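(* Let $\mu$ be a Carleson measure on $\mathbb R_+$ such that $H_\mu\neq0$, and let $H_\mu^\perp=H_\mu|_{(\operatorname{Ker}H_\mu)^\perp}$. Then the spectrum of $H_\mu^\perp$ is the closure of the set of those $E>0$ for which the Hankel equation $$\int_0^\infty h_\mu(t+s)f(s)\,ds=Ef(t),\quad t>0,$$ has a non-zero solution $f\in\mathcal B_0$.
   Context: $\mathbb R_+=(0,\infty)$. A (non-negative Borel) measure $\mu$ on $\mathbb R_+$ is Carleson if there is a constant $C_\mu$ with $\mu([0,a))\le C_\mu a$ for all $a>0$. For such $\mu$ put $h_\mu(t)=\int_0^\infty e^{-t\lambda}\,d\mu(\lambda)$, $t>0$, and let $H_\mu$ be the integral Hankel operator $(H_\mu f)(t)=\int_0^\infty h_\mu(t+s)f(s)\,ds$ on $L^2(\mathbb R_+)$; it is bounded, self-adjoint and positive semi-definite. For $\varepsilon\in(0,\tfrac12)$, a measurable function $f$ on $\mathbb R_+$ belongs to $\mathcal B_\varepsilon$ if there is $C_\varepsilon>0$ with $|f(t)|\le C_\varepsilon t^{-\frac12-\varepsilon}$ for $0<t<1$ and $|f(t)|\le C_\varepsilon t^{-\frac12+\varepsilon}$ for $t>1$; $\mathcal B_0=\bigcap_{\varepsilon\in(0,1/2)}\mathcal B_\varepsilon$. For $f\in\mathcal B_0$ the integral in the Hankel equation converges absolutely; $f$ need not be in $L^2(\mathbb R_+)$. *)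

(* Defs.v *)
From HB Require Import structures.
From mathcomp Require Import all_boot all_order all_algebra.
From mathcomp Require Import complex.
From mathcomp Require Import all_classical all_reals all_analysis.

Set Implicit Arguments.
Unset Strict Implicit.
Unset Printing Implicit Defensive.

Import Order.TTheory GRing.Theory Num.Theory.
Import numFieldNormedType.Exports.

Local Open Scope classical_set_scope.
Local Open Scope ring_scope.
Local Open Scope complex_scope.

Definition Rplus {R : realType} : set R := `]0, +oo[.

(* A function on Rplus is a total function on R whose values outside Rplus are
   irrelevant; elements of L^2(Rplus) are such functions up to [aeq]. *)
Section complex_functions.
Context {R : realType}.
Implicit Types f g : R -> R[i].

Definition aeq f g : Prop := ae_eq (@lebesgue_measure R) Rplus f g.

Definition cmeasurable f : Prop :=
  measurable_fun (Rplus : set R) (fun t => complex.Re (f t)) /\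
  measurable_fun (Rplus : set R) (fun t => complex.Im (f t)).

Definition cintegral f : R[i] :=
  (\int[@lebesgue_measure R]_(t in Rplus) complex.Re (f t)) +i*
  (\int[@lebesgue_measure R]_(t in Rplus) complex.Im (f t)).

Definition L2norm f : \bar R :=
  'N[@lebesgue_measure R]_2%:E[(EFin \o (fun t => Normc.normc (f t))) \_ Rplus].

Definition L2 : set (R -> R[i]) :=
  [set f | cmeasurable f /\ (L2norm f < +oo)%E].

Definition L2inner f g : R[i] := cintegral (fun t => f t * (g t)^*).

End complex_functions.

(* Operators are given on representatives. *)
Section operators.
Context {R : realType}.
Implicit Types (A : (R -> R[i]) -> (R -> R[i])) (V : set (R -> R[i])).

Definition opKer A : set (R -> R[i]) := [set f | L2 f /\ aeq (A f) (cst 0)].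

Definition L2orth V : set (R -> R[i]) :=
  [set f | L2 f /\ forall g, V g -> L2inner f g = 0].

(* [A - z] is a bijection of [V] with bounded inverse. *)
Definition resolvent_set V A : set R[i] :=
  [set z | exists C : R, forall g, V g ->
    exists f, [/\ V f,
      aeq (fun t => A f t - z * f t) g,
      (L2norm f <= C%:E * L2norm g)%E &
      forall f', V f' -> aeq (fun t => A f' t - z * f' t) g -> aeq f' f]].

Definition spectrum V A : set R[i] := ~` resolvent_set V A.

End operators.

Section hankel.
Context {R : realType}.
Implicit Types (mu : {measure set (measurableTypeR R) -> \bar R})
  (f : R -> R[i]).

(* Borel measures on Rplus are Borel measures on R carried by Rplus. *)
Definition carleson mu : Prop :=
  mu [set` `]-oo, 0%R]] = 0%E /\
  exists C : R, forall a : R, 0 < a -> (mu [set` `[0%R, a[] <= (C * a)%:E)%E.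

Definition hankel_kernel mu (t : R) : R :=
  \int[mu]_(l in Rplus) expR (- (t * l)).

Definition hankel mu f (t : R) : R[i] :=
  cintegral (fun s => (hankel_kernel mu (t + s))%:C * f s).

Definition Beps (eps : R) : set (R -> R[i]) :=
  [set f | cmeasurable f /\ exists2 C : R, 0 < C &
    (forall t : R, 0 < t < 1 ->
       Normc.normc (f t) <= C * t `^ (- 2^-1 - eps)) /\
    (forall t : R, 1 < t ->
       Normc.normc (f t) <= C * t `^ (- 2^-1 + eps))].

Definition B0 : set (R -> R[i]) :=
  [set f | forall eps : R, 0 < eps < 2^-1 -> Beps eps f].

Definition hankel_equation mu (E : R) f : Prop :=
  forall t, 0 < t -> hankel mu f t = E%:C * f t.

End hankel.

(* Main.v *)
Require Import Defs.
From HB Require Import structures.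
From mathcomp Require Import all_boot all_order all_algebra.
From mathcomp Require Import complex.
From mathcomp Require Import all_classical all_reals all_analysis.
From mathcomp Require Import measurable_realfun spectral sesquilinear ring lra.

Set Implicit Arguments.
Unset Strict Implicit.
Unset Printing Implicit Defensive.

Import Order.TTheory GRing.Theory Num.Theory.
Import numFieldNormedType.Exports.

Local Open Scope classical_set_scope.
Local Open Scope ring_scope.

(** Let [H] be the Hankel operator with kernel function [h], [V] the orthogonal
    complement of its null space and [S] the set of generalized eigenvalues,
    that is, of those [E > 0] for which the Hankel equation has a non-zero
    solution in the class [B0]. Since [h] is real, [H] acts separately on real
    and imaginary parts, and the analysis is done for real functions. It uses
    only that [0 <= h t <= C / t], that [h] is locally Lipschitz at the
    corresponding scale, and that [h (t + s)] is a positive definite kernel;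
    [hankel_like_kernel] derives these properties from the Carleson condition.
    The point of the bound [C / t] is that in the variable [ln t] the kernel [h
    (t + s)], normalised by [sqrt (t * s)], decays exponentially off the
    diagonal, whereas a function of [B0], normalised by [sqrt t], grows more
    slowly than any exponential.

    The closure of [S] lies in the spectrum. Damping a generalized
    eigenfunction [f] by [max t (1 / t) `^ (- e)] makes it square integrable,
    and by the exponential decay of the kernel the damped function solves the
    equation up to an error of relative size [O(e)]
    ([schnol_quasimode]). Applying [H] moves it into [V], and a sequence of
    approximate eigenfunctions in [V] rules out a bounded inverse
    ([near_eigenvalue_spectrum]).

    The spectrum lies in the closure of [S]. If [H - z] is bounded below on the
    images [H chi] of a suitable class of test functions [chi], then
    [(H - a) ^ 2 + b ^ 2], with [z = a +i* b], can be inverted on [V] by a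
    variational argument ([coercive_form_solution],
    [coercive_square_solvable]), and so can [H - z]. For non-real [z] the lower
    bound is immediate. For a real [E0] at distance more than [del] from [S] it
    takes the place of an expansion in generalized eigenfunctions
    ([generalized_eigenfunction_near]). Suppose that it fails for some
    [chi]. Discretise the equation on a grid that is uniform in [ln t]. For
    positive semidefinite matrices the spectral theorem turns the failure into
    the existence of an eigenvector with eigenvalue within [del] of [E0] and
    bounded away from 0, normalised by its pairing with [chi], whose
    mean-square norm with a weight [(1 + |ln t|) ^- 2] is bounded by a trace,
    uniformly in the grid ([eigenvector_selection]). Through the eigenvalue
    equation these bounds improve to pointwise bounds of the kind that define
    [B0] and to equicontinuity, so a subsequence converges to a solution in
    [B0], which is non-zero because its pairing with [chi] is 1. Its
    eigenvalue lies in [S] within [del] of [E0], a contradiction. *)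

(** * Integration and square-integrable functions on the half-line *)

Lemma le_of_eq d (T : porderType d) (x y : T) : x = y -> (x <= y)%O.
Proof. by move=> ->. Qed.

Section real_tools.
Context {R : realType}.
Implicit Types (f g : R -> R) (u : nat -> R -> R).
Notation leb := (@lebesgue_measure R).

Definition itg f : Prop := leb.-integrable Rplus (EFin \o f).
Definition Int f : R := \int[leb]_(t in Rplus) f t.

Lemma RplusE (x : R) : Rplus x <-> 0 < x.
Proof. by rewrite /Rplus /= in_itv /= andbT. Qed.

Lemma in_Rplus (x : R) : (x \in (Rplus : set R)) = (0 < x).
Proof. by apply/idP/idP => [/set_mem/RplusE//|/RplusE/mem_set]. Qed.

Lemma mRplus : measurable (Rplus : set R).
Proof. exact: measurable_itv. Qed.
Hint Resolve mRplus : core.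

Lemma itg0 : itg (cst 0).
Proof. exact: integrable0. Qed.

Lemma eq_itg f g : (forall x : R, 0 < x -> f x = g x) -> itg f -> itg g.
Proof.
move=> fg; apply: eq_integrable => // x; rewrite in_Rplus => x0.
by rewrite /= fg.
Qed.

Lemma eq_Int f g : (forall x : R, 0 < x -> f x = g x) -> Int f = Int g.
Proof. by move=> fg; apply: eq_Rintegral => x; rewrite in_Rplus => /fg. Qed.

Lemma itgD f g : itg f -> itg g -> itg (fun x => f x + g x).
Proof. exact: integrableD. Qed.

Lemma itgB f g : itg f -> itg g -> itg (fun x => f x - g x).
Proof. exact: integrableB. Qed.

Lemma itgZ (c : R) f : itg f -> itg (fun x => c * f x).
Proof. exact: integrableZl. Qed.

Lemma itg_sum (I : Type) (s : seq I) (F : I -> R -> R) :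
  (forall i, itg (F i)) -> itg (fun x => \sum_(i <- s) F i x).
Proof.
move=> iF; elim: s => [|i s IH].
  by apply: eq_itg itg0 => x _; rewrite big_nil.
by apply: eq_itg (itgD (iF i) IH) => x _; rewrite big_cons.
Qed.

Lemma IntD f g : itg f -> itg g -> Int (fun x => f x + g x) = Int f + Int g.
Proof. exact: RintegralD. Qed.

Lemma IntB f g : itg f -> itg g -> Int (fun x => f x - g x) = Int f - Int g.
Proof. exact: RintegralB. Qed.

Lemma IntZ (c : R) f : itg f -> Int (fun x => c * f x) = c * Int f.
Proof. exact: RintegralZl. Qed.

Lemma Int0 : Int (cst 0) = 0.
Proof. by rewrite /Int /Rintegral integral0. Qed.

Lemma Int_sum (I : Type) (s : seq I) (F : I -> R -> R) :
  (forall i, itg (F i)) ->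
  Int (fun x => \sum_(i <- s) F i x) = \sum_(i <- s) Int (F i).
Proof.
move=> iF; elim: s => [|i s IH].
  by rewrite big_nil -[RHS]Int0; apply: eq_Int => x _; rewrite big_nil.
rewrite big_cons -IH -IntD//; last exact: itg_sum.
by apply: eq_Int => x _; rewrite big_cons.
Qed.

Lemma le_Int f g : itg f -> itg g -> (forall x : R, 0 < x -> f x <= g x) ->
  Int f <= Int g.
Proof. by move=> jf jg fg; apply: le_Rintegral => // x /RplusE; exact: fg. Qed.

Lemma Int_ge0 f : (forall x : R, 0 < x -> 0 <= f x) -> 0 <= Int f.
Proof. by move=> f0; apply: Rintegral_ge0 => x /RplusE; exact: f0. Qed.

Lemma itg_le f g : measurable_fun Rplus f -> itg g ->
  (forall x : R, 0 < x -> `|f x| <= g x) -> itg f.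
Proof.
move=> mf ig fg; apply: (le_integrable _ _ _ ig) => //.
  exact/measurable_EFinP.
move=> x /RplusE x0 /=; rewrite lee_fin (le_trans (fg _ x0))//.
exact: ler_norm.
Qed.

Lemma itg_norm f : itg f -> itg (fun x => `|f x|).
Proof. exact: integrable_norm. Qed.

Lemma norm_Int f g : itg f -> itg g -> (forall x : R, 0 < x -> `|f x| <= g x) ->
  `|Int f| <= Int g.
Proof.
move=> jf jg fg; apply: le_trans (le_normr_Rintegral _ jf) _ => //.
by apply: le_Int => //; exact: itg_norm.
Qed.

Lemma EFin_Int f : itg f -> (Int f)%:E = (\int[leb]_(t in Rplus) (f t)%:E)%E.
Proof. by move=> jf; rewrite /Int /Rintegral fineK//; exact: integrable_fin_num. Qed.

Lemma itg_ge0P f (M : R) : measurable_fun Rplus f ->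
  (forall x : R, 0 < x -> 0 <= f x) ->
  (\int[leb]_(t in Rplus) (f t)%:E <= M%:E)%E -> itg f /\ Int f <= M.
Proof.
move=> mf f0 fM; have jf : itg f.
  apply/integrableP; split; first exact/measurable_EFinP.
  apply: le_lt_trans (ltry M); apply: le_trans fM.
  apply: le_of_eq; apply: eq_integral => x.
  by rewrite in_Rplus => x0; rewrite /= ger0_norm// f0.
by split => //; rewrite -lee_fin EFin_Int.
Qed.

Lemma Int_dominated_cvg u f g : (forall n, measurable_fun Rplus (u n)) ->
  (forall x : R, 0 < x -> u n x @[n --> \oo] --> f x) -> itg g ->
  (forall n (x : R), 0 < x -> `|u n x| <= g x) ->
  itg f /\ Int (u n) @[n --> \oo] --> Int f.
Proof.
move=> mu cu jg ug.
have mf : measurable_fun Rplus f.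
  by apply: measurable_fun_cvg mu _ => x /RplusE; exact: cu.
have [||||jf _ cvI] := @dominated_convergence _ _ R leb _ mRplus
  (fun n => EFin \o u n) (EFin \o f) (EFin \o g) _ _ _ jg.
- by move=> n; apply/measurable_EFinP; exact: mu.
- by apply/measurable_EFinP.
- apply: aeW => x /RplusE x0; apply: cvg_comp (cu _ x0) _ => //.
- by apply: aeW => x n /RplusE x0; rewrite lee_fin ug.
split => //; apply: fine_cvg; rewrite EFin_Int//; exact: cvI.
Qed.

End real_tools.

Section basic_integral.
Context {R : realType}.
Notation leb := (@lebesgue_measure R).

Lemma is_derive_explog (b c s : R) : b != 0 -> 0 < s ->
  is_derive s 1 (fun s => b^-1 * expR (b * (ln s - c)))
    (expR (b * (ln s - c) - ln s)).
Proof.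
move=> b0 s0.
have h1 : is_derive s 1 (fun s : R => b * (ln s - c)) (b * s^-1).
  have := is_derive1_ln s0 => hln.
  by apply: is_derive_eq; rewrite subr0.
have h2 := @is_derive1_comp _ expR (fun s => b * (ln s - c)) _ _ _
    (is_derive_expR (b * (ln s - c))) h1.
have h3 : is_derive s 1 (fun s => b^-1 * expR (b * (ln s - c)))
   (b^-1 * (expR (b * (ln s - c)) * (b * s^-1))).
  exact: (is_deriveZ _ h2).
apply: is_derive_eq; rewrite expRD expRN lnK ?posrE//.
by field; rewrite b0 gt_eqF.
Qed.

(** On each side of [ln s = c] the integrand [expR (- ln s - a * `|ln s - c|)]
    is an exact derivative; [b] is [a] on the left and [- a] on the right. *)
Lemma int_explog (b c x y : R) : b != 0 -> 0 < x -> x < y ->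
  (\int[leb]_(s in `[x, y]) (expR (b * (ln s - c) - ln s))%:E =
   (b^-1 * expR (b * (ln y - c)))%:E - (b^-1 * expR (b * (ln x - c)))%:E)%E.
Proof.
move=> b0 x0 xy.
have dF s : 0 < s -> {for s, continuous (fun s => b^-1 * expR (b * (ln s - c)))}.
  move=> s0; apply: differentiable_continuous; apply/derivable1_diffP.
  by have [] := is_derive_explog c b0 s0.
apply: (continuous_FTC2 (F := fun s => b^-1 * expR (b * (ln s - c)))) => //.
- apply: continuous_in_subspaceT => s; rewrite inE/= in_itv/= => /andP[xs _].
  have s0 : 0 < s by exact: lt_le_trans xs.
  apply: continuous_comp; last exact: continuous_expR.
  apply: cvgB; last exact: continuous_ln.
  apply: cvgM; first exact: cvg_cst.
  by apply: cvgB; [exact: continuous_ln|exact: cvg_cst].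
- split.
  + move=> s; rewrite in_itv/= => /andP[xs _].
    by have [] := is_derive_explog c b0 (lt_trans x0 xs).
  + by apply: cvg_at_right_filter; apply: dF.
  + by apply: cvg_at_left_filter; apply: dF; exact: lt_trans xy.
- move=> s; rewrite in_itv/= => /andP[xs _]; rewrite derive1E.
  by have [_ ->] := is_derive_explog c b0 (lt_trans x0 xs).
Qed.

Lemma continuous_measurable_Rplus (f : R -> R) :
  (forall s, 0 < s -> {for s, continuous f}) -> measurable_fun Rplus f.
Proof.
move=> cf; apply: open_continuous_measurable_fun; first exact: interval_open.
by move=> s; rewrite in_Rplus; exact: cf.
Qed.

Lemma measurable_lnRplus : measurable_fun Rplus (@ln R).
Proof. by apply: continuous_measurable_Rplus => s; exact: continuous_ln. Qed.

Lemma measurable_explog (a c : R) :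
  measurable_fun Rplus (fun s : R => expR (- ln s - a * `|ln s - c|)).
Proof.
apply: measurableT_comp => //; apply: measurable_funB.
  by apply: measurableT_comp => //; exact: measurable_lnRplus.
apply: measurable_funM => //; apply: measurableT_comp => //.
by apply: measurable_funB => //; exact: measurable_lnRplus.
Qed.

Lemma int_explog_seg (a c : R) (n : nat) : 0 < a ->
  (\int[leb]_(s in `[expR (c - n.+1%:R), expR (c + n.+1%:R)])
     (expR (- ln s - a * `|ln s - c|))%:E <= (2 / a)%:E)%E.
Proof.
move=> a0; set x := expR _; set y := expR (c + _); pose m := expR c.
have x0 : 0 < x by exact: expR_gt0.
have xm : x < m by rewrite ltr_expR gtrBl.
have my : m < y by rewrite ltr_expR ltrDl.
have m0 : 0 < m by exact: expR_gt0.
have sub (z w : R) : 0 < z -> `[z, w]%classic `<=` (Rplus : set R).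
  by move=> z0 s; rewrite /= in_itv/= => /andP[zs _]; apply/RplusE; exact: lt_le_trans zs.
have mf (z w : R) : 0 < z -> measurable_fun `[z, w]%classic
    (fun s : R => (expR (- ln s - a * `|ln s - c|))%:E).
  move=> z0; apply/measurable_EFinP.
  by apply: measurable_funS (measurable_explog a c); [exact: measurable_itv|exact: sub].
rewrite (@itv_bndbnd_setU _ _ _ (BRight m)) ?bnd_simp; [|exact: ltW..].
rewrite ge0_integral_setU//=; last 2 first.
- rewrite -itv_bndbnd_setU ?bnd_simp; [exact: mf|exact: ltW..].
- apply/disj_setPS => s [/=]; rewrite !in_itv/= => /andP[_ sm] /andP[].
  by rewrite ltNge sm.
rewrite integral_itv_obnd_cbnd; last by apply: measurable_funS (mf m y m0) => //; exact: subset_itv_oc_cc.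
rewrite (@eq_integral _ _ _ leb `[x, m]%classic
   (fun s => (expR (a * (ln s - c) - ln s))%:E)); last first.
  move=> s; rewrite inE/= in_itv/= => /andP[xs sm].
  have : ln s <= c by rewrite -(expRK c) ler_ln ?posrE//; exact: lt_le_trans xs.
  by move=> sc; rewrite ler0_norm ?subr_le0//; congr (expR _)%:E; ring.
rewrite (@eq_integral _ _ _ leb `[m, y]%classic
   (fun s => (expR (- a * (ln s - c) - ln s))%:E)); last first.
  move=> s; rewrite inE/= in_itv/= => /andP[ms sy].
  have : c <= ln s by rewrite -(expRK c) ler_ln ?posrE//; exact: lt_le_trans ms.
  by move=> sc; rewrite ger0_norm ?subr_ge0//; congr (expR _)%:E; ring.
rewrite !int_explog ?oppr_eq0 ?gt_eqF// !expRK.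
rewrite subrr !mulr0 expR0 -!EFinB -EFinD lee_fin mulr1.
rewrite invrN !mulNr mulr1 opprK.
have p1 : 0 <= a^-1 * expR (a * (c - n.+1%:R - c)) by rewrite mulr_ge0 ?expR_ge0 ?invr_ge0 ?ltW.
have p2 : 0 <= a^-1 * expR (- (a * (c + n.+1%:R - c))) by rewrite mulr_ge0 ?expR_ge0 ?invr_ge0 ?ltW.
lra.
Qed.

Lemma cvge_le_lim (u : nat -> \bar R) (l M : \bar R) :
  u n @[n --> \oo] --> l -> (forall n, (u n <= M)%E) -> (l <= M)%E.
Proof.
move=> ul uM; rewrite -(cvg_lim _ ul)//; apply: lime_le; last exact: nearW.
by apply/cvg_ex; exists l.
Qed.

(** In the variable [ln s] this is the integral of a two-sided exponential.
    All integral estimates for kernels and weights reduce to it. *)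
Lemma itg_explog (a c : R) : 0 < a ->
  itg (fun s => expR (- ln s - a * `|ln s - c|)) /\
  Int (fun s => expR (- ln s - a * `|ln s - c|)) <= 2 / a.
Proof.
move=> a0; apply: itg_ge0P; first exact: measurable_explog.
  by move=> x _; exact: expR_ge0.
pose F n := `[expR (c - n.+1%:R), expR (c + n.+1%:R)]%classic : set R.
have sF n : F n `<=` (Rplus : set R).
  move=> s; rewrite /F /= in_itv/= => /andP[zs _]; apply/RplusE; apply: lt_le_trans zs.
  exact: expR_gt0.
have -> : (Rplus : set R) = \bigcup_n F n.
  apply/seteqP; split => [s /RplusE s0|s [n _]]; last exact: sF.
  pose n := Num.bound (ln s - c).
  exists n => //; rewrite /F /= in_itv/=.
  have h : `|ln s - c| <= n.+1%:R.
    rewrite (le_trans (ltW (archi_boundP (normr_ge0 _))))//.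
    by rewrite /n /Num.bound normr_id ler_nat leqnSn.
  move: h; rewrite ler_distl => /andP[h1 h2].
  by rewrite -[X in _ <= X <= _]lnK ?posrE// !ler_expR h1 h2.
have cF := @ge0_nondecreasing_set_cvg_integral _ (measurableTypeR R) R F
  (fun s => (expR (- ln s - a * `|ln s - c|))%:E) leb.
apply: (cvge_le_lim (cF _ _ _ _)).
- move=> i j ij; apply/subsetPset => s; rewrite /F/= !in_itv/= => /andP[h1 h2].
  apply/andP; split; [apply: le_trans h1|apply: le_trans h2 _]; rewrite ler_expR.
    by rewrite lerD2l lerN2 ler_nat.
  by rewrite lerD2l ler_nat.
- by move=> i; exact: measurable_itv.
- move=> i; apply/measurable_EFinP.
  by apply: measurable_funS (measurable_explog a c) => //; exact: mRplus.
- by move=> i x _; rewrite lee_fin expR_ge0.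
- by move=> n; exact: int_explog_seg.
Qed.

End basic_integral.

Section square_integrable.
Context {R : realType}.
Implicit Types (f g k : R -> R).
Notation leb := (@lebesgue_measure R).

Definition sqi f : Prop := measurable_fun Rplus f /\ itg (fun x => f x ^+ 2).
Definition ip f g : R := Int (fun x => f x * g x).

Lemma sqi_ip f : sqi f -> itg (fun x => f x * f x).
Proof. by case=> _; apply: eq_itg. Qed.

Lemma sqiM f g : sqi f -> sqi g -> itg (fun x => f x * g x).
Proof.
move=> [mf jf] [mg jg]; apply: (itg_le _ (itgD jf jg)).
  exact: measurable_funM.
move=> x _; rewrite normrM.
have := sqr_ge0 (`|f x| - `|g x|); rewrite sqrrB !real_normK ?num_real//.
have := mulr_ge0 (normr_ge0 (f x)) (normr_ge0 (g x)); lra.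
Qed.

Lemma sqi0 : sqi (fun _ : R => 0).
Proof.
split; first exact: measurable_cst.
by apply: eq_itg itg0 => x _; rewrite expr0n.
Qed.

Lemma sqiD f g : sqi f -> sqi g -> sqi (fun x => f x + g x).
Proof.
move=> sf sg; split; first exact: measurable_funD sf.1 sg.1.
apply: eq_itg (itgD sf.2 (itgD (itgZ 2 (sqiM sf sg)) sg.2)) => x _; ring.
Qed.

Lemma sqiZ (c : R) f : sqi f -> sqi (fun x => c * f x).
Proof.
move=> sf; split; first by apply: measurable_funM => //; exact: sf.1.
by apply: eq_itg (itgZ (c ^+ 2) sf.2) => x _; rewrite exprMn.
Qed.

Lemma eq_sqi f g : (forall x : R, 0 < x -> f x = g x) -> sqi f -> sqi g.
Proof.
move=> fg [mf jf]; split.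
  by apply: eq_measurable_fun mf => x; rewrite in_Rplus; exact: fg.
by apply: eq_itg jf => x x0; rewrite fg.
Qed.

Lemma sqiB f g : sqi f -> sqi g -> sqi (fun x => f x - g x).
Proof.
move=> sf sg; apply: eq_sqi (sqiD sf (sqiZ (-1) sg)) => x _.
by rewrite mulN1r.
Qed.

Lemma sqi_le f g : measurable_fun Rplus f -> sqi g ->
  (forall x : R, 0 < x -> `|f x| <= g x) -> sqi f.
Proof.
move=> mf [_ jg] fg; split => //; apply: (itg_le _ jg).
  by apply: measurable_funX.
move=> x x0; rewrite ger0_norm ?sqr_ge0// -real_normK ?num_real//.
by rewrite lerXn2r ?nnegrE// ?fg// (le_trans _ (fg _ x0)).
Qed.

Lemma ipC f g : ip f g = ip g f.
Proof. by apply: eq_Int => x _; rewrite mulrC. Qed.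

Lemma ipDl f g k : sqi f -> sqi g -> sqi k ->
  ip (fun x => f x + g x) k = ip f k + ip g k.
Proof.
move=> sf sg sk; rewrite -IntD; [|exact: sqiM..].
by apply: eq_Int => x _; rewrite mulrDl.
Qed.

Lemma ipZl (c : R) f k : sqi f -> sqi k -> ip (fun x => c * f x) k = c * ip f k.
Proof.
move=> sf sk; rewrite -IntZ; last exact: sqiM.
by apply: eq_Int => x _; rewrite mulrA.
Qed.

Lemma ipBl f g k : sqi f -> sqi g -> sqi k ->
  ip (fun x => f x - g x) k = ip f k - ip g k.
Proof.
move=> sf sg sk; rewrite -IntB; [|exact: sqiM..].
by apply: eq_Int => x _; rewrite mulrBl.
Qed.

Lemma ipDr f g k : sqi f -> sqi g -> sqi k ->
  ip k (fun x => f x + g x) = ip k f + ip k g.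
Proof. by move=> *; rewrite ipC ipDl// !(ipC k). Qed.

Lemma ipZr (c : R) f k : sqi f -> sqi k -> ip k (fun x => c * f x) = c * ip k f.
Proof. by move=> *; rewrite ipC ipZl// (ipC k). Qed.

Lemma ipBr f g k : sqi f -> sqi g -> sqi k ->
  ip k (fun x => f x - g x) = ip k f - ip k g.
Proof. by move=> *; rewrite ipC ipBl// !(ipC k). Qed.

Lemma ip_ge0 f : 0 <= ip f f.
Proof. by apply: Int_ge0 => x _; rewrite -expr2 sqr_ge0. Qed.

(** Optimising the parameter in the inequality 2T <= c a + b / c; a form of
    Cauchy-Schwarz that applies to sums and integrals without discussing
    degenerate cases. *)
Lemma sqr_le_of_young (T a b : R) : 0 <= a -> 0 <= b ->
  (forall c : R, 0 < c -> 2 * T <= c * a + b / c) -> 0 <= T -> T ^+ 2 <= a * b.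
Proof.
move=> a0 b0 H T0.
have [aE|aN] := eqVneq a 0.
  rewrite aE mul0r; suff -> : T = 0 by rewrite expr0n.
  apply/eqP; rewrite eq_le T0 andbT; apply/ler_addgt0Pl => e e0; rewrite addr0.
  have := H ((b + 1) / e) (divr_gt0 (ltr_wpDl b0 ltr01) e0).
  rewrite aE mulr0 add0r invf_div => h.
  have : b * (e / (b + 1)) <= e.
    by rewrite mulrCA ger_pMr// ler_pdivrMr ?mul1r ?lerDl// ltr_wpDl.
  lra.
have a1 : 0 < a by rewrite lt_neqAle eq_sym aN.
have [->|TN] := eqVneq T 0; first by rewrite expr0n mulr_ge0.
have T1 : 0 < T by rewrite lt_neqAle eq_sym TN.
have := H (T / a) (divr_gt0 T1 a1).
rewrite divfK// invf_div => h.
have : T * T <= T * (b * (a / T)) by rewrite ler_pM2l//; lra.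
by rewrite (_ : T * (b * (a / T)) = a * b); [|by field].
Qed.

Lemma sqr_le_of_quadratic (T a b : R) : 0 <= b ->
  (forall t : R, 0 <= a + 2 * t * T + t ^+ 2 * b) -> T ^+ 2 <= a * b.
Proof.
move=> b0 H; have a0 : 0 <= a.
  by have := H 0; rewrite mulr0 mul0r expr0n mul0r !addr0.
rewrite -real_normK ?num_real//; apply: sqr_le_of_young => // c c0.
have H2 t : 0 <= c * a + b * (c * t ^+ 2) + 2 * (c * t) * T.
  by have := mulr_ge0 (ltW c0) (H t); lra.
have ce : c * c^-1 ^+ 2 = c^-1 by rewrite expr2 mulrA divff ?gt_eqF// mul1r.
have := H2 (c^-1); have := H2 (- c^-1).
rewrite sqrrN ce mulrN divff ?gt_eqF// !mulr1 mulrN1.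
move: (c * _) (_ / c) => A B h1 h2; case: (ger0P T) => _; lra.
Qed.

Lemma ip_addsq f g (c : R) : sqi f -> sqi g ->
  ip (fun x => f x + c * g x) (fun x => f x + c * g x) =
  ip f f + 2 * c * ip f g + c ^+ 2 * ip g g.
Proof.
move=> sf sg; have scg := sqiZ c sg.
rewrite ipDl ?ipDr ?ipZl ?ipZr//; last exact: sqiD.
rewrite (ipC g f); ring.
Qed.

Lemma ip_cs f g : sqi f -> sqi g -> ip f g ^+ 2 <= ip f f * ip g g.
Proof.
move=> sf sg; apply: sqr_le_of_quadratic; rewrite ?ip_ge0// => e.
by rewrite -ip_addsq// ip_ge0.
Qed.

Definition aez f : Prop := ae_eq leb Rplus f (cst 0).

Lemma ip0_aez f : sqi f -> ip f f = 0 -> aez f.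
Proof.
move=> [mf jf] f0.
have j2 : measurable_fun Rplus (fun x => (f x ^+ 2)%:E).
  by apply/measurable_EFinP; exact: measurable_funX.
have /(ae_eq_integral_abs leb mRplus j2) : (\int[leb]_(x in Rplus) `|(f x ^+ 2)%:E| = 0)%E.
  transitivity (\int[leb]_(x in Rplus) (f x ^+ 2)%:E)%E.
    by apply: eq_integral => x _; rewrite gee0_abs// lee_fin sqr_ge0.
  by rewrite -EFin_Int//; congr EFin; exact: f0.
move=> h; rewrite /aez /ae_eq; apply: filterS h => x /[apply] /eqP.
by rewrite eqe sqrf_eq0 => /eqP ->.
Qed.

Lemma ae_Int f g : measurable_fun Rplus f -> measurable_fun Rplus g ->
  ae_eq leb Rplus f g -> Int f = Int g.
Proof.
move=> mf mg fg; congr fine; apply: ae_eq_integral => //.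
- exact: mRplus.
- exact/measurable_EFinP.
- exact/measurable_EFinP.
- by apply: filterS fg => x /= /[apply] ->.
Qed.

End square_integrable.

Section completeness.
Context {R : realType}.
Notation leb := (@lebesgue_measure R).

Lemma cvg_le_lim (u : nat -> R) (l M : R) (N : nat) :
  u n @[n --> \oo] --> l -> (forall n, (N <= n)%N -> u n <= M) -> l <= M.
Proof.
move=> ul uM; rewrite -(cvg_lim _ ul)//; apply: limr_le.
  by apply/cvg_ex; exists l.
by near=> n; apply: uM; near: n; exists N.
Unshelve. all: by end_near. Qed.

Lemma sum_expr_half_le (n : nat) : \sum_(0 <= k < n) (2^-1 : R) ^+ k <= 2.
Proof.
suff -> : \sum_(0 <= k < n) (2^-1 : R) ^+ k = 2 - 2 * 2^-1 ^+ n.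
  by rewrite gerBl mulr_ge0// exprn_ge0.
elim: n => [|n IH]; first by rewrite expr0 mulr1 subrr big_geq.
rewrite big_nat_recr//= IH exprS; by field.
Qed.

(** The uniform bound provides the dominating function in the proof of
    completeness. *)
Lemma geometric_steps_cvg (v : nat -> R) (M : R) :
  (forall k, `|v k.+1 - v k| <= M * 2^-1 ^+ k) ->
  cvgn v /\ forall k, `|v k| <= `|v 0%N| + 2 * M.
Proof.
move=> vM.
have M0 : 0 <= M by have := vM 0%N; rewrite expr0 mulr1; exact: le_trans.
split.
  have -> : v = (fun n => v 0%N + series (telescope v) n).
    by apply/funext => n; rewrite -eq_sum_telescope.
  apply: is_cvgD; first exact: is_cvg_cst.
  apply: normed_cvg; apply: (@series_le_cvg _ _ (geometric M 2^-1)).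
  - by move=> n; rewrite normr_ge0.
  - by move=> n; rewrite /geometric/= mulr_ge0// exprn_ge0.
  - by move=> n; exact: vM.
  - by apply: is_cvg_geometric_series; rewrite ger0_norm; lra.
move=> k; have -> : v k = v 0%N + \sum_(0 <= j < k) (v j.+1 - v j).
  by rewrite telescope_sumr// addrC subrK.
apply: le_trans (ler_normD _ _) _; rewrite lerD2l.
apply: le_trans (ler_norm_sum _ _ _) _.
apply: (@le_trans _ _ (\sum_(0 <= j < k) M * 2^-1 ^+ j)).
  by apply: ler_sum => j _; exact: vM.
by rewrite -mulr_sumr mulrC ler_wpM2r// sum_expr_half_le.
Qed.

(** The function [s] is the sum of [4 ^+ k * d k ^+ 2], integrable because the
    norms decay like [8^-1 ^+ k]; [E] is the set where that sum is finite. The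
    pointwise decay that remains is geometric, hence summable. *)
Lemma summable_squares_ae (d : nat -> R -> R) :
  (forall k, sqi (d k)) -> (forall k, ip (d k) (d k) <= 8^-1 ^+ k) ->
  exists (E : set R) (s : R -> R),
    [/\ measurable E,
        (forall f g : R -> R, (forall x : R, 0 < x -> E x -> f x = g x) ->
           ae_eq leb Rplus f g), itg s,
        (forall x : R, 0 < x -> 0 <= s x) &
        forall k (x : R), 0 < x -> E x -> d k x ^+ 2 <= 4^-1 ^+ k * s x].
Proof.
move=> sd dk.
pose S x := (\sum_(0 <= k <oo) (4 ^+ k * d k x ^+ 2)%:E)%E.
have md k : measurable_fun Rplus (fun x => (4 ^+ k * d k x ^+ 2)%:E).
  apply/measurable_EFinP; apply: measurable_funM => //.
  by apply: measurable_funX; exact: (sd k).1.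
have pos k x : (0%R <= (4 ^+ k * d k x ^+ 2)%:E)%E.
  by rewrite lee_fin mulr_ge0 ?sqr_ge0// exprn_ge0.
have mS : measurable_fun Rplus S.
  apply: (@ge0_emeasurable_sum _ _ _ Rplus
    (fun k x => (4 ^+ k * d k x ^+ 2)%:E) xpredT) => [k x _ _|k _].
    exact: pos.
  exact: md.
have S0 x : (0%R <= S x)%E by apply: nneseries_ge0 => k _ _; exact: pos.
have iS : (\int[leb]_(x in Rplus) S x <= 2%:E)%E.
  rewrite /S integral_nneseries//; first last.
    exact: mRplus.
  apply: lime_le; first by apply: is_cvg_nneseries => k _ _; exact: integral_ge0.
  apply: nearW => n.
  apply: (@le_trans _ _ (\sum_(0 <= k < n) ((2^-1 : R) ^+ k)%:E)%E).
    apply: lee_sum => k _.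
    rewrite -EFin_Int; last by apply: itgZ; exact: (sd k).2.
    rewrite lee_fin IntZ; last exact: (sd k).2.
    apply: le_trans (ler_wpM2l _ (dk k)) _; first exact: exprn_ge0.
    by rewrite -exprMn (_ : 4 * 8^-1 = 2^-1 :> R)//; field.
  by rewrite sumEFin lee_fin sum_expr_half_le.
have jS : leb.-integrable Rplus S.
  apply/integrableP; split => //; apply: le_lt_trans (ltry 2).
  apply: le_trans iS; apply: le_of_eq.
  by apply: eq_integral => x _; rewrite gee0_abs.
pose E := Rplus `&` [set x | S x \is a fin_num].
exists E, (fun x => fine (S x)); split.
- by apply: emeasurable_fin_num => //; exact: mRplus.
- have h := @integrable_ae _ _ R leb Rplus mRplus S jS.
  move=> f g fg; apply: filterS h => x h x0; apply: fg; first exact/RplusE.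
  by split => //; exact: h.
- apply/integrableP; split.
    by apply/measurable_EFinP; apply: measurableT_comp.
  apply: le_lt_trans (ltry 2); apply: le_trans iS.
  apply: ge0_le_integral => //.
  + exact: mRplus.
  + apply: measurableT_comp => //; apply/measurable_EFinP.
    exact: measurableT_comp.
  + move=> x _ /=; rewrite ger0_norm; last exact: fine_ge0.
    by case: (S x) (S0 x) => [r||]//=; rewrite lee0y.
- by move=> x _; exact: fine_ge0.
- move=> k x x0 [_ /= fS]; rewrite mulrC exprVn ler_pdivlMr ?exprn_gt0//.
  rewrite [leLHS]mulrC -lee_fin fineK//.
  have := @nneseries_lim_ge R (fun k => (4 ^+ k * d k x ^+ 2)%:E) xpredT 0 k.+1
     (fun n _ _ => pos n x).
  apply: le_trans; rewrite big_nat_recr//= leeDr// sume_ge0// => i _; exact: pos.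
Qed.

Definition nrm2 (f : R -> R) : R := ip f f.

(** A subsequence with geometrically small steps converges almost everywhere,
    and dominated convergence identifies its limit in mean square. *)
Lemma L2_complete (u : nat -> R -> R) :
  (forall n, sqi (u n)) ->
  (forall e : R, 0 < e -> exists N, forall m n, (N <= m)%N -> (N <= n)%N ->
     nrm2 (fun x => u m x - u n x) <= e) ->
  exists2 f, sqi f & forall e : R, 0 < e -> exists N, forall n, (N <= n)%N ->
     nrm2 (fun x => u n x - f x) <= e.
Proof.
move=> su cu.
have /choice[N hN] : forall k : nat, exists N, forall m n, (N <= m)%N -> (N <= n)%N ->
     nrm2 (fun x => u m x - u n x) <= 8^-1 ^+ k.
  by move=> k; apply: cu; exact: exprn_gt0.
pose phi k := (\sum_(0 <= j < k.+1) (N j).+1)%N.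
have phiS k : phi k.+1 = (phi k + (N k.+1).+1)%N by rewrite /phi big_nat_recr.
have Nphi k : (N k < phi k)%N.
  by rewrite /phi big_nat_recr//= leq_addl.
have kphi k : (k < phi k)%N.
  elim: k => [|k IH]; first exact: leq_ltn_trans (Nphi 0%N).
  by rewrite phiS addnS ltnS (leq_trans IH)// leq_addr.
pose v k := u (phi k).
have [|k|E [s [mE aeE js s0 hs]]] := @summable_squares_ae (fun k x => v k.+1 x - v k x).
- by move=> k; apply: sqiB; exact: su.
- by apply: hN; [rewrite phiS (leq_trans (ltnW (Nphi k)))// leq_addr|exact: ltnW].
(* Cutting off to [E] makes the subsequence converge at every point of the
   half-line, and changes it only on a null set. *)
pose w k x := v k x * \1_E x.
have mw k : measurable_fun Rplus (w k).
  by apply: measurable_funM; [exact: (su _).1|exact: measurable_indic].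
have ws k (x : R) : 0 < x -> `|w k.+1 x - w k x| <= Num.sqrt (s x) * 2^-1 ^+ k.
  move=> x0; rewrite /w -mulrBl indicE.
  have [/set_mem xE|_] := boolP (x \in E); last first.
    by rewrite mulr0 normr0 mulr_ge0// exprn_ge0.
  rewrite mulr1 -sqrtr_sqr.
  have -> : 2^-1 ^+ k = Num.sqrt (4^-1 ^+ k) :> R.
    have -> : 4^-1 = (2^-1 : R) ^+ 2 by field.
    by rewrite exprAC sqrtr_sqr ger0_norm// exprn_ge0.
  rewrite -sqrtrM; last exact: s0.
  by apply: ler_wsqrtr; rewrite mulrC; exact: hs.
pose f x := limn (w ^~ x).
have wf (x : R) : 0 < x -> w k x @[k --> \oo] --> f x.
  by move=> x0; have [+ _] := geometric_steps_cvg (fun k => ws k x x0).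
have wb k (x : R) : 0 < x -> `|w k x| <= `|v 0%N x| + 2 * Num.sqrt (s x).
  move=> x0; have [_ /(_ k)] := geometric_steps_cvg (fun k => ws k x x0).
  move/le_trans; apply; rewrite lerD2r /w normrM ler_piMr//.
  by rewrite indicE; case: (_ \in _); rewrite ?normr1 ?normr0.
have mf : measurable_fun Rplus f.
  by apply: measurable_fun_cvg mw _ => x /RplusE; exact: wf.
have key n : itg (fun x => (u n x - f x) ^+ 2) /\
   nrm2 (fun x => u n x - v k x) @[k --> \oo] --> nrm2 (fun x => u n x - f x).
  have [||||jd cd] := @Int_dominated_cvg _ (fun k x => (u n x - w k x) ^+ 2)
     (fun x => (u n x - f x) ^+ 2)
     (fun x => 2 * u n x ^+ 2 + (4 * v 0%N x ^+ 2 + 16 * s x)).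
  - by move=> k; apply: measurable_funX; apply: measurable_funB => //; exact: (su n).1.
  - move=> x x0; apply: cvgM;
    by apply: cvgB; [exact: cvg_cst|exact: wf].
  - by apply: itgD; [|apply: itgD]; apply: itgZ => //; exact: (su _).2.
  - move=> k x x0; rewrite ger0_norm ?sqr_ge0//.
    have h1 : w k x ^+ 2 <= 2 * v 0%N x ^+ 2 + 8 * s x.
      rewrite -real_normK ?num_real//.
      have : `|w k x| ^+ 2 <= (`|v 0%N x| + 2 * Num.sqrt (s x)) ^+ 2.
        rewrite lerXn2r ?nnegrE ?wb//.
      move/le_trans; apply.
      rewrite -(real_normK (num_real (v 0%N x))) -{2}(sqr_sqrtr (s0 x x0)).
      have := sqr_ge0 (`|v 0%N x| - 2 * Num.sqrt (s x)); lra.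
    have := sqr_ge0 (u n x + w k x); lra.
  split => //; rewrite (_ : (fun k => _) = (fun k => Int (fun x => (u n x - w k x) ^+ 2))) //.
  apply/funext => k; apply: ae_Int.
  - by apply: measurable_funM; apply: measurable_funB; [exact: (su _).1..].
  - by apply: measurable_funX; apply: measurable_funB => //; exact: (su n).1.
  - apply: aeE => x x0 Ex; rewrite /w indicE mem_set// mulr1.
    by rewrite expr2.
exists f.
  apply: eq_sqi (sqiB (su 0%N) (_ : sqi (fun x => u 0%N x - f x))).
    by move=> x _; rewrite opprB addrC subrK.
  split; last exact: (key 0%N).1.
  by apply: measurable_funB => //; exact: (su _).1.
move=> e e0; have [M hM] := cu e e0; exists M => n Mn.
apply: (cvg_le_lim (N := M) (key n).2) => k Mk; apply: hM => //.
exact: leq_trans (ltnW (kphi k)).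
Qed.

End completeness.

(** * Coercive quadratic problems *)

Section variational.
Context {R : realType}.
Implicit Types (f g k : R -> R).

Definition L2cvg (u : nat -> R -> R) f : Prop :=
  nrm2 (fun x => u n x - f x) @[n --> \oo] --> (0 : R).

(** Symmetric bilinear forms that are continuous for the mean-square norm; the
    functions are not quotiented by almost everywhere equality. *)
Record bounded_form (Q : (R -> R) -> (R -> R) -> R) (M : R) : Prop := {
  formDl : forall (f g k : R -> R) (a : R), sqi f -> sqi g -> sqi k ->
    Q (fun x => f x + a * g x) k = Q f k + a * Q g k;
  formC : forall f g : R -> R, sqi f -> sqi g -> Q f g = Q g f;
  form_le : forall f g : R -> R, sqi f -> sqi g ->
    Q f g ^+ 2 <= M * nrm2 f * nrm2 g
}.

Lemma ip_bounded_form : bounded_form (@ip R) 1.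
Proof.
split=> [f g k a sf sg sk|f g _ _|f g sf sg].
- by rewrite ipDl ?ipZl//; exact: sqiZ.
- exact: ipC.
- by rewrite mul1r ip_cs.
Qed.

Section form.
Variables (Q : (R -> R) -> (R -> R) -> R) (M : R) (QM : bounded_form Q M).

Lemma formDr (f g k : R -> R) (a : R) : sqi f -> sqi g -> sqi k ->
    Q k (fun x => f x + a * g x) = Q k f + a * Q k g.
Proof.
move=> sf sg sk; have sfg := sqiD sf (sqiZ a sg).
by rewrite (formC QM)// (formDl QM)// !(formC QM (f := k)).
Qed.

Lemma form_sq (f g : R -> R) (a : R) : sqi f -> sqi g ->
  Q (fun x => f x + a * g x) (fun x => f x + a * g x) =
  Q f f + 2 * a * Q f g + a ^+ 2 * Q g g.
Proof.
move=> sf sg; have sfg := sqiD sf (sqiZ a sg).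
rewrite (formDl QM)// !formDr// (formC QM (f := g) (g := f))//; ring.
Qed.

Lemma cvg_sqr0 (u : nat -> R) (v : nat -> R) :
  (forall n, u n ^+ 2 <= v n) -> v n @[n --> \oo] --> (0 : R) ->
  u n @[n --> \oo] --> (0 : R).
Proof.
move=> uv v0; apply/cvgr0Pnorm_lt => e e0.
have := v0 => /cvgr0Pnorm_lt /(_ (e ^+ 2)); rewrite exprn_gt0// => /(_ isT).
apply: filterS => n vn.
rewrite -(@ltr_pXn2r _ 2)// ?nnegrE// ?ltW//.
rewrite real_normK ?num_real//.
by apply: le_lt_trans (uv n) _; apply: le_lt_trans vn; exact: ler_norm.
Qed.

Lemma form_subl (u f g : R -> R) : sqi u -> sqi f -> sqi g ->
  Q (fun x => u x - f x) g = Q u g - Q f g.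
Proof.
move=> su sf sg; rewrite -mulN1r -(formDl QM)//; congr (Q _ g).
by apply/funext => x; rewrite mulN1r.
Qed.

Lemma form_cvgl (u : nat -> R -> R) f g : (forall n, sqi (u n)) -> sqi f ->
  sqi g -> L2cvg u f -> Q (u n) g @[n --> \oo] --> Q f g.
Proof.
move=> su sf sg uf; apply/subr_cvg0.
under eq_cvg do rewrite -form_subl//.
apply: (@cvg_sqr0 _ (fun n => M * nrm2 (fun x => u n x - f x) * nrm2 g)).
  by move=> n; apply: (form_le QM) => //; exact: sqiB.
rewrite -(mul0r (nrm2 g)); apply: cvgM; last exact: cvg_cst.
by rewrite -(mulr0 M); apply: cvgM; [exact: cvg_cst|exact: uf].
Qed.

Lemma form_cvg_sq (u : nat -> R -> R) f : (forall n, sqi (u n)) -> sqi f ->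
  L2cvg u f -> Q (u n) (u n) @[n --> \oo] --> Q f f.
Proof.
move=> su sf uf; pose e n := fun x => u n x - f x.
have se n : sqi (e n) by exact: sqiB.
have E n : Q (u n) (u n) = Q (e n) (e n) + (2 * Q (u n) f - Q f f).
  have -> : e n = fun x => u n x + (- 1) * f x.
    by apply/funext => x; rewrite /e mulN1r.
  rewrite form_sq//; ring.
under eq_cvg do rewrite E.
have h : Q (e n) (e n) + (2 * Q (u n) f - Q f f) @[n --> \oo] -->
    0 + (2 * Q f f - Q f f).
  apply: cvgD.
    apply: (@cvg_sqr0 _ (fun n => M * nrm2 (e n) * nrm2 (e n))).
      by move=> n; exact: (form_le QM).
    rewrite -[0](mulr0 (M * 0)); apply: cvgM; last exact: uf.
    by apply: cvgM; [exact: cvg_cst|exact: uf].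
  apply: cvgB; last exact: cvg_cst.
  by apply: cvgM; [exact: cvg_cst|exact: form_cvgl].
by rewrite (_ : 0 + (2 * Q f f - Q f f) = Q f f) in h; last by ring.
Qed.

End form.

(** Minimise [Q u u - 2 * ip g u] over [S]. By the parallelogram identity and
    coercivity every minimising sequence is Cauchy; its limit satisfies the
    Euler-Lagrange equation against [S], although it need not belong to [S]. *)
Theorem coercive_form_solution (Q : (R -> R) -> (R -> R) -> R) (M c : R)
    (S : set (R -> R)) g :
  bounded_form Q M -> 0 < c -> sqi g -> S `<=` sqi -> S (fun=> 0) ->
  (forall f k a, S f -> S k -> S (fun x => f x + a * k x)) ->
  (forall f, S f -> c * nrm2 f <= Q f f) ->
  exists r, [/\ sqi r, (exists2 u, forall n, S (u n) & L2cvg u r),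
    (forall s, S s -> Q r s = ip g s) & c * nrm2 r <= ip g r].
Proof.
move=> QM c0 sg Ssqi S0 SD coer.
have QI := ip_bounded_form.
pose J u := Q u u - 2 * ip g u.
have Jlow u : S u -> - (nrm2 g / c) <= J u.
  move=> Su; have su := Ssqi _ Su.
  have h : 0 <= nrm2 g + 2 * (- c) * ip g u + (- c) ^+ 2 * nrm2 u.
    by rewrite -(form_sq QI _ sg su) ip_ge0.
  have {}h : 0 <= c^-1 * (nrm2 g + 2 * (- c) * ip g u + (- c) ^+ 2 * nrm2 u).
    by rewrite mulr_ge0// invr_ge0 ltW.
  have E : c^-1 * (nrm2 g + 2 * (- c) * ip g u + (- c) ^+ 2 * nrm2 u) =
     nrm2 g / c - 2 * ip g u + c * nrm2 u by field; rewrite gt_eqF.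
  rewrite E in h; have := coer _ Su; rewrite /J; lra.
pose m := inf (J @` S).
have hinf : has_inf (J @` S).
  split; first by exists (J (fun=> 0)), (fun=> 0).
  by exists (- (nrm2 g / c)) => _ [u Su <-]; exact: Jlow.
have mle u : S u -> m <= J u.
  by move=> Su; apply: ge_inf; [exact: hinf.2|exists u].
have /choice[u hu] : forall n : nat, exists u, S u /\ J u < m + n.+1%:R^-1.
  move=> n; have n0 : 0 < n.+1%:R^-1 :> R by rewrite invr_gt0.
  have [_ [u Su <-] ulm] := inf_adherent n0 hinf.
  by exists u.
have Su n : S (u n) by have [] := hu n.
have su n : sqi (u n) by exact: Ssqi.
have Ju n : J (u n) < m + n.+1%:R^-1 by have [] := hu n.
have cauchy (n k : nat) : c * nrm2 (fun x => u n x - u k x) <= 2 * (n.+1%:R^-1 + k.+1%:R^-1).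
  have SB : S (fun x => u n x - u k x).
    have := SD _ _ (-1) (Su n) (Su k); rewrite (_ : (fun x => _) = (fun x => u n x - u k x))//.
    by apply/funext => x; rewrite mulN1r.
  apply: le_trans (coer _ SB) _.
  (* The midpoint cannot be better than the infimum: this is where the
     parallelogram identity enters. *)
  have SA : S (fun x => 0 + 2^-1 * (u n x + 1 * u k x)).
    by apply: (SD (fun=> 0) (fun x => u n x + 1 * u k x)) => //; exact: SD.
  have JA := mle _ SA.
  have E : J (fun x => 0 + 2^-1 * (u n x + 1 * u k x)) =
    4^-1 * (Q (u n) (u n) + 2 * Q (u n) (u k) + Q (u k) (u k)) - ip g (u n) - ip g (u k).
    rewrite /J (form_sq QM _ sqi0 (sqiD (su n) (sqiZ 1 (su k)))).
    rewrite (formDr QI _ sqi0 (sqiD (su n) (sqiZ 1 (su k))) sg).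
    rewrite (form_sq QM)// (formDr QI)//.
    have Q0 f : sqi f -> Q (fun=> 0) f = 0.
      move=> sf; have := formDl QM (-1) sf sf sf.
      rewrite mulN1r subrr (_ : (fun x => _) = (fun=> 0))//.
      by apply/funext => x; rewrite mulN1r subrr.
    have I0 : ip g (fun=> 0) = 0.
      by rewrite /ip -[RHS]Int0; apply: eq_Int => x _; rewrite mulr0.
    by rewrite I0 (Q0 _ sqi0) (Q0 _ (sqiD (su n) (sqiZ 1 (su k)))); field.
  have -> : Q (fun x => u n x - u k x) (fun x => u n x - u k x) =
     Q (u n) (u n) - 2 * Q (u n) (u k) + Q (u k) (u k).
    have -> : (fun x => u n x - u k x) = fun x => u n x + (- 1) * u k x.
      by apply/funext => x; rewrite mulN1r.
    rewrite (form_sq QM)//; ring.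
  rewrite E in JA; have := Ju n; have := Ju k; rewrite /J.
  move: (n.+1%:R^-1) (k.+1%:R^-1) => a b; lra.
have [|r sr ur] := L2_complete su.
  move=> e e0; pose N := Num.bound (4 / (c * e)).
  have Nb : 4 / (c * e) < N.+1%:R.
    have h := archi_boundP (ltW (divr_gt0 (ltr0n R 4) (mulr_gt0 c0 e0))).
    by apply: lt_le_trans h _; rewrite ler_nat.
  have hN n : (N <= n)%N -> n.+1%:R^-1 <= c * e / 4.
    move=> Nn; rewrite -[leRHS]invrK lef_pV2 ?posrE ?invr_gt0//; last first.
      by rewrite divr_gt0// mulr_gt0.
    by rewrite invf_div (le_trans (ltW Nb))// ler_nat.
  exists N => p q Np Nq; rewrite -(ler_pM2l c0); apply: le_trans (cauchy p q) _.
  have := hN _ Np; have := hN _ Nq; move: (p.+1%:R^-1) (q.+1%:R^-1) => a b; lra.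
have cur : L2cvg u r.
  apply/cvgr0Pnorm_le => e e0; have [N hN] := ur e e0.
  exists N => // n /= Nn; rewrite ger0_norm ?ip_ge0//; exact: hN.
have Eul s : S s -> Q r s = ip g s.
  move=> Ss; have ss := Ssqi _ Ss.
  have h1 : Q (u n) s - ip g s @[n --> \oo] --> Q r s - ip g s.
    by apply: cvgB; [exact: (form_cvgl QM)|exact: cvg_cst].
  have Qs0 : 0 <= Q s s.
    by apply: le_trans (coer _ Ss); apply: mulr_ge0; [exact: ltW|exact: ip_ge0].
  have h2 : Q (u n) s - ip g s @[n --> \oo] --> 0.
    apply: (@cvg_sqr0 _ (fun n => n.+1%:R^-1 * Q s s)).
      move=> n; apply: sqr_le_of_quadratic => // t.
      have := mle _ (SD _ _ t (Su n) Ss); rewrite /J (form_sq QM)// (formDr QI)//.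
      have := Ju n; rewrite /J; move: (n.+1%:R^-1) => b; lra.
    rewrite -(mul0r (Q s s)); apply: cvgM; last exact: cvg_cst.
    exact: cvg_harmonic.
  by apply/eqP; rewrite -subr_eq0; apply/eqP; apply: cvg_unique h1 h2.
exists r; split => //; first by exists u.
have e1 : Q r r = ip g r.
  apply: (@cvg_unique _ _ (Q (u n) r @[n --> \oo])).
  - exact: norm_hausdorff.
  - exact: (form_cvgl QM).
  - rewrite /= ipC; under eq_cvg do rewrite (formC QM)// Eul// ipC.
    exact: (form_cvgl QI).
have h1 : c * nrm2 (u n) @[n --> \oo] --> c * nrm2 r.
  by apply: cvgM; [exact: cvg_cst|exact: (form_cvg_sq QI)].
have h2 : Q (u n) (u n) @[n --> \oo] --> Q r r by exact: (form_cvg_sq QM).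
by rewrite -e1; apply: ler_cvg_to h1 h2 _; apply: nearW => n; exact: coer.
Qed.

End variational.

(** * Iterated integrals, power weights and the Schur test *)

Section product.
Context {R : realType}.
Notation leb := (@lebesgue_measure R).
Implicit Types (F G : R -> R -> R) (f : R -> R).
Local Notation T := (measurableTypeR R).

Definition ind2 (p : T * T) : R := \1_Rplus p.1 * \1_Rplus p.2.

(** Joint measurability on the quadrant: functions on the half-line carry no
    information about their values outside it, so they are cut off by [ind2]. *)
Definition meas2 F : Prop :=
  measurable_fun [set: T * T] (fun p : T * T => F p.1 p.2 * ind2 p).

Lemma ind2_idem p : ind2 p * ind2 p = ind2 p.
Proof.
by rewrite /ind2 !indicE; case: (_ \in _); case: (_ \in _);
  rewrite ?(mulr0, mul0r, mulr1).
Qed.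

Lemma ind21 (x y : R) : 0 < x -> 0 < y -> ind2 (x, y) = 1.
Proof. by move=> x0 y0; rewrite /ind2 !indicE !mem_set ?mulr1//; apply/RplusE. Qed.

Lemma ind20 (x y : R) : ~~ ((0 < x) && (0 < y)) -> ind2 (x, y) = 0.
Proof.
rewrite negb_and /ind2 !indicE !in_Rplus => /orP[/negbTE ->|/negbTE ->].
  by rewrite mul0r.
by rewrite mulr0.
Qed.

Lemma meas2M F G : meas2 F -> meas2 G -> meas2 (fun x y => F x y * G x y).
Proof.
move=> mF mG; have := measurable_funM mF mG.
by apply: eq_measurable_fun => p _ /=; rewrite mulrACA ind2_idem.
Qed.

Lemma eq_meas2 F G : (forall x y : R, 0 < x -> 0 < y -> F x y = G x y) ->
  meas2 F -> meas2 G.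
Proof.
move=> FG; apply: eq_measurable_fun => -[x y] _ /=.
have [/andP[x0 y0]|n] := boolP ((0 < x) && (0 < y)); first by rewrite FG.
by rewrite ind20// !mulr0.
Qed.

Lemma measurable_ind2 : measurable_fun [set: T * T] ind2.
Proof.
by apply: measurable_funM; apply: measurableT_comp;
  try exact: measurable_indic mRplus; [exact: measurable_fst|exact: measurable_snd].
Qed.

Lemma meas2_of_setT F : measurable_fun [set: T * T] (fun p : T * T => F p.1 p.2) ->
  meas2 F.
Proof. by move=> mF; apply: measurable_funM => //; exact: measurable_ind2. Qed.

Lemma meas2_comp (k : T * T -> R) f : measurable_fun [set: T * T] k ->
  (forall x y : R, 0 < x -> 0 < y -> 0 < k (x, y)) ->
  measurable_fun Rplus f -> meas2 (fun x y => f (k (x, y))).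
Proof.
move=> mk k0 mf; apply: (@eq_meas2 (fun x y => (f \_ Rplus) (k (x, y)))).
  by move=> x y x0 y0; rewrite patchE in_Rplus k0.
apply: meas2_of_setT.
have mf0 : measurable_fun [set: T] (f \_ Rplus).
  by have := measurable_restrictT f mRplus => -[+ _]; exact.
have := measurableT_comp mf0 mk.
by apply: eq_measurable_fun => -[x y].
Qed.

Lemma meas2_l f : measurable_fun Rplus f -> meas2 (fun x _ => f x).
Proof. by apply: (@meas2_comp fst) => //; exact: measurable_fst. Qed.

Lemma meas2_r f : measurable_fun Rplus f -> meas2 (fun _ y => f y).
Proof. by apply: (@meas2_comp snd) => //; exact: measurable_snd. Qed.

Lemma meas2_sum f : measurable_fun Rplus f -> meas2 (fun x y => f (x + y)).
Proof.
apply: (@meas2_comp (fun p => p.1 + p.2)).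
  by apply: measurable_funD; [exact: measurable_fst|exact: measurable_snd].
by move=> x y x0 y0; exact: addr_gt0.
Qed.

Let P F (p : T * T) : \bar R := (F p.1 p.2 * ind2 p)%:E.

Lemma inner_P F (x : R) :
  (\int[leb]_y P F (x, y) = ((fun x => \int[leb]_(y in Rplus) (F x y)%:E) \_ Rplus) x)%E.
Proof.
rewrite patchE in_Rplus; case: ifPn => x0; last first.
  by rewrite integral0_eq// => y _; rewrite /P ind20 ?mulr0// negb_and x0.
rewrite [RHS]integral_mkcond; apply: eq_integral => y _.
rewrite patchE in_Rplus /P; case: ifPn => y0; first by rewrite ind21// mulr1.
by rewrite ind20 ?mulr0// negb_and y0 orbT.
Qed.

Lemma inner_P' F (y : R) :
  (\int[leb]_x P F (x, y) = ((fun y => \int[leb]_(x in Rplus) (F x y)%:E) \_ Rplus) y)%E.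
Proof.
rewrite patchE in_Rplus; case: ifPn => y0; last first.
  by rewrite integral0_eq// => x _; rewrite /P ind20 ?mulr0// negb_and y0 orbT.
rewrite [RHS]integral_mkcond; apply: eq_integral => x _.
rewrite patchE in_Rplus /P; case: ifPn => x0; first by rewrite ind21// mulr1.
by rewrite ind20 ?mulr0// negb_and x0.
Qed.

Lemma P_ge0 F p : (forall x y : R, 0 < x -> 0 < y -> 0 <= F x y) -> (0 <= P F p)%E.
Proof.
case: p => x y F0; rewrite /P lee_fin.
have [/andP[x0 y0]|n] := boolP ((0 < x) && (0 < y)).
  by rewrite ind21// mulr1 F0.
by rewrite ind20// mulr0.
Qed.

Lemma tonelli_Rplus F : meas2 F ->
  (forall x y : R, 0 < x -> 0 < y -> 0 <= F x y) ->
  (\int[leb]_(x in Rplus) \int[leb]_(y in Rplus) (F x y)%:E =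
   \int[leb]_(y in Rplus) \int[leb]_(x in Rplus) (F x y)%:E)%E.
Proof.
move=> mF F0.
have mP : measurable_fun [set: T * T] (P F) by exact/measurable_EFinP.
have := @fubini_tonelli _ _ T T R leb leb (P F) mP (fun p => P_ge0 p F0).
under eq_integral do rewrite inner_P.
under [in RHS]eq_integral do rewrite inner_P'.
by rewrite -!integral_mkcond.
Qed.

Lemma measurable_inner F : meas2 F ->
  (forall x y : R, 0 < x -> 0 < y -> 0 <= F x y) ->
  measurable_fun Rplus (fun x => \int[leb]_(y in Rplus) (F x y)%:E)%E.
Proof.
move=> mF F0.
have mP : measurable_fun [set: T * T] (P F) by exact/measurable_EFinP.
have := @measurable_fun_fubini_tonelli_F _ _ T T R leb (P F) mP (fun p => P_ge0 p F0).
move=> mm.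
have [_ +] := measurable_restrictT
  (fun x => \int[leb]_(y in Rplus) (F x y)%:E)%E mRplus; apply.
by apply: eq_measurable_fun mm => x _; exact: inner_P.
Qed.

Lemma fubini_Rplus F : meas2 F ->
  (forall x : R, 0 < x -> itg (F x)) -> (forall y : R, 0 < y -> itg (F^~ y)) ->
  itg (fun x => Int (fun y => `|F x y|)) ->
  Int (fun x => Int (F x)) = Int (fun y => Int (F^~ y)).
Proof.
move=> mF jx jy jF.
have mP : measurable_fun [set: T * T] (P F) by exact/measurable_EFinP.
have jP : (leb \x leb)%E.-integrable [set: T * T] (P F).
  apply/integrable12ltyP => //.
  pose N x y := `|F x y|.
  rewrite (eq_integral (fun x => \int[leb]_y P N (x, y))%E); last first.
    move=> x _; apply: eq_integral => y _; rewrite /P abse_EFin normrM.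
    by congr (_ * _)%:E; rewrite ger0_norm// /ind2 mulr_ge0.
  under eq_integral do rewrite inner_P.
  rewrite -integral_mkcond.
  have h : (\int[leb]_(x in Rplus) \int[leb]_(y in Rplus) (N x y)%:E =
      (Int (fun x => Int (N x)))%:E)%E.
    rewrite EFin_Int//; apply: eq_integral => x; rewrite in_Rplus => x0.
    by rewrite EFin_Int//; exact/itg_norm/jx.
  by apply: (@eq_ind_r _ _ (fun z => (z < +oo)%E) _ _ h); exact: ltry.
have := Fubini jP.
under eq_integral do rewrite inner_P.
under [in RHS]eq_integral do rewrite inner_P'.
rewrite -!integral_mkcond => E.
rewrite /Int /Rintegral; congr fine.
transitivity (\int[leb]_(x in Rplus) \int[leb]_(y in Rplus) (F x y)%:E)%E.
  by apply: eq_integral => x; rewrite in_Rplus => x0; rewrite -EFin_Int//; exact: jx.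
rewrite E; apply: eq_integral => x; rewrite in_Rplus => x0.
by rewrite -EFin_Int//; exact: jy.
Qed.

End product.

Section weights.
Context {R : realType}.
Implicit Types (a al s t : R) (f : R -> R).
Notation leb := (@lebesgue_measure R).

(** This is [t `^ (- 2^-1 - al)] for [t < 1] and [t `^ (- 2^-1 + al)] for [t >
    1]: the weight that defines the growth classes, square integrable when [al
    < 0]. *)
Definition wt al t : R := expR (- ln t / 2 + al * `|ln t|).

(** The kernel [(t * s) `^ (- 2^-1) * (min t s / max t s) `^ a], homogeneous
    of degree -1. It decays exponentially in the logarithmic distance of its
    arguments, and for [a = 2^-1] it is [(max t s)^-1], which dominates [(t +
    s)^-1]. *)
Definition Ka a t s : R := expR (- (ln t + ln s) / 2 - a * `|ln s - ln t|).

Lemma wt_gt0 al t : 0 < wt al t.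
Proof. exact: expR_gt0. Qed.

Lemma Ka_gt0 a t s : 0 < Ka a t s.
Proof. exact: expR_gt0. Qed.

Lemma Ka_sym a t s : Ka a t s = Ka a s t.
Proof. by rewrite /Ka addrC (addrC (ln t)) distrC addrC. Qed.

Lemma measurable_wt_exponent al : measurable_fun Rplus (fun t => - ln t / 2 + al * `|ln t|).
Proof.
have ml := @measurable_lnRplus R.
by apply: measurable_funD; apply: measurable_funM => //; exact: measurableT_comp.
Qed.

Lemma measurable_wt al : measurable_fun Rplus (wt al).
Proof. by apply: measurableT_comp => //; exact: measurable_wt_exponent. Qed.

Lemma measurable_inv_wt al : measurable_fun Rplus (fun t => (wt al t)^-1).
Proof.
under eq_fun do rewrite /wt -expRN.
by do 2 apply: measurableT_comp => //; exact: measurable_wt_exponent.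
Qed.

Lemma measurable_Ka a t : measurable_fun Rplus (Ka a t).
Proof.
apply: measurableT_comp => //; apply: measurable_funB.
  apply: measurable_funM => //; apply: measurableT_comp => //.
  by apply: measurable_funD => //; exact: measurable_lnRplus.
apply: measurable_funM => //; apply: measurableT_comp => //.
by apply: measurable_funB => //; exact: measurable_lnRplus.
Qed.

Lemma meas2_Ka a : meas2 (Ka a).
Proof.
apply: meas2_of_setT.
have m1 : measurable_fun [set: measurableTypeR R * measurableTypeR R] (fun p => ln p.1 : R).
  by apply: measurableT_comp; [exact: measurable_ln|exact: measurable_fst].
have m2 : measurable_fun [set: measurableTypeR R * measurableTypeR R] (fun p => ln p.2 : R).
  by apply: measurableT_comp; [exact: measurable_ln|exact: measurable_snd].
apply: measurableT_comp => //; apply: measurable_funB.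
  apply: measurable_funM => //; apply: measurableT_comp => //.
  exact: measurable_funD.
apply: measurable_funM => //; apply: measurableT_comp => //.
exact: measurable_funB.
Qed.

Lemma wtM_le al (s t : R) : al * `|ln s| <= al * `|ln t| + `|al| * `|ln s - ln t|.
Proof.
have h1 : `|ln s| <= `|ln t| + `|ln s - ln t|.
  by rewrite -{1}(subrK (ln t) (ln s)) addrC ler_normD.
have h2 : `|ln t| <= `|ln s| + `|ln s - ln t|.
  by rewrite -{1}(subrK (ln s) (ln t)) distrC addrC ler_normD.
case: (ger0P al) => al0.
  by rewrite -mulrDr ler_wpM2l.
have := ler_wnM2l (ltW al0) h2; lra.
Qed.

Lemma Ka_wt_le a al s t :
  Ka a t s * wt al s <= wt al t * expR (- ln s - (a - `|al|) * `|ln s - ln t|).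
Proof.
rewrite /Ka /wt -!expRD ler_expR; have := wtM_le al s t; lra.
Qed.

(** Replacing [wt al s] by [wt al t] costs a factor [expR (`|al| * `|ln s - ln
    t|)], which the decay of the kernel absorbs when [`|al| < a]. *)
Lemma itg_Ka_wt a al t : `|al| < a ->
  itg (fun s => Ka a t s * wt al s) /\
  Int (fun s => Ka a t s * wt al s) <= 2 / (a - `|al|) * wt al t.
Proof.
move=> ala; have a0 : 0 < a - `|al| by rewrite subr_gt0.
have [j1 I1] := itg_explog (ln t) a0.
have j2 := itgZ (wt al t) j1.
have j3 : itg (fun s => Ka a t s * wt al s).
  apply: (itg_le _ j2).
    by apply: measurable_funM; [exact: measurable_Ka|exact: measurable_wt].
  by move=> s s0; rewrite ger0_norm ?mulr_ge0 ?expR_ge0//; exact: Ka_wt_le.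
split => //; apply: le_trans (le_Int j3 j2 _) _.
  by move=> s _; exact: Ka_wt_le.
by rewrite IntZ// mulrC ler_pM2r ?wt_gt0.
Qed.

Lemma sqi_Ka a t : 0 < a -> sqi (Ka a t).
Proof.
move=> a0; split; first exact: measurable_Ka.
have a2 : 0 < 2 * a by rewrite mulr_gt0.
apply: eq_itg (itgZ (expR (- ln t)) (itg_explog (ln t) a2).1) => s s0.
by rewrite /Ka expr2 -!expRD; congr expR; field.
Qed.

Lemma sqi_wt al : al < 0 -> sqi (wt al).
Proof.
move=> al0; split; first exact: measurable_wt.
have a2 : 0 < - 2 * al by lra.
apply: eq_itg (itg_explog 0 a2).1 => s s0.
by rewrite /wt expr2 -!expRD subr0; congr expR; field.
Qed.

Definition Kop a f t : R := Int (fun s => Ka a t s * `|f s|).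

Lemma sqi_norm f : sqi f -> sqi (fun x => `|f x|).
Proof.
move=> [mf jf]; split; first exact: measurableT_comp.
by apply: eq_itg jf => x _; rewrite real_normK ?num_real.
Qed.

Lemma itg_Kop a f t : 0 < a -> sqi f -> itg (fun s => Ka a t s * `|f s|).
Proof. by move=> a0 sf; apply: sqiM; [exact: sqi_Ka|exact: sqi_norm]. Qed.

Lemma Kop_ge0 a f t : 0 <= Kop a f t.
Proof. by apply: Int_ge0 => s _; rewrite mulr_ge0// expR_ge0. Qed.

Lemma measurable_Kop a f : 0 < a -> sqi f -> measurable_fun Rplus (Kop a f).
Proof.
move=> a0 sf.
have mm := measurable_inner (meas2M (meas2_Ka a) (meas2_r (sqi_norm sf).1))
   (fun x y _ _ => mulr_ge0 (ltW (Ka_gt0 a x y)) (normr_ge0 (f y))).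
apply/measurable_EFinP; apply: eq_measurable_fun mm => t; rewrite in_Rplus => t0.
by rewrite /= /Kop EFin_Int//; exact: itg_Kop.
Qed.

(** Cauchy-Schwarz for the measure with density [Ka a t], splitting the
    integrand as [wt 0 ^ 1/2] times [f / wt 0 ^ 1/2]. *)
Lemma Kop_sqr_le_schur a f t : 0 < a -> sqi f ->
  ((Kop a f t ^+ 2)%:E <=
   \int[leb]_(s in Rplus) (2 / a * wt 0 t * (Ka a t s * (f s ^+ 2 / wt 0 s)))%:E)%E.
Proof.
move=> a0 sf; have w0 := wt_gt0.
have n0 : `|0 : R| < a by rewrite normr0.
have [jw Iw] := itg_Ka_wt t n0; rewrite normr0 subr0 in Iw.
have mg : measurable_fun Rplus (fun s => Ka a t s * (f s ^+ 2 / wt 0 s)).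
  apply: measurable_funM; first exact: measurable_Ka.
  apply: measurable_funM; first by apply: measurable_funX; exact: sf.1.
  exact: measurable_inv_wt.
have g0 s : 0 <= Ka a t s * (f s ^+ 2 / wt 0 s).
  by rewrite mulr_ge0 ?expR_ge0// mulr_ge0 ?sqr_ge0// invr_ge0 expR_ge0.
have c0 : 0 <= 2 / a * wt 0 t by rewrite mulr_ge0 ?divr_ge0 ?expR_ge0// ltW.
have -> : (\int[leb]_(s in Rplus)
      (2 / a * wt 0 t * (Ka a t s * (f s ^+ 2 / wt 0 s)))%:E =
    (2 / a * wt 0 t)%:E *
      \int[leb]_(s in Rplus) (Ka a t s * (f s ^+ 2 / wt 0 s))%:E)%E.
  under eq_integral do rewrite EFinM.
  rewrite ge0_integralZl_EFin//.
  - exact: mRplus.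
  - by move=> s _; rewrite lee_fin.
  - exact/measurable_EFinP.
have c1 : 0 < 2 / a * wt 0 t by rewrite mulr_gt0// divr_gt0.
have [fin|] := ltP (\int[leb]_(s in Rplus) (Ka a t s * (f s ^+ 2 / wt 0 s))%:E)%E +oo%E; last first.
  by rewrite leye_eq => /eqP ->; rewrite gt0_muley ?lte_fin// leey.
have jg : itg (fun s => Ka a t s * (f s ^+ 2 / wt 0 s)).
  apply/integrableP; split; first exact/measurable_EFinP.
  apply: le_lt_trans fin; apply: le_of_eq.
  by apply: eq_integral => s _; rewrite /= ger0_norm.
rewrite -EFin_Int// -EFinM lee_fin.
apply: sqr_le_of_young => //; first by apply: Int_ge0 => s _; exact: g0.
  (* Young's inequality under the integral: [(c w - |f|)^2 / (c w)] is
     non-negative. *)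
  move=> c c_gt0; have jK := itg_Kop t a0 sf.
  rewrite -IntZ//; apply: (@le_trans _ _ (Int (fun s => c * (Ka a t s * wt 0 s) +
      c^-1 * (Ka a t s * (f s ^+ 2 / wt 0 s))))).
    apply: le_Int; [exact: itgZ|by apply: itgD; exact: itgZ|].
    move=> s s0.
    rewrite [c * _]mulrCA [c^-1 * _]mulrCA -mulrDr mulrCA ler_pM2l ?Ka_gt0//.
    rewrite -(real_normK (num_real (f s))); move: (wt 0 s) (w0 0 s) => w wp.
    have iw : 0 <= (c * w)^-1 by rewrite invr_ge0; apply: ltW; exact: mulr_gt0.
    have := mulr_ge0 (sqr_ge0 (c * w - `|f s|)) iw.
    have -> : (c * w - `|f s|) ^+ 2 / (c * w) =
       c * w + c^-1 * (`|f s| ^+ 2 / w) - 2 * `|f s|.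
      by field; rewrite !gt_eqF.
    lra.
  rewrite IntD; [|exact: itgZ..]; rewrite !IntZ//.
  by rewrite [c^-1 * _]mulrC lerD2r ler_pM2l.
exact: Kop_ge0.
Qed.

(** Schur's test with the weight [wt 0 t = t `^ (- 2^-1)], which the kernel
    reproduces up to the factor [2 / a]. *)
Theorem schur_Kop a f : 0 < a -> sqi f ->
  sqi (Kop a f) /\ nrm2 (Kop a f) <= (2 / a) ^+ 2 * nrm2 f.
Proof.
move=> a0 sf; have w0 := wt_gt0.
have mK := measurable_Kop a0 sf.
have n0 : `|0 : R| < a by rewrite normr0.
have ia : 0 <= 2 / a by apply: ltW; exact: divr_gt0.
have q0 s : 0 <= f s ^+ 2 / wt 0 s by rewrite divr_ge0 ?sqr_ge0// expR_ge0.
pose F t s := 2 / a * wt 0 t * (Ka a t s * (f s ^+ 2 / wt 0 s)).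
have F0 t s : 0 <= F t s.
  by rewrite /F; apply: mulr_ge0; rewrite mulr_ge0// expR_ge0.
have mw := @measurable_inv_wt 0.
have mF : meas2 F.
  apply: (meas2M (F := fun t _ => 2 / a * wt 0 t)).
    by apply: meas2_l; apply: measurable_funM => //; exact: measurable_wt.
  apply: meas2M; first exact: meas2_Ka.
  apply: (meas2_r (f := fun s => f s ^+ 2 / wt 0 s)).
  by apply: measurable_funM => //; apply: measurable_funX; exact: sf.1.
have jf : itg (fun s => (2 / a) ^+ 2 * f s ^+ 2) by apply: itgZ; exact: sf.2.
have [|||j I] := @itg_ge0P _ (fun t => Kop a f t ^+ 2) ((2 / a) ^+ 2 * nrm2 f).
- exact: measurable_funX.
- by move=> t _; exact: sqr_ge0.
- apply: (@le_trans _ _ (\int[leb]_(t in Rplus) \int[leb]_(s in Rplus) (F t s)%:E)%E).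
    apply: ge0_le_integral => //.
    + exact: mRplus.
    + by move=> t _; rewrite lee_fin sqr_ge0.
    + by apply/measurable_EFinP; exact: measurable_funX.
    + by apply: measurable_inner.
    + by move=> t _; exact: Kop_sqr_le_schur.
  rewrite tonelli_Rplus//.
  rewrite /nrm2 /ip -IntZ; last exact: sqi_ip.
  rewrite EFin_Int; last by apply: itgZ; exact: sqi_ip.
  apply: ge0_le_integral => //.
  + exact: mRplus.
  + by move=> s _; apply: integral_ge0 => t _; rewrite lee_fin.
  + apply: (@measurable_inner _ (fun s t => F t s)) => //.
    have : meas2 (fun s t => (f s ^+ 2 / wt 0 s) * (Ka a s t * (2 / a * wt 0 t))).
      apply: (meas2M (F := fun s _ => f s ^+ 2 / wt 0 s)).
        by apply: meas2_l; apply: measurable_funM => //; apply: measurable_funX; exact: sf.1.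
      apply: meas2M; first exact: meas2_Ka.
      apply: (meas2_r (f := fun t => 2 / a * wt 0 t)).
      by apply: measurable_funM => //; exact: measurable_wt.
    by apply: eq_meas2 => s t _ _; rewrite /F (Ka_sym _ s); ring.
  + apply/measurable_EFinP; apply: measurable_funM => //.
    by apply: measurable_funM; exact: sf.1.
  + move=> s _.
    have [jw Iw] := itg_Ka_wt s n0; rewrite normr0 subr0 in Iw.
    have jw2 := itgZ (2 / a * (f s ^+ 2 / wt 0 s)) jw.
    rewrite (_ : (\int[leb]_(t in Rplus) _)%E =
        (Int (fun t => 2 / a * (f s ^+ 2 / wt 0 s) * (Ka a s t * wt 0 t)))%:E); last first.
      rewrite EFin_Int//; apply: eq_integral => t _; congr EFin.
      by rewrite /F (Ka_sym _ t); ring.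
    rewrite IntZ// lee_fin.
    apply: le_trans (ler_wpM2l (mulr_ge0 ia (q0 s)) Iw) _.
    rewrite -expr2; apply: le_of_eq.
    by field; rewrite !gt_eqF.
- by split.
Qed.

End weights.

(** * Hankel operators with kernel of order 1/t *)

Section hankel_operator.
Context {R : realType}.
Implicit Types (t s m al M : R) (f g : R -> R).

(** The properties of the kernel of a Carleson measure from which the spectral
    statement follows: size, local regularity, and positivity, the last one
    expressed at finitely many points. *)
Record hankel_like (h : R -> R) (C : R) : Prop := {
  hk_C : 0 < C;
  hk_ge0 : forall t : R, 0 < t -> 0 <= h t;
  hk_le : forall t : R, 0 < t -> h t <= C / t;
  hk_lip : forall m t s : R, 0 < m -> m <= t -> m <= s ->
    `|h t - h s| <= C * `|t - s| / m ^+ 2;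
  hk_psd : forall n (x t : 'I_n -> R), (forall i, 0 < t i) ->
    0 <= \sum_i \sum_j x i * x j * h (t i + t j)
}.

Definition Hop (h : R -> R) f t : R := Int (fun s => h (t + s) * f s).

(** Functions to which every kernel dominated by [(t + s)^-1] can be applied;
    they include the square integrable ones and those bounded by [wt al] with
    [`|al| < 2^-1]. *)
Definition adm f : Prop :=
  measurable_fun Rplus f /\ forall t : R, 0 < t -> itg (fun s => Ka 2^-1 t s * `|f s|).

Lemma Ka_half t s : 0 < t -> 0 < s -> Ka 2^-1 t s = (Num.max t s)^-1.
Proof.
move=> t0 s0; wlog ts : t s t0 s0 / t <= s.
  move=> W; case: (leP t s) => [|/ltW] st; first by rewrite W// max_r.
  by rewrite Ka_sym W// max_r.
rewrite max_r// /Ka ger0_norm; last by rewrite subr_ge0 ler_ln.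
have -> : - (ln t + ln s) / 2 - 2^-1 * (ln s - ln t) = - ln s by field.
by rewrite expRN lnK.
Qed.

Lemma inv_add_le_Ka t s : 0 < t -> 0 < s -> (t + s)^-1 <= Ka 2^-1 t s.
Proof.
move=> t0 s0; rewrite Ka_half// lef_pV2 ?posrE ?addr_gt0//; last first.
  by rewrite lt_max t0.
by rewrite ge_max lerDl lerDr !ltW.
Qed.

Lemma sqi_adm f : sqi f -> adm f.
Proof.
by move=> sf; split=> [|t _]; [exact: sf.1|apply: itg_Kop => //; rewrite invr_gt0].
Qed.

Lemma adm_wt f M al : measurable_fun Rplus f -> `|al| < 2^-1 ->
  (forall s : R, 0 < s -> `|f s| <= M * wt al s) -> adm f.
Proof.
move=> mf ala fM; split => // t t0.
apply: (itg_le _ (itgZ M (itg_Ka_wt t ala).1)).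
  apply: measurable_funM; first exact: measurable_Ka.
  exact: measurableT_comp.
move=> s s0; rewrite ger0_norm; last by rewrite mulr_ge0// expR_ge0.
by rewrite mulrCA ler_pM2l ?Ka_gt0// fM.
Qed.

Lemma admZ (c : R) f : adm f -> adm (fun x => c * f x).
Proof.
move=> [mf jf]; split; first exact: measurable_funM.
move=> t t0; apply: eq_itg (itgZ `|c| (jf t t0)) => s s0.
by rewrite normrM mulrCA.
Qed.

Lemma lip_continuous_at f t m (L : R) : m < t ->
  (forall y : R, m <= y -> `|f t - f y| <= L * `|t - y|) -> {for t, continuous f}.
Proof.
move=> mt fL; have tm : 0 < t - m by rewrite subr_gt0.
have L1 : 0 < `|L| + 1 by rewrite ltr_wpDl.
apply/cvgrPdist_le => e e0; near=> y.
have my : m <= y.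
  near: y; exists (t - m) => //= y /=; rewrite ltr_norml => /andP[_]; lra.
apply: le_trans (fL y my) _.
apply: (@le_trans _ _ ((`|L| + 1) * `|t - y|)).
  by rewrite ler_wpM2r// (le_trans (ler_norm _))// lerDl.
rewrite mulrC -ler_pdivlMr//.
near: y; exists (e / (`|L| + 1)) => /=; first by rewrite /= divr_gt0.
by move=> y /= /ltW.
Unshelve. all: by end_near. Qed.

Section fixed_kernel.
Variables (h : R -> R) (C : R) (hC : hankel_like h C).

Lemma h_le_Ka t s : 0 < t -> 0 < s -> h (t + s) <= C * Ka 2^-1 t s.
Proof.
move=> t0 s0; apply: le_trans (hk_le hC (addr_gt0 t0 s0)) _.
by rewrite ler_pM2l ?(hk_C hC)// inv_add_le_Ka.
Qed.

Lemma h_diff_le_Ka m t t' s : 0 < m -> m <= t -> m <= t' -> 0 < s ->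
  `|h (t + s) - h (t' + s)| <= C / m * `|t - t'| * Ka 2^-1 m s.
Proof.
move=> m0 mt mt' s0.
have ms : 0 < m + s by exact: addr_gt0.
apply: le_trans (hk_lip hC (m := m + s) ms _ _) _; rewrite ?lerD2r//.
rewrite opprD addrACA subrr addr0.
have -> : C / m * `|t - t'| * Ka 2^-1 m s = C * `|t - t'| * (m^-1 * Ka 2^-1 m s).
  by ring.
apply: ler_wpM2l; first by rewrite mulr_ge0// ltW// (hk_C hC).
rewrite expr2 invfM; apply: ler_pM; rewrite ?invr_ge0 ?(ltW ms)//.
  by rewrite lef_pV2 ?posrE// lerDl ltW.
exact: inv_add_le_Ka.
Qed.

Lemma measurable_h : measurable_fun Rplus h.
Proof.
apply: continuous_measurable_Rplus => s s0.
have s2 : 0 < s / 2 by rewrite divr_gt0.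
apply: (@lip_continuous_at _ _ (s / 2) (C / (s / 2) ^+ 2)); first by lra.
move=> y sy; apply: le_trans (hk_lip hC s2 _ sy) _; first by lra.
by rewrite mulrAC.
Qed.

Lemma measurable_h_shift t : 0 < t -> measurable_fun Rplus (fun s => h (t + s)).
Proof.
move=> t0; apply: continuous_measurable_Rplus => s s0.
apply: (@lip_continuous_at _ _ 0 (C / t ^+ 2)) => // y y0.
have s1 := ltW s0; apply: le_trans (hk_lip hC t0 _ _) _; rewrite ?lerDl//.
by rewrite opprD addrACA subrr add0r mulrAC.
Qed.

Lemma itg_Hop f t : adm f -> 0 < t -> itg (fun s => h (t + s) * f s).
Proof.
move=> [mf jf] t0; apply: (itg_le _ (itgZ C (jf t t0))).
  by apply: measurable_funM => //; exact: measurable_h_shift.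
move=> s s0; rewrite normrM ger0_norm; last by apply: (hk_ge0 hC); exact: addr_gt0.
by rewrite mulrA ler_wpM2r// h_le_Ka.
Qed.

Lemma Hop_le_Kop f t : adm f -> 0 < t -> `|Hop h f t| <= C * Kop 2^-1 f t.
Proof.
move=> af t0; rewrite /Kop -IntZ; last exact: af.2.
apply: norm_Int; [exact: itg_Hop|by apply: itgZ; exact: af.2|].
move=> s s0; rewrite normrM ger0_norm; last by apply: (hk_ge0 hC); exact: addr_gt0.
by rewrite mulrA ler_wpM2r// h_le_Ka.
Qed.

Lemma HopD f g t : adm f -> adm g -> 0 < t ->
  Hop h (fun x => f x + g x) t = Hop h f t + Hop h g t.
Proof.
move=> af ag t0; rewrite /Hop -IntD; [|exact: itg_Hop..].
by apply: eq_Int => s _; rewrite mulrDr.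
Qed.

Lemma HopZ (c : R) f t : adm f -> 0 < t ->
  Hop h (fun x => c * f x) t = c * Hop h f t.
Proof.
move=> af t0; rewrite /Hop -IntZ; last exact: itg_Hop.
by apply: eq_Int => s _; rewrite mulrCA.
Qed.

Lemma HopDZ (c : R) f g t : adm f -> adm g -> 0 < t ->
  Hop h (fun x => f x + c * g x) t = Hop h f t + c * Hop h g t.
Proof. by move=> af ag t0; rewrite HopD ?HopZ//; exact: admZ. Qed.

Lemma eq_Hop f g t : (forall s : R, 0 < s -> f s = g s) -> Hop h f t = Hop h g t.
Proof. by move=> fg; apply: eq_Int => s s0; rewrite fg. Qed.

Lemma ae_Hop f g t : 0 < t -> measurable_fun Rplus f -> measurable_fun Rplus g ->
  ae_eq (@lebesgue_measure R) Rplus f g -> Hop h f t = Hop h g t.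
Proof.
move=> t0 mf mg fg; have mh := measurable_h_shift t0.
apply: ae_Int; [exact: measurable_funM..|].
by apply: filterS fg => x /[apply] ->.
Qed.

(** Functions in the range are locally Lipschitz, with constants that depend
    on the function only through one value of the dominating operator. *)
Lemma Hop_lip f m t t' : adm f -> 0 < m -> m <= t -> m <= t' ->
  `|Hop h f t - Hop h f t'| <= C / m * Kop 2^-1 f m * `|t - t'|.
Proof.
move=> af m0 mt mt'; have t0 := lt_le_trans m0 mt; have t0' := lt_le_trans m0 mt'.
rewrite /Hop -IntB; [|exact: itg_Hop..].
rewrite mulrAC /Kop -IntZ; last exact: af.2.
apply: norm_Int; [by apply: itgB; exact: itg_Hop|by apply: itgZ; exact: af.2|].
move=> s s0; rewrite -mulrBl normrM mulrA ler_wpM2r//; exact: h_diff_le_Ka.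
Qed.

Lemma Hop_continuous f t : adm f -> 0 < t -> {for t, continuous (Hop h f)}.
Proof.
move=> af t0; have t2 : 0 < t / 2 by rewrite divr_gt0.
apply: (@lip_continuous_at _ _ (t / 2)); first by lra.
by move=> y ty; apply: (Hop_lip af t2 _ ty); lra.
Qed.

Lemma measurable_Hop f : adm f -> measurable_fun Rplus (Hop h f).
Proof. by move=> af; apply: continuous_measurable_Rplus => t; exact: Hop_continuous. Qed.

Lemma Hop_sqi f : sqi f -> sqi (Hop h f) /\ nrm2 (Hop h f) <= (4 * C) ^+ 2 * nrm2 f.
Proof.
move=> sf; have af := sqi_adm sf.
have i2 : 0 < 2^-1 :> R by rewrite invr_gt0.
have [sK nK] := schur_Kop i2 sf.
have sCK := sqiZ C sK.
have sH : sqi (Hop h f).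
  apply: sqi_le sCK _; first exact: measurable_Hop.
  by move=> t t0; exact: Hop_le_Kop.
split => //; have le1 : nrm2 (Hop h f) <= nrm2 (fun t => C * Kop 2^-1 f t).
  apply: le_Int; [exact: sqi_ip..|] => t t0; rewrite -!expr2.
  rewrite -real_normK ?num_real// lerXn2r ?nnegrE//; last exact: Hop_le_Kop.
  by rewrite mulr_ge0 ?Kop_ge0// ltW// (hk_C hC).
apply: le_trans le1 _; rewrite /nrm2 ipZl// ipZr//.
have C2 : 0 <= C ^+ 2 by exact: sqr_ge0.
have := ler_wpM2l C2 nK; rewrite invrK /nrm2; lra.
Qed.

Lemma meas2_h : meas2 (fun t s => h (t + s)).
Proof. by apply: meas2_sum; exact: measurable_h. Qed.

(** Fubini's theorem; the double integral converges absolutely because the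
    dominating operator is bounded. *)
Lemma Hop_sym f g : sqi f -> sqi g -> ip (Hop h f) g = ip f (Hop h g).
Proof.
move=> sf sg; have af := sqi_adm sf; have ag := sqi_adm sg.
pose F t s := h (t + s) * (f s * g t).
have mF : meas2 F.
  apply: meas2M; first exact: meas2_h.
  by apply: meas2M; [apply: meas2_r; exact: sf.1|apply: meas2_l; exact: sg.1].
have jx (t : R) : 0 < t -> itg (F t).
  move=> t0; apply: eq_itg (itgZ (g t) (itg_Hop af t0)) => s _.
  by rewrite /F; ring.
have jy (s : R) : 0 < s -> itg (F^~ s).
  move=> s0; apply: eq_itg (itgZ (f s) (itg_Hop ag s0)) => t _.
  by rewrite /F addrC; ring.
have i2 : 0 < 2^-1 :> R by rewrite invr_gt0.
have jF : itg (fun t => Int (fun s => `|F t s|)).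
  have jb := sqiM (sqiZ C (schur_Kop i2 sf).1) (sqi_norm sg).
  apply: (itg_le _ jb).
    have mN : meas2 (fun t s => `|F t s|).
      have := measurableT_comp (@normr_measurable R setT) mF.
      by apply: eq_measurable_fun => p _ /=; rewrite normrM [`|ind2 p|]ger0_norm// /ind2 mulr_ge0.
    have mm := measurable_inner mN (fun x y _ _ => normr_ge0 _).
    apply/measurable_EFinP; apply: eq_measurable_fun mm => t; rewrite in_Rplus => t0.
    by rewrite /= EFin_Int//; exact/itg_norm/jx.
  move=> t t0; rewrite ger0_norm; last by apply: Int_ge0.
  rewrite mulrAC /Kop -IntZ; last exact: af.2.
  apply: le_Int; [exact/itg_norm/jx|by apply: itgZ; exact: af.2|].
  move=> s s0; rewrite /F !normrM ger0_norm; last by apply: (hk_ge0 hC); exact: addr_gt0.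
  have := ler_wpM2r (mulr_ge0 (normr_ge0 (f s)) (normr_ge0 (g t))) (h_le_Ka t0 s0).
  lra.
have := fubini_Rplus mF jx jy jF => E.
transitivity (Int (fun t => Int (F t))).
  apply: eq_Int => t t0; rewrite mulrC /Hop -IntZ; last exact: itg_Hop.
  by apply: eq_Int => s _; rewrite /F; ring.
rewrite E; apply: eq_Int => s s0; rewrite /Hop -IntZ; last exact: itg_Hop.
by apply: eq_Int => t _; rewrite /F addrC; ring.
Qed.

End fixed_kernel.
End hankel_operator.

(** * Quasimodes from generalized eigenfunctions *)

Section schnol.
Context {R : realType}.
Implicit Types (t s x : R) (f g : R -> R).

Lemma expR_sub1_le (e x : R) : 0 <= e -> e <= 8^-1 -> 0 <= x ->
  expR (e * x) - 1 <= 8 * e * expR (4^-1 * x).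
Proof.
move=> e0 e8 x0.
have h1 : 1 - e * x <= expR (- (e * x)) by have := expR_ge1Dx (- (e * x)); lra.
have h2 : expR (e * x) - 1 <= e * x * expR (e * x).
  have := ler_wpM2r (expR_ge0 (e * x)) h1.
  rewrite -expRD addNr expR0 mulrBl mul1r; lra.
have h3 : x <= 8 * expR (8^-1 * x) by have := expR_ge1Dx (8^-1 * x); lra.
have h4 : expR (e * x) <= expR (8^-1 * x) by rewrite ler_expR ler_wpM2r.
have -> : expR (4^-1 * x) = expR (8^-1 * x) * expR (8^-1 * x).
  by rewrite -expRD; congr expR; field.
apply: le_trans h2 _; rewrite -mulrA [8 * e * _](_ : _ = e * (8 * expR (8^-1 * x) * expR (8^-1 * x))); last by ring.
apply: ler_wpM2l => //; apply: ler_pM => //; exact: expR_ge0.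
Qed.

(** The damping factor [max t (1 / t) `^ (- e)] varies slowly in [ln t], so
    its increments are of size [e] apart from an exponential in the
    logarithmic distance that the kernel can absorb. *)
Lemma damping_diff_le (e t s : R) : 0 <= e -> e <= 8^-1 ->
  `|expR (- e * `|ln s|) - expR (- e * `|ln t|)| <=
  expR (- e * `|ln s|) * (8 * e * expR (4^-1 * `|ln s - ln t|)).
Proof.
move=> e0 e8; set d := `|ln s - ln t|; have d0 : 0 <= d by exact: normr_ge0.
apply: (@le_trans _ _ (expR (- e * `|ln s|) * (expR (e * d) - 1))); last first.
  by rewrite ler_wpM2l ?expR_ge0// expR_sub1_le.
have h1 := @wtM_le _ (- e) t s; have h2 := @wtM_le _ (- e) s t.
rewrite normrN (ger0_norm e0) in h1 h2; rewrite distrC -/d in h1; rewrite -/d in h2.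
have u : expR (- e * `|ln t|) <= expR (- e * `|ln s|) * expR (e * d).
  by rewrite -expRD ler_expR.
have l : expR (- e * `|ln s|) * expR (- (e * d)) <= expR (- e * `|ln t|).
  by rewrite -expRD ler_expR; lra.
have q : 2 <= expR (e * d) + expR (- (e * d)).
  by have := expR_ge1Dx (e * d); have := expR_ge1Dx (- (e * d)); lra.
have := ler_wpM2l (expR_ge0 (- e * `|ln s|)) q.
by rewrite ler_norml => {}q; apply/andP; split; lra.
Qed.

Variables (h : R -> R) (C : R) (hC : hankel_like h C).

(** Damping the solution by [w = max t (1 / t) `^ (- e)] makes it square
    integrable. Since [f] solves the equation exactly, the error [Hop h (w f)
    - E (w f)] is the commutator of the operator with [w], which is [O(e)]
    relative to [w f] itself: only the damped function occurs in the bound, so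
    that the blow-up of the norm of [w f] as [e] tends to 0 is harmless. *)
Theorem schnol_quasimode f (E : R) : 0 < E -> measurable_fun Rplus f ->
  (forall e : R, 0 < e < 2^-1 -> exists2 M : R, 0 < M &
     forall t : R, 0 < t -> `|f t| <= M * wt e t) ->
  (exists2 t : R, 0 < t & f t != 0) ->
  (forall t : R, 0 < t -> Hop h f t = E * f t) ->
  forall eta : R, 0 < eta -> exists u, [/\ sqi u, 0 < nrm2 u &
    nrm2 (fun t => Hop h u t - E * u t) <= eta * nrm2 u].
Proof.
move=> E0 mf fB [t0 t00 ft0] hf eta eta0.
have C0 := hk_C hC.
(* The commutator is bounded by [8 * e * C] times the operator with kernel
   [Ka 4^-1], whose norm is at most 8. *)
pose e := Num.min 8^-1 (Num.min 1 eta / (64 * C)).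
have e0 : 0 < e.
  by rewrite /e lt_min invr_gt0 ltr0n/= divr_gt0 ?mulr_gt0// lt_min ltr01.
have e8 : e <= 8^-1 by rewrite /e ge_min lexx.
have eC : 64 * C * e <= Num.min 1 eta.
  by rewrite mulrC -ler_pdivlMr ?mulr_gt0// /e ge_min lexx orbT.
have eC2 : (64 * C * e) ^+ 2 <= eta.
  have h1 : 64 * C * e <= 1 by apply: le_trans eC _; rewrite ge_min lexx.
  have h2 : 64 * C * e <= eta by apply: le_trans eC _; rewrite ge_min lexx orbT.
  have h0 : 0 <= 64 * C * e by rewrite mulr_ge0 ?mulr_ge0// ltW.
  by rewrite expr2 -[leRHS]mul1r ler_pM.
have e2 : 0 < e / 2 < 2^-1 by lra.
have [M M0 fM] := fB _ e2.
have af : adm f.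
  by apply: (adm_wt (al := e / 2) mf _ fM); rewrite ger0_norm; lra.
pose w t := expR (- e * `|ln t|).
have mw : measurable_fun Rplus w.
  apply: measurableT_comp => //; apply: measurable_funM => //.
  by apply: measurableT_comp => //; exact: measurable_lnRplus.
pose u t := w t * f t.
have mu : measurable_fun Rplus u by exact: measurable_funM.
have uM t : 0 < t -> `|u t| <= M * wt (- (e / 2)) t.
  move=> tp; rewrite /u normrM ger0_norm ?expR_ge0//.
  apply: le_trans (ler_wpM2l (expR_ge0 _) (fM t tp)) _.
  rewrite mulrCA ler_pM2l// /w /wt -expRD ler_expR; lra.
have su : sqi u.
  apply: sqi_le mu (sqiZ M (sqi_wt _)) uM; lra.
have au := sqi_adm su.
exists u; split => //.
  (* If the damped function vanished almost everywhere so would [f], and then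
     [E * f], being an integral of [f], would vanish everywhere. *)
  rewrite lt_neqAle ip_ge0 andbT eq_sym; apply/eqP => u0.
  have uz := ip0_aez su u0.
  move: ft0; rewrite -(mulrI_eq0 _ (lregP (lt0r_neq0 E0))) -hf//.
  rewrite (_ : Hop h f t0 = 0) ?eqxx//.
  rewrite (@ae_Hop _ _ _ hC f (fun=> 0))//.
    by rewrite /Hop -[RHS]Int0; apply: eq_Int => s _; rewrite mulr0.
  apply: filterS uz => s /[apply] /eqP; rewrite /u mulf_eq0 expR_eq0/=.
  by move/eqP.
have key t : 0 < t -> `|Hop h u t - E * u t| <= 8 * e * C * Kop 4^-1 u t.
  move=> tp; pose g s := (w s - w t) * f s.
  have -> : Hop h u t - E * u t = Int (fun s => h (t + s) * g s).
    have -> : E * u t = Hop h (fun s => w t * f s) t by rewrite (HopZ hC)// hf// /u; ring.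
    rewrite /Hop -IntB; [|exact: (itg_Hop hC)|by apply: (itg_Hop hC) => //; exact: admZ].
    by apply: eq_Int => s _; rewrite /g /u; ring.
  have i4 : 0 < 4^-1 :> R by rewrite invr_gt0.
  have jK := itg_Kop t i4 su.
  rewrite /Kop -IntZ//; apply: norm_Int; [|exact: itgZ|].
    have jb : itg (fun s => h (t + s) * u s - h (t + s) * (w t * f s)).
      by apply: itgB; apply: (itg_Hop hC) => //; exact: admZ.
    by apply: eq_itg jb => s _; rewrite /g /u; ring.
  move=> s sp; rewrite normrM ger0_norm; last by apply: (hk_ge0 hC); exact: addr_gt0.
  have h1 := h_le_Ka hC tp sp.
  have h2 := damping_diff_le t s (ltW e0) e8.
  rewrite /g normrM -/(w s) -/(w t) in h2 *.
  have h3 : `|u s| = w s * `|f s| by rewrite /u normrM ger0_norm ?expR_ge0.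
  have h4 : Ka 4^-1 t s = Ka 2^-1 t s * expR (4^-1 * `|ln s - ln t|).
    by rewrite /Ka -expRD; congr expR; field.
  rewrite h3 h4.
  have := ler_pM (hk_ge0 hC (addr_gt0 tp sp)) (normr_ge0 _) h1 h2.
  move/(ler_wpM2r (normr_ge0 (f s))); lra.
have i4 : 0 < 4^-1 :> R by rewrite invr_gt0.
have [sK nK] := schur_Kop i4 su.
have sH := (Hop_sqi hC su).1.
apply: (@le_trans _ _ (nrm2 (fun t => 8 * e * C * Kop 4^-1 u t))).
  have sd := sqiB sH (sqiZ E su); have sb := sqiZ (8 * e * C) sK.
  apply: le_Int; [exact: sqi_ip..|] => t tp; rewrite -!expr2.
  rewrite -real_normK ?num_real// lerXn2r ?nnegrE//; last exact: key.
  by rewrite mulr_ge0 ?Kop_ge0// !mulr_ge0// ltW.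
rewrite /nrm2 ipZl//; last exact: sqiZ.
rewrite ipZr//.
have := ler_wpM2l (sqr_ge0 (8 * e * C)) nK; rewrite invrK => h1.
have h2 := ler_wpM2r (ip_ge0 u) eC2.
by move: h1 h2; rewrite /nrm2; lra.
Qed.

End schnol.

(** * Selecting an eigenvector of a positive semidefinite matrix *)

Section symmetric_matrices.
Context {R : realType}.

Lemma Re_sum (I : Type) (r : seq I) (F : I -> R[i]) :
  complex.Re (\sum_(i <- r) F i) = \sum_(i <- r) complex.Re (F i).
Proof. by apply: (big_morph (@complex.Re R)) => // -[? ?] [? ?]. Qed.

Lemma Im_sum (I : Type) (r : seq I) (F : I -> R[i]) :
  complex.Im (\sum_(i <- r) F i) = \sum_(i <- r) complex.Im (F i).
Proof. by apply: (big_morph (@complex.Im R)) => // -[? ?] [? ?]. Qed.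

(** The spectral theorem over the complex numbers gives a unitary basis; the
    real and imaginary parts of its vectors are real eigenvectors forming a
    Parseval frame. A frame serves as well as a basis here and avoids choosing
    real eigenvectors. *)
Lemma psd_eigenframe n (A : 'M[R]_n) : A^T = A ->
  (forall x : 'I_n -> R, 0 <= \sum_i \sum_j x i * x j * A i j) ->
  exists (e : 'I_n * bool -> R) (Z : 'I_n * bool -> 'I_n -> R),
    [/\ forall k, 0 <= e k,
        forall k i, \sum_j A i j * Z k j = e k * Z k i &
        forall i j, \sum_k Z k i * Z k j = (i == j)%:R].
Proof.
move=> sA pA; pose Ac : 'M[R[i]]_n := map_mx (real_complex R) A.
have AcE j i : Ac j i = Complex (A j i) 0 by rewrite mxE.
have hA : Ac \is hermsymmx.
  apply: realsym_hermsym.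
    apply/is_hermitianmxP; rewrite expr0 scale1r map_mx_id//.
    by apply/matrixP => i j; rewrite !mxE -{1}sA mxE.
  by apply/mxOverP => i j; rewrite mxE complex_real.
pose P := spectralmx Ac; pose sp := spectral_diag Ac.
have PU : P \is unitarymx by exact: spectral_unitarymx.
have PE : P *m Ac = diag_mx sp *m P.
  have /hermitian_normalmx/orthomx_spectralP E := hA.
  by rewrite [in LHS]E !mulmxA mulmxV ?mul1mx//; exact: unitarymx_unit.
have /mxOverP spR := hermitian_spectral_diag_real hA.
pose e k := complex.Re (sp 0 k).
have spE k : sp 0 k = Complex (e k) 0.
  have := spR 0 k; rewrite /e -/sp; case: (sp 0 k) => a b.
  by rewrite complex_real => /eqP ->.
pose Z (k : 'I_n * bool) i := if k.2 then complex.Re (P k.1 i) else complex.Im (P k.1 i).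
have eig k i : \sum_j A i j * Z k j = e k.1 * Z k i.
  have /matrixP/(_ k.1 i) := PE; rewrite mul_diag_mx !mxE spE.
  case: k => k [] /=; rewrite /Z /=.
    have -> : e k * complex.Re (P k i) = complex.Re (Complex (e k) 0 * P k i).
      by case: (P k i) => a b /=; rewrite mul0r subr0.
    move=> <-; rewrite Re_sum; apply: eq_bigr => j _.
    rewrite AcE -{1}sA mxE; case: (P k j) => c d /=.
    by rewrite mulr0 subr0 mulrC.
  have -> : e k * complex.Im (P k i) = complex.Im (Complex (e k) 0 * P k i).
    by case: (P k i) => a b /=; rewrite mul0r addr0.
  move=> <-; rewrite Im_sum; apply: eq_bigr => j _.
  rewrite AcE -{1}sA mxE; case: (P k j) => c d /=.
  by rewrite mulr0 add0r mulrC.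
have orth i j : \sum_k Z k i * Z k j = (i == j)%:R.
  have PP : (P ^t*)%sesqui *m P = 1%:M by apply: mulmx1C; exact/unitarymxP.
  have /matrixP/(_ i j) := PP; rewrite !mxE.
  move/(congr1 (@complex.Re R)); rewrite Re_sum.
  have -> : complex.Re ((i == j)%:R : R[i]) = (i == j)%:R by case: (i == j).
  move=> <-; rewrite -(pair_bigA _ (fun k b => Z (k, b) i * Z (k, b) j)) /=.
  apply: eq_bigr => k _; rewrite big_bool /Z /= !mxE.
  by case: (P k i) => a b; case: (P k j) => c d /=; rewrite mulNr opprK.
have norm k : \sum_i (Z (k, true) i ^+ 2 + Z (k, false) i ^+ 2) = 1.
  have /unitarymxP/matrixP/(_ k k) := PU; rewrite !mxE eqxx.
  move/(congr1 (@complex.Re R)); rewrite Re_sum /= => <-.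
  apply: eq_bigr => i _; rewrite !mxE /Z /=.
  by case: (P k i) => a b /=; rewrite mulrN opprK !expr2.
exists (fun k => e k.1), Z; split => // -[k b] /=.
have q c : \sum_i \sum_j Z (k, c) i * Z (k, c) j * A i j = e k * \sum_i Z (k, c) i ^+ 2.
  rewrite mulr_sumr; apply: eq_bigr => i _.
  transitivity (Z (k, c) i * \sum_j A i j * Z (k, c) j).
    by rewrite mulr_sumr; apply: eq_bigr => j _; rewrite -mulrA [A i j * _]mulrC.
  by rewrite eig /= mulrCA expr2.
have := addr_ge0 (pA (Z (k, true))) (pA (Z (k, false))).
by rewrite !q -mulrDr -big_split /= norm mulr1.
Qed.

End symmetric_matrices.

Section eigenvector_selection.
Context {R : realType}.

Lemma parseval_frame n (K : finType) (Z : K -> 'I_n -> R) (x : 'I_n -> R) :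
  (forall i j, \sum_k Z k i * Z k j = (i == j)%:R) ->
  \sum_k (\sum_i x i * Z k i) ^+ 2 = \sum_i x i ^+ 2.
Proof.
move=> orth.
transitivity (\sum_k \sum_i \sum_j x i * x j * (Z k i * Z k j)).
  apply: eq_bigr => k _; rewrite expr2 mulr_suml; apply: eq_bigr => i _.
  by rewrite mulr_sumr; apply: eq_bigr => j _; ring.
rewrite exchange_big; apply: eq_bigr => i _ /=.
rewrite exchange_big /= (bigD1 i)//= [X in _ + X]big1 ?addr0.
  by rewrite -mulr_sumr orth eqxx mulr1 expr2.
by move=> j ji; rewrite -mulr_sumr orth eq_sym (negbTE ji) mulr0.
Qed.

(** Here [b] and [d] are [A c] and [A (A c)], and the hypothesis says that [A
    c] is an approximate eigenvector at [E0]. In the eigenframe it reads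
    [\sum_k e k ^+ 2 * ((e k - E0) ^+ 2 - del ^+ 2) * al k ^+ 2 <= - kap],
    where [al k] is the component of [c] along [Z k]. Negative terms come only
    from eigenvalues within [del] of [E0], and those below [c0] contribute at
    most [kap / 2]; so the others carry a definite amount of the mass of [c].
    On the other side the weighted norms [W k] satisfy [\sum_k e k * W k <=
    T], a trace. Hence some such [k] has [W k] bounded by a fixed multiple of
    [al k ^+ 2], and it remains to normalise its eigenvector. *)
Theorem eigenvector_selection n (A : 'M[R]_n) (c lgw : 'I_n -> R)
    (E0 del kap c0 T Q : R) :
  A^T = A -> (forall x : 'I_n -> R, 0 <= \sum_i \sum_j x i * x j * A i j) ->
  let b i := \sum_j A i j * c j in
  let d i := \sum_j A i j * b j in
  \sum_i (d i - E0 * b i) ^+ 2 - del ^+ 2 * \sum_i b i ^+ 2 <= - kap ->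
  0 < kap -> 0 < del -> 0 < c0 -> c0 ^+ 2 * del ^+ 2 * \sum_i c i ^+ 2 <= kap / 2 ->
  (forall i, 0 <= lgw i) -> \sum_i lgw i * A i i <= T ->
  T / c0 < Q * (kap / (2 * (`|E0| + del) ^+ 2 * del ^+ 2)) -> 0 <= Q ->
  exists E psi, [/\ `|E - E0| <= del, c0 <= E,
    forall i, \sum_j A i j * psi j = E * psi i,
    \sum_i c i * psi i = 1 & \sum_i lgw i * psi i ^+ 2 <= Q].
Proof.
move=> sA pA b d hS kap0 del0 c00 hc om0 hT hQ Q0.
have [e [Z [e0 eig orth]]] := psd_eigenframe sA pA.
have dual (x : 'I_n -> R) k :
    \sum_i (\sum_j A i j * x j) * Z k i = e k * \sum_i x i * Z k i.
  transitivity (\sum_i \sum_j x j * (A j i * Z k i)).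
    apply: eq_bigr => i _; rewrite mulr_suml; apply: eq_bigr => j _.
    by rewrite -{1}sA mxE; ring.
  rewrite exchange_big mulr_sumr; apply: eq_bigr => j _ /=.
  by rewrite -mulr_sumr eig; ring.
pose al k := \sum_i c i * Z k i.
pose W k := \sum_i lgw i * Z k i ^+ 2.
pose J k := (`|e k - E0| <= del) && (c0 <= e k).
set M := `|E0| + del in hQ *.
have M0 : 0 < M by rewrite ltr_wpDl.
have S1 : \sum_k e k ^+ 2 * ((e k - E0) ^+ 2 - del ^+ 2) * al k ^+ 2 <= - kap.
  apply: le_trans hS.
  rewrite -(parseval_frame (fun i => d i - E0 * b i) orth) -(parseval_frame b orth).
  rewrite mulr_sumr -sumrB; apply: le_of_eq.
  apply: eq_bigr => k _.
  have -> : \sum_i (d i - E0 * b i) * Z k i =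
     \sum_i d i * Z k i - E0 * \sum_i b i * Z k i.
    by rewrite mulr_sumr -sumrB; apply: eq_bigr => i _; ring.
  by rewrite /d /b !dual -/(al k); ring.
have S2 : \sum_k al k ^+ 2 = \sum_i c i ^+ 2 by exact: parseval_frame.
have S3 : \sum_k e k * W k <= T.
  apply: le_trans hT; apply: le_of_eq.
  transitivity (\sum_k \sum_i lgw i * (e k * Z k i * Z k i)).
    by apply: eq_bigr => k _; rewrite mulr_sumr; apply: eq_bigr => i _; ring.
  rewrite exchange_big; apply: eq_bigr => i _ /=; rewrite -mulr_sumr; congr (_ * _).
  under eq_bigr do rewrite -eig mulr_suml.
  rewrite exchange_big /= (bigD1 i)//= [X in _ + X]big1 ?addr0.
    under eq_bigr do rewrite -mulrA.
    by rewrite -mulr_sumr orth eqxx mulr1.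
  move=> j ji; under eq_bigr do rewrite -mulrA.
  by rewrite -mulr_sumr orth (negbTE ji) mulr0.
have W0 k : 0 <= W k by apply: sumr_ge0 => i _; rewrite mulr_ge0// sqr_ge0.
have [/existsP[k /andP[/andP[/andP[k1 k2] k3] k4]]|] :=
    boolP [exists k, J k && (al k != 0) && (W k <= Q * al k ^+ 2)].
  exists (e k), (fun i => Z k i / al k); split => //.
  - move=> i; rewrite mulrA -eig mulr_suml; apply: eq_bigr => j _.
    by rewrite mulrA.
  - under eq_bigr do rewrite mulrA.
    by rewrite -mulr_suml divff.
  - under eq_bigr do rewrite expr_div_n mulrA.
    by rewrite -mulr_suml ler_pdivrMr// exprn_even_gt0.
rewrite negb_exists => /forallP noK.
have JW k : J k -> Q * al k ^+ 2 <= W k.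
  move=> Jk; have := noK k; rewrite Jk /= negb_and negbK -ltNge.
  by case/orP => [/eqP ->|/ltW//]; rewrite expr0n mulr0.
pose SJ := \sum_(k | J k) al k ^+ 2.
(* If no eigenvector qualified, the trace bound would limit the mass [SJ] of
   [c] on the relevant eigenvalues from above, against [h3]. *)
have h1 : Q * SJ <= T / c0.
  rewrite ler_pdivlMr//; apply: le_trans S3; rewrite /SJ mulr_sumr mulr_suml.
  rewrite [leRHS](bigID J) /= -[leLHS]addr0; apply: lerD.
    apply: ler_sum => k Jk; rewrite mulrC.
    apply: (@le_trans _ _ (c0 * W k)); first by rewrite ler_pM2l// JW.
    by rewrite ler_wpM2r//; case/andP: Jk.
  by apply: sumr_ge0 => k _; rewrite mulr_ge0.
have h2 : - kap / 2 - M ^+ 2 * del ^+ 2 * SJ <= - kap.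
  apply: le_trans S1.
  apply: (@le_trans _ _ (\sum_k (- (c0 ^+ 2 * del ^+ 2 * al k ^+ 2) -
      (if J k then M ^+ 2 * del ^+ 2 * al k ^+ 2 else 0)))).
    rewrite sumrB sumrN -big_mkcond /= -!mulr_sumr -/SJ S2; lra.
  apply: ler_sum => k _; have a2 := sqr_ge0 (al k).
  have ek2 := sqr_ge0 (e k); have d2 := sqr_ge0 (e k - E0).
  have cd := mulr_ge0 (sqr_ge0 c0) (sqr_ge0 del).
  have pos := mulr_ge0 (mulr_ge0 ek2 d2) a2.
  have cda := mulr_ge0 cd a2.
  have da := mulr_ge0 (sqr_ge0 del) a2.
  have [/andP[k1 k2]|] := boolP (J k).
    have eM : e k ^+ 2 <= M ^+ 2.
      have ekM : e k <= M.
        move: k1; rewrite ler_distl => /andP[_]; have := ler_norm E0; rewrite /M; lra.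
      by rewrite lerXn2r ?nnegrE// ltW.
    have := ler_wpM2r da eM; lra.
  rewrite negb_and -!ltNge => /orP[k1|k1].
    have : del ^+ 2 <= (e k - E0) ^+ 2.
      by rewrite -[leRHS]real_normK ?num_real// lerXn2r ?nnegrE// ltW.
    move=> k2; have {}k2 : 0 <= (e k - E0) ^+ 2 - del ^+ 2 by rewrite subr_ge0.
    have := mulr_ge0 (mulr_ge0 ek2 k2) a2; lra.
  have ec : e k ^+ 2 <= c0 ^+ 2 by rewrite lerXn2r ?nnegrE// ltW.
  have := ler_wpM2r da ec; lra.
have Md : 0 < M ^+ 2 * del ^+ 2 by rewrite mulr_gt0 ?exprn_gt0.
have h3 : kap / (2 * M ^+ 2 * del ^+ 2) <= SJ.
  rewrite ler_pdivrMr ?mulr_gt0 ?exprn_gt0//; lra.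
have := ler_wpM2l Q0 h3 => h4.
by have := lt_le_trans hQ (le_trans h4 h1); rewrite ltxx.
Qed.

End eigenvector_selection.

(** * Logarithmic grids *)

Section log_grid.
Context {R : realType}.
Implicit Types (N i j : nat) (s t : R) (F G : nat -> R).
Notation leb := (@lebesgue_measure R).

Definition gstep N : R := N.+1%:R^-1.
Definition gpt N i : R := expR (i%:R * gstep N - N.+1%:R).
Definition gsz N : nat := (2 * N.+1 ^ 2)%N.
Definition gcell N i : set R := `[gpt N i, gpt N i.+1[%classic.
Definition glen N i : R := gpt N i.+1 - gpt N i.
(** The grid is uniform in [ln s], with mesh [gstep N], and covers the range
    from [expR (- N.+1%:R)] to [expR N.+1%:R], so that it becomes both finer
    and longer as [N] grows. *)
Definition samp N F s : R := \sum_(i < gsz N) F i * \1_(gcell N i) s.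

Lemma gstep_gt0 N : 0 < gstep N.
Proof. by rewrite invr_gt0. Qed.

Lemma gstep_le1 N : gstep N <= 1.
Proof. by rewrite invf_le1// ler1n. Qed.

Lemma gpt_gt0 N i : 0 < gpt N i.
Proof. exact: expR_gt0. Qed.

Lemma ln_gpt N i : ln (gpt N i) = i%:R * gstep N - N.+1%:R.
Proof. by rewrite /gpt expRK. Qed.

Lemma gptS N i : gpt N i.+1 = expR (gstep N) * gpt N i.
Proof. by rewrite /gpt -expRD; congr expR; rewrite -natr1; ring. Qed.

Lemma gpt_lt N i j : (i < j)%N -> gpt N i < gpt N j.
Proof.
by move=> ij; rewrite ltr_expR ltrD2r ltr_pM2r ?gstep_gt0// ltr_nat.
Qed.

Lemma gpt_le N i j : (i <= j)%N -> gpt N i <= gpt N j.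
Proof. by move=> ij; rewrite ler_expR lerD2r ler_pM2r ?gstep_gt0// ler_nat. Qed.

Lemma glen_gt0 N i : 0 < glen N i.
Proof. by rewrite subr_gt0 gpt_lt. Qed.

Lemma gcell_gpt N i : gcell N i (gpt N i).
Proof. by rewrite /gcell /= in_itv/= lexx gpt_lt. Qed.

Lemma gcell_gt0 N i s : gcell N i s -> 0 < s.
Proof.
rewrite /gcell /= in_itv/= => /andP[h _]; exact: lt_le_trans (gpt_gt0 N i) h.
Qed.

Lemma gcell_ln N i s : gcell N i s ->
  ln (gpt N i) <= ln s /\ ln s <= ln (gpt N i) + gstep N.
Proof.
move=> cs; have s0 := gcell_gt0 cs.
move: cs; rewrite /gcell /= in_itv/= => /andP[h1 h2]; split.
  by rewrite ler_ln ?posrE ?gpt_gt0.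
rewrite -(expRK (gstep N)) -lnM ?posrE ?expR_gt0 ?gpt_gt0// mulrC -gptS.
by rewrite ler_ln ?posrE ?gpt_gt0// ltW.
Qed.

Lemma gcell_ln_dist N i s : gcell N i s -> `|ln (gpt N i) - ln s| <= gstep N.
Proof. by move=> /gcell_ln[h1 h2]; rewrite ler_norml; apply/andP; split; lra. Qed.

Lemma gcell_inj N i j s : gcell N i s -> gcell N j s -> i = j.
Proof.
rewrite /gcell /= !in_itv/= => /andP[i1 i2] /andP[j1 j2].
case: (ltngtP i j) => // ij.
  by have := lt_le_trans i2 (le_trans (gpt_le N ij) j1); rewrite ltxx.
by have := lt_le_trans j2 (le_trans (gpt_le N ij) i1); rewrite ltxx.
Qed.

Lemma samp_cell N F i s : (i < gsz N)%N -> gcell N i s -> samp N F s = F i.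
Proof.
move=> iN cs; rewrite /samp (bigD1 (Ordinal iN))//= big1 ?addr0.
  by rewrite indicE mem_set// mulr1.
move=> j ji; rewrite indicE memNset ?mulr0// => cj.
by move: ji; rewrite -val_eqE /= (gcell_inj cj cs) eqxx.
Qed.

(** Outside the range of the grid all step functions vanish; this is the case
    distinction behind every identity between step functions. *)
Lemma samp_locate N s :
  (exists2 i, (i < gsz N)%N & gcell N i s) \/ (forall F, samp N F s = 0).
Proof.
have [[i [iN ci]]|no] := pselect (exists i, (i < gsz N)%N /\ gcell N i s).
  by left; exists i.
right=> F; apply: big1 => i _; rewrite indicE memNset ?mulr0// => ci.
by apply: no; exists i.
Qed.

Lemma gpt0 N : gpt N 0 = expR (- N.+1%:R).
Proof. by rewrite /gpt mul0r add0r. Qed.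

Lemma gpt_end N : gpt N (gsz N) = expR (N.+1%:R).
Proof.
rewrite /gpt /gsz natrM expnS expn1 natrM /gstep; congr expR.
have : N.+1%:R != 0 :> R by rewrite pnatr_eq0.
by move: (N.+1%:R) => x x0; field.
Qed.

Lemma gcell_exists N s : expR (- N.+1%:R) <= s -> s < expR N.+1%:R ->
  exists2 i, (i < gsz N)%N & gcell N i s.
Proof.
move=> h1 h2.
have s0 : 0 < s by apply: lt_le_trans h1; exact: expR_gt0.
pose P i := gpt N i <= s.
have P0 : exists i, P i by exists 0%N; rewrite /P gpt0.
have PN i : P i -> (i <= gsz N)%N.
  move=> Pi; rewrite leqNgt; apply/negP => ni.
  have := lt_le_trans (gpt_lt N ni) Pi; rewrite gpt_end => /lt_trans/(_ h2).
  by rewrite ltxx.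
case: (ex_maxnP P0 PN) => i Pi imax; exists i.
  rewrite ltn_neqAle PN// andbT; apply/eqP => iE.
  by move: Pi; rewrite /P iE gpt_end leNgt h2.
rewrite /gcell /= in_itv/= (_ : gpt N i <= s)//= ltNge; apply/negP => Pi1.
by have := imax _ Pi1; rewrite ltnn.
Qed.

Lemma gcell_eventually s : 0 < s -> exists n0, forall N, (n0 <= N)%N ->
  exists2 i, (i < gsz N)%N & gcell N i s.
Proof.
move=> s0; exists (Num.bound (ln s)) => N nN.
have h : `|ln s| < N.+1%:R.
  apply: lt_trans (archi_boundP (normr_ge0 _)) _.
  by rewrite /Num.bound normr_id ltr_nat ltnS.
move: h; rewrite ltr_norml => /andP[a b].
apply: gcell_exists.
  by rewrite -[leRHS]lnK ?posrE// ler_expR ltW.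
by rewrite -[ltLHS]lnK ?posrE// ltr_expR.
Qed.

Lemma measurable_gcell N i : measurable (gcell N i).
Proof. exact: measurable_itv. Qed.

Lemma measurable_samp N F : measurable_fun Rplus (samp N F).
Proof.
apply: measurable_sum => i; apply: measurable_funM => //.
by apply: measurable_indic; exact: measurable_gcell.
Qed.

Lemma itg_indic_gcell N i :
  itg (\1_(gcell N i) : R -> R) /\ Int (\1_(gcell N i)) = glen N i.
Proof.
have mc := measurable_gcell N i.
have hl : leb (gcell N i) = (glen N i)%:E.
  by rewrite lebesgue_measure_itv/= lte_fin gpt_lt.
have E : (\int[leb]_(x in Rplus) (\1_(gcell N i) x)%:E = (glen N i)%:E)%E.
  rewrite integral_indic//; last exact: mRplus.
  rewrite (_ : gcell N i `&` Rplus = gcell N i); last first.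
    by apply/setIidPl => s /gcell_gt0 s0; apply/RplusE.
  exact: hl.
split; last by rewrite /Int /Rintegral E.
apply/integrableP; split.
  by apply/measurable_EFinP; exact: measurable_indic.
under eq_integral do rewrite /= ger0_norm//.
by rewrite E ltry.
Qed.

Lemma itg_samp N F : itg (samp N F).
Proof. by apply: itg_sum => i; apply: itgZ; have [] := itg_indic_gcell N i. Qed.

Lemma Int_samp N F : Int (samp N F) = \sum_(i < gsz N) F i * glen N i.
Proof.
rewrite Int_sum; last by move=> i; apply: itgZ; have [] := itg_indic_gcell N i.
by apply: eq_bigr => i _; have [j <-] := itg_indic_gcell N i; rewrite IntZ.
Qed.

Lemma gcell_le N i s : gcell N i s -> gpt N i <= s.
Proof. by rewrite /gcell /= in_itv/= => /andP[]. Qed.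

Lemma gcell_expR1 N i s : gcell N i s -> s <= expR 1 * gpt N i.
Proof.
rewrite /gcell /= in_itv/= => /andP[_ /ltW h]; apply: le_trans h _.
by rewrite gptS ler_pM2r ?gpt_gt0// ler_expR gstep_le1.
Qed.

(** The mesh is uniform in the logarithm, hence proportional to the point. *)
Lemma gcell_dist N i s : gcell N i s -> `|gpt N i - s| <= s * gstep N.
Proof.
move=> cs; have s0 := gcell_gt0 cs; have h1 := gcell_le cs.
rewrite distrC ger0_norm ?subr_ge0//.
have : gpt N i.+1 >= s by move: cs; rewrite /gcell /= in_itv/= => /andP[_ /ltW].
rewrite gptS => h2.
have h3 : expR (- gstep N) * s <= gpt N i.
  have := ler_wpM2l (expR_ge0 (- gstep N)) h2.
  by rewrite mulrA -expRD addNr expR0 mul1r.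
have h4 : 1 - gstep N <= expR (- gstep N) by have := expR_ge1Dx (- gstep N); lra.
have := ler_wpM2r (ltW s0) h4; lra.
Qed.

(** Weights and kernels change by bounded factors across a cell, so that
    bounds at the grid points and bounds for step functions are
    interchangeable. *)
Lemma wt_gcell al N i s : `|al| <= 2^-1 -> gcell N i s ->
  wt al (gpt N i) <= expR 1 * wt al s.
Proof.
move=> al2 cs; rewrite /wt -expRD ler_expR.
have h1 := wtM_le al (gpt N i) s.
have h2 := le_trans (gcell_ln_dist cs) (gstep_le1 N).
have h3 : `|al| * `|ln (gpt N i) - ln s| <= 2^-1.
  by rewrite -[leRHS]mulr1; apply: ler_pM.
have h4 : - (ln (gpt N i) - ln s) <= 1 by move: h2; rewrite ler_norml => /andP[]; lra.
lra.
Qed.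

Lemma Ka_half_gcell N i s t : 0 < t -> gcell N i s ->
  Ka 2^-1 (gpt N i) t <= expR 1 * Ka 2^-1 s t.
Proof.
move=> t0 cs; have s0 := gcell_gt0 cs; have p0 := gpt_gt0 N i.
rewrite !Ka_half//.
have m0 : 0 < Num.max s t by rewrite lt_max s0.
have n0 : 0 < Num.max (gpt N i) t by rewrite lt_max p0.
rewrite -ler_pdivrMl ?expR_gt0// -invfM lef_pV2 ?posrE ?mulr_gt0 ?expR_gt0//.
rewrite ge_max; apply/andP; split.
  apply: le_trans (gcell_expR1 cs) _.
  by rewrite ler_pM2l ?expR_gt0// le_max lexx.
apply: (@le_trans _ _ (1 * Num.max (gpt N i) t)).
  by rewrite mul1r le_max lexx orbT.
have e1 : 1 <= expR 1 :> R by have := expR_ge1Dx (1 : R); lra.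
by rewrite ler_wpM2r ?(ltW n0).
Qed.

End log_grid.

(** * Convergence of the discretised operator *)

Section nystrom.
Context {R : realType}.
Implicit Types (N i j n : nat) (s t y : R) (F G : nat -> R).

Lemma cvg_dist_le (u v e : nat -> R) (l : R) n0 :
  v n @[n --> \oo] --> l -> e n @[n --> \oo] --> (0 : R) ->
  (forall n, (n0 <= n)%N -> `|u n - v n| <= e n) -> u n @[n --> \oo] --> l.
Proof.
move=> vl e0 uv; rewrite -(addr0 l).
have -> : u = fun n => v n + (u n - v n) by apply/funext => n; rewrite addrC subrK.
apply: cvgD => //; apply/cvgr0Pnorm_le => eps eps0.
have /cvgr0Pnorm_le/(_ eps eps0)[n1 _ hn1] := e0.
exists (maxn n0 n1) => // n /=; rewrite geq_max => /andP[a b].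
by apply: le_trans (uv n a) _; apply: le_trans (hn1 n b); exact: ler_norm.
Qed.

Lemma gstep_cvg0 (nu : nat -> nat) : (forall n, (n <= nu n)%N) ->
  gstep (nu n) @[n --> \oo] --> (0 : R).
Proof.
move=> hnu; apply: (squeeze_cvgr (f := fun=> 0) (h := @harmonic R)).
- apply: nearW => n; rewrite ltW ?gstep_gt0//= /harmonic /gstep.
  by rewrite lef_pV2 ?posrE// ler_nat ltnS.
- exact: cvg_cst.
- exact: cvg_harmonic.
Qed.

Variables (h : R -> R) (C : R) (hC : hankel_like h C).

(** The quadrature of the integral operator on the grid. *)
Definition nys N F i : R := \sum_(j < gsz N) h (gpt N i + gpt N j) * F j * glen N j.

(** The step function in both variables whose integral over the second is the
    quadrature; it converges pointwise to the integrand of the operator. *)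
Definition nys_integrand N F t y : R :=
  samp N (fun j => samp N (fun i => h (gpt N i + gpt N j)) t * F j) y.

Lemma Int_nys N F t : Int (nys_integrand N F t) = samp N (nys N F) t.
Proof.
rewrite Int_samp /samp /nys.
transitivity (\sum_(j < gsz N) \sum_(i < gsz N)
    h (gpt N i + gpt N j) * F j * glen N j * \1_(gcell N i) t).
  apply: eq_bigr => j _; rewrite -mulrA mulr_suml; apply: eq_bigr => i _; ring.
by rewrite exchange_big; apply: eq_bigr => i _ /=; rewrite mulr_suml.
Qed.

Lemma nys_integrand_le N F (al M : R) t y : `|al| <= 2^-1 -> 0 <= M ->
  (forall i, (i < gsz N)%N -> `|F i| <= M * wt al (gpt N i)) ->
  0 < t -> 0 < y ->
  `|nys_integrand N F t y| <= C * M * expR 1 ^+ 3 * (Ka 2^-1 t y * wt al y).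
Proof.
move=> al2 M0 FM t0 y0; have C0 := ltW (hk_C hC); have e1 := expR_ge0 (1 : R).
have B0 : 0 <= C * M * expR 1 ^+ 3 * (Ka 2^-1 t y * wt al y).
  by rewrite mulr_ge0 ?mulr_ge0 ?exprn_ge0 ?expR_ge0.
rewrite /nys_integrand.
have [[j jN cj]|->] := samp_locate N y; last by rewrite normr0.
rewrite (samp_cell _ jN cj).
have [[i iN ci]|->] := samp_locate N t; last by rewrite mul0r normr0.
rewrite (samp_cell _ iN ci) normrM ger0_norm; last first.
  by apply: (hk_ge0 hC); apply: addr_gt0; exact: gpt_gt0.
have h1 := h_le_Ka hC (gpt_gt0 N i) (gpt_gt0 N j).
have h2 := Ka_half_gcell (gpt_gt0 N j) ci.
have h3 := Ka_half_gcell t0 cj; rewrite !(Ka_sym _ _ t) in h3.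
have h4 : h (gpt N i + gpt N j) <= C * (expR 1 * (expR 1 * Ka 2^-1 t y)).
  apply: le_trans h1 _; apply: ler_wpM2l => //; apply: le_trans h2 _.
  exact: ler_wpM2l.
have h5 : `|F j| <= M * (expR 1 * wt al y).
  by apply: le_trans (FM j jN) _; apply: ler_wpM2l => //; exact: wt_gcell.
have hp : 0 <= h (gpt N i + gpt N j).
  by apply: (hk_ge0 hC); apply: addr_gt0; exact: gpt_gt0.
have := ler_pM hp (normr_ge0 (F j)) h4 h5.
move/le_trans; apply; apply: le_of_eq; ring.
Qed.

Lemma samp_nys_le N F (al M : R) t : `|al| < 2^-1 -> 0 <= M ->
  (forall i, (i < gsz N)%N -> `|F i| <= M * wt al (gpt N i)) -> 0 < t ->
  `|samp N (nys N F) t| <= C * M * expR 1 ^+ 3 * (2 / (2^-1 - `|al|)) * wt al t.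
Proof.
move=> al2 M0 FM t0; rewrite -Int_nys.
have [j I] := itg_Ka_wt t al2.
apply: (@le_trans _ _ (C * M * expR 1 ^+ 3 * Int (fun y => Ka 2^-1 t y * wt al y))).
  rewrite -IntZ//; apply: norm_Int; [exact: itg_samp|exact: itgZ|].
  by move=> y y0; apply: nys_integrand_le => //; exact: ltW.
rewrite -[leRHS]mulrA; apply: ler_wpM2l => //.
rewrite mulr_ge0 ?exprn_ge0 ?expR_ge0// mulr_ge0//; exact: ltW (hk_C hC).
Qed.

Lemma nys_le N F (al M : R) i : `|al| < 2^-1 -> 0 <= M ->
  (forall i, (i < gsz N)%N -> `|F i| <= M * wt al (gpt N i)) -> (i < gsz N)%N ->
  `|nys N F i| <= C * M * expR 1 ^+ 3 * (2 / (2^-1 - `|al|)) * wt al (gpt N i).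
Proof.
move=> al2 M0 FM iN; have := samp_nys_le al2 M0 FM (gpt_gt0 N i).
by rewrite (samp_cell _ iN (gcell_gpt N i)).
Qed.

Lemma samp_le N F (al M : R) t : `|al| <= 2^-1 -> 0 <= M ->
  (forall i, (i < gsz N)%N -> `|F i| <= M * wt al (gpt N i)) -> 0 < t ->
  `|samp N F t| <= M * expR 1 * wt al t.
Proof.
move=> al2 M0 FM t0.
have [[i iN ci]|->] := samp_locate N t; last first.
  by rewrite normr0 !mulr_ge0// expR_ge0.
rewrite (samp_cell _ iN ci) -mulrA; apply: le_trans (FM i iN) _.
by apply: ler_wpM2l => //; exact: wt_gcell.
Qed.

Variables (nu : nat -> nat) (hnu : forall n, (n <= nu n)%N).

Lemma nys_integrand_cvg (F : nat -> nat -> R) (phi : R -> R) al M t y :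
  `|al| <= 2^-1 -> 0 <= M ->
  (forall n i, (i < gsz (nu n))%N -> `|F n i| <= M * wt al (gpt (nu n) i)) ->
  samp (nu n) (F n) y @[n --> \oo] --> phi y -> 0 < t -> 0 < y ->
  nys_integrand (nu n) (F n) t y @[n --> \oo] --> h (t + y) * phi y.
Proof.
move=> al2 M0 FM Fy t0 y0; have C0 := ltW (hk_C hC).
have [n1 hn1] := gcell_eventually t0; have [n2 hn2] := gcell_eventually y0.
have v1 : h (t + y) * samp (nu n) (F n) y @[n --> \oo] --> h (t + y) * phi y.
  by apply: cvgM => //; exact: cvg_cst.
pose m := (expR 1)^-1 * (t + y).
have m0 : 0 < m by rewrite mulr_gt0 ?addr_gt0// invr_gt0 expR_gt0.
pose K := C * (t + y) / m ^+ 2 * (M * expR 1 * wt al y).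
have v2 : K * gstep (nu n) @[n --> \oo] --> (0 : R).
  rewrite -(mulr0 K); apply: cvgM; first exact: cvg_cst.
  exact: gstep_cvg0.
apply: (cvg_dist_le (n0 := maxn n1 n2) v1 v2) => n; rewrite geq_max => /andP[a b].
have [i iN ci] := hn1 _ (leq_trans a (hnu n)).
have [j jN cj] := hn2 _ (leq_trans b (hnu n)).
have FB := samp_le al2 M0 (FM n) y0.
move: FB; rewrite /nys_integrand !(samp_cell _ jN cj) (samp_cell _ iN ci) => FB.
rewrite -mulrBl normrM.
have mt : m <= gpt (nu n) i + gpt (nu n) j.
  rewrite /m ler_pdivrMl ?expR_gt0// mulrDr; apply: lerD; exact: gcell_expR1.
have mty : m <= t + y.
  have e1 : 1 <= expR 1 :> R by have := expR_ge1Dx (1 : R); lra.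
  rewrite /m ler_pdivrMl ?expR_gt0//.
  by apply: ler_peMl => //; rewrite addr_ge0// ltW.
have L := hk_lip hC m0 mt mty.
have D : `|gpt (nu n) i + gpt (nu n) j - (t + y)| <= (t + y) * gstep (nu n).
  rewrite opprD addrACA mulrDl; apply: le_trans (ler_normD _ _) _.
  by apply: lerD; exact: gcell_dist.
have {}L : `|h (gpt (nu n) i + gpt (nu n) j) - h (t + y)| <=
    C * ((t + y) * gstep (nu n)) / m ^+ 2.
  apply: le_trans L _; apply: ler_wpM2r; first by rewrite invr_ge0 exprn_ge0// ltW.
  exact: ler_wpM2l.
have := ler_pM (normr_ge0 _) (normr_ge0 _) L FB.
move/le_trans; apply; rewrite /K; apply: le_of_eq; ring.
Qed.

(** Dominated convergence for the step functions [nys_integrand], dominated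
    uniformly in the grid by [Ka 2^-1 t * wt al]. *)
Theorem nys_cvg (F : nat -> nat -> R) (phi : R -> R) (al M : R) :
  `|al| < 2^-1 -> 0 <= M ->
  (forall n i, (i < gsz (nu n))%N -> `|F n i| <= M * wt al (gpt (nu n) i)) ->
  (forall y, 0 < y -> samp (nu n) (F n) y @[n --> \oo] --> phi y) ->
  forall t, 0 < t -> samp (nu n) (nys (nu n) (F n)) t @[n --> \oo] --> Hop h phi t.
Proof.
move=> al2 M0 FM Fy t t0.
under eq_cvg do rewrite -Int_nys.
have [||||//] := @Int_dominated_cvg _ (fun n => nys_integrand (nu n) (F n) t)
  (fun y => h (t + y) * phi y)
  (fun y => C * M * expR 1 ^+ 3 * (Ka 2^-1 t y * wt al y)).
- by move=> n; exact: measurable_samp.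
- move=> y y0; apply: (nys_integrand_cvg (ltW al2) M0 FM) => //; exact: Fy.
- by apply: itgZ; have [] := itg_Ka_wt t al2.
- by move=> n y y0; apply: nys_integrand_le => //; [exact: ltW|exact: FM].
Qed.

End nystrom.

(** * Extracting pointwise convergent subsequences *)

Section extraction.
Context {R : realType}.

(** Limits along an ultrafilter exist for all the bounded sequences
    simultaneously; the subsequence then follows the ultrafilter closely
    enough. *)
Lemma diagonal_extraction (a : nat -> nat -> R) (B : nat -> R) :
  (forall n k, `|a n k| <= B k) ->
  exists2 mu : nat -> nat, (forall n, (n <= mu n)%N) &
    forall k, cvgn (fun n => a (mu n) k).
Proof.
move=> aB.
have [U [UU Uoo]] := @ultraFilterLemma nat (\oo : set_system nat) _.
have UP : ProperFilter U by exact: ultra_proper.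
have /choice[p hp] : forall k, exists p : R, a n k @[n --> U] --> p.
  move=> k.
  have cB : compact `[- B k, B k]%classic by exact: segment_compact.
  have [|p [_ clp]] := cB (a n k @[n --> U]) _.
    have h : U [set n | `[- B k, B k]%classic (a n k)].
      by apply: filterE => n /=; rewrite in_itv/= -ler_norml; exact: aB.
    exact: h.
  exists p => V Vp; have [//|UV] := in_ultra_setVsetC ((fun n => a n k) @^-1` V) UU.
  have [z [Vz nVz]] := clp (~` V) V UV Vp; contradiction.
pose S n := [set j | (n <= j)%N /\
  forall k, (k <= n)%N -> `|p k - a j k| < n.+1%:R^-1].
have SU n : U (S n).
  have U1 : U [set j | (n <= j)%N] by apply: Uoo; exists n.
  have U2 m : U [set j | forall k, (k < m)%N -> `|p k - a j k| < n.+1%:R^-1].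
    elim: m => [|m IH]; first by apply: filterE.
    have : U [set j | `|p m - a j m| < n.+1%:R^-1].
      have /cvgrPdist_lt/(_ n.+1%:R^-1) := hp m; apply.
      by rewrite invr_gt0.
    move=> Um; apply: filterS (filterI IH Um) => j [h1 h2] k.
    by rewrite ltnS leq_eqVlt => /orP[/eqP ->|] //; exact: h1.
  by apply: filterS (filterI U1 (U2 n.+1)) => j [].
have /choice[mu hmu] : forall n, exists j, S n j.
  by move=> n; exact: (filter_ex (SU n)).
exists mu; first by move=> n; have [] := hmu n.
move=> k; apply/cvg_ex; exists (p k); apply/cvgrPdist_lt => e e0.
have /cvgr0Pnorm_lt/(_ e e0)[n1 _ hn1] := @cvg_harmonic R.
exists (maxn n1 k) => // n /=; rewrite geq_max => /andP[a1 a2].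
have [_ /(_ k a2)] := hmu n; move/lt_trans; apply.
by have := hn1 n a1; rewrite /= /harmonic ger0_norm.
Qed.

(** Convergence is extracted at the positive rational points, and the local
    Lipschitz bounds carry it to all points. *)
Lemma lipschitz_extraction (E : nat -> R) (g : nat -> R -> R) (K : R) (B L : R -> R) :
  (forall n, `|E n| <= K) ->
  (forall n (t : R), 0 < t -> `|g n t| <= B t) ->
  (forall n (m t s : R), 0 < m -> m <= t -> m <= s ->
     `|g n t - g n s| <= L m * `|t - s|) ->
  exists2 mu : nat -> nat, (forall n, (n <= mu n)%N) &
    cvgn (fun n => E (mu n)) /\ forall t : R, 0 < t -> cvgn (fun n => g (mu n) t).
Proof.
move=> EK gB gL.
pose q (k : nat) : R := if unpickle k is Some r then ratr r else 0.
(* Index 0 is reserved for the numbers [E n]. *)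
pose a n k : R := if k is k'.+1 then (if 0 < q k' then g n (q k') else 0) else E n.
pose b k : R := if k is k'.+1 then (if 0 < q k' then B (q k') else 0) else K.
have [|mu hmu cmu] := @diagonal_extraction a b.
  move=> n [|k]; first exact: EK.
  by rewrite /a /b; case: ifP => [|_]; [exact: gB|rewrite normr0].
exists mu => //; split; first exact: (cmu 0%N).
move=> t t0; apply/cauchy_cvgP/cauchyP => e e0.
have t2 : 0 < t / 2 by rewrite divr_gt0.
have L1 : 0 < `|L (t / 2)| + 1 by rewrite ltr_wpDl.
pose d := Num.min (t / 2) (e / 4 / (`|L (t / 2)| + 1)).
have d0 : 0 < d by rewrite lt_min t2 !divr_gt0.
have [r rP] := rat_in_itvoo (ltr_pwDr d0 (lexx t)).
move: rP; rewrite in_itv/= => /andP[r1 r2].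
have qE : q (pickle r) = ratr r by rewrite /q pickleK.
have r0 : 0 < ratr r :> R by exact: lt_trans r1.
have cr : cvgn (fun n => g (mu n) (ratr r)).
  by have := cmu (pickle r).+1; rewrite /a qE r0.
have gd n : `|g n t - g n (ratr r)| <= e / 4.
  apply: le_trans (gL n (t / 2) _ _ t2 _ _) _; [lra|lra|].
  apply: (@le_trans _ _ ((`|L (t / 2)| + 1) * `|t - ratr r|)).
    by rewrite ler_wpM2r// (le_trans (ler_norm _))// lerDl.
  rewrite mulrC -ler_pdivlMr// distrC ger0_norm; last by lra.
  have : d <= e / 4 / (`|L (t / 2)| + 1) by rewrite ge_min lexx orbT.
  lra.
have e4 : 0 < e / 4 by rewrite divr_gt0.
have /cvgrPdist_lt/(_ _ e4)[n1 _ hn1] := cr.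
exists (g (mu n1) t); exists n1 => // n /= hn.
rewrite /ball/= .
have h1 := gd (mu n1); have h2 := gd (mu n).
have h3 := hn1 n hn; have h4 := hn1 n1 (leqnn _).
move: h1 h2 h3 h4; move: (limn _) => l.
rewrite !ler_norml !ltr_norml => /andP[a1 a2] /andP[b1 b2] /andP[c1 c2] /andP[d1 d2].
by apply/andP; split; lra.
Qed.

End extraction.

(** * Limits of discrete eigenvectors *)

Section eigenvector_limit.
Context {R : realType}.
Implicit Types (N i j n : nat) (s t y : R) (F G : nat -> R).
Variables (h : R -> R) (C : R) (hC : hankel_like h C).

Lemma grid_sum_le N F (k : nat -> R) (A al M t : R) :
  `|al| < 2^-1 -> 0 <= A -> 0 <= M -> 0 < t ->
  (forall i, (i < gsz N)%N -> `|F i| <= M * wt al (gpt N i)) ->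
  (forall i, (i < gsz N)%N -> `|k i| <= A * Ka 2^-1 t (gpt N i)) ->
  `|\sum_(j < gsz N) k j * F j * glen N j| <=
    A * M * expR 1 ^+ 2 * (2 / (2^-1 - `|al|)) * wt al t.
Proof.
move=> al2 A0 M0 t0 FM kA; rewrite -(Int_samp N (fun j => k j * F j)).
have [j I] := itg_Ka_wt t al2.
have e1 := expR_ge0 (1 : R).
have B0 : 0 <= A * M * expR 1 ^+ 2 by rewrite mulr_ge0 ?exprn_ge0// mulr_ge0.
apply: (@le_trans _ _ (A * M * expR 1 ^+ 2 * Int (fun y => Ka 2^-1 t y * wt al y))).
  rewrite -IntZ//; apply: norm_Int; [exact: itg_samp|exact: itgZ|].
  move=> y y0.
  have [[i iN ci]|->] := samp_locate N y; last first.
    by rewrite normr0; apply: mulr_ge0 => //; apply: mulr_ge0; exact: expR_ge0.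
  rewrite (samp_cell _ iN ci) normrM.
  have h3 := Ka_half_gcell t0 ci; rewrite !(Ka_sym _ _ t) in h3.
  have h4 : `|k i| <= A * (expR 1 * Ka 2^-1 t y).
    by apply: le_trans (kA i iN) _; exact: ler_wpM2l.
  have h5 : `|F i| <= M * (expR 1 * wt al y).
    apply: le_trans (FM i iN) _; apply: ler_wpM2l => //.
    by apply: wt_gcell => //; exact: ltW.
  have := ler_pM (normr_ge0 _) (normr_ge0 _) h4 h5.
  move/le_trans; apply; apply: le_of_eq; ring.
by rewrite -[leRHS]mulrA; apply: ler_wpM2l.
Qed.

Variables (nu : nat -> nat) (hnu : forall n, (n <= nu n)%N).
Variables (x : nat -> nat -> R) (e : nat -> R) (K c0 : R).
Hypothesis c0_gt0 : 0 < c0.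
Hypothesis e_ge : forall n, c0 <= e n.
Hypothesis e_le : forall n, e n <= K.
Hypothesis eigen : forall n i, (i < gsz (nu n))%N ->
  nys h (nu n) (x n) i = e n * x n i.
Hypothesis xB : forall eps : R, 0 < eps < 2^-1 -> exists2 M : R, 0 <= M &
  forall n i, (i < gsz (nu n))%N -> `|x n i| <= M * wt eps (gpt (nu n) i).

(** The eigenvectors are known only on the grid, but the eigenvalue equation
    extends them: [g n t = \sum_j h (t + t_j) x_j] is defined for every [t >
    0], agrees with [e n * x n] at the grid points and is locally Lipschitz
    uniformly in [n]. *)
Lemma eigenvector_subsequence :
  exists (mu : nat -> nat) (E : R) (f : R -> R),
    [/\ forall n, (n <= mu n)%N, e (mu n) @[n --> \oo] --> E, c0 <= E &
        forall s : R, 0 < s -> samp (nu (mu n)) (x (mu n)) s @[n --> \oo] --> f s].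
Proof.
have C0 := ltW (hk_C hC).
have q4 : `|4^-1 : R| < 2^-1 by rewrite ger0_norm//; lra.
have [|M M0 xM] := xB (eps := 4^-1); first by lra.
pose g n t := \sum_(j < gsz (nu n)) h (t + gpt (nu n) j) * x n j * glen (nu n) j.
pose Z := C * M * expR 1 ^+ 2 * (2 / (2^-1 - `|4^-1 : R|)).
have gB n (t : R) : 0 < t -> `|g n t| <= Z * wt 4^-1 t.
  move=> t0; apply: (grid_sum_le (k := fun j => h (t + gpt (nu n) j)) q4 C0 M0 t0).
    exact: xM.
  move=> i _; rewrite ger0_norm; first exact: (h_le_Ka hC t0 (gpt_gt0 _ _)).
  by apply: (hk_ge0 hC); apply: addr_gt0 => //; exact: gpt_gt0.
have gL n (m t s : R) : 0 < m -> m <= t -> m <= s ->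
    `|g n t - g n s| <= (m^-1 * Z * wt 4^-1 m) * `|t - s|.
  move=> m0 mt ms.
  have -> : g n t - g n s = \sum_(j < gsz (nu n))
      (h (t + gpt (nu n) j) - h (s + gpt (nu n) j)) * x n j * glen (nu n) j.
    by rewrite /g -sumrB; apply: eq_bigr => j _; ring.
  have A0 : 0 <= C / m * `|t - s|.
    by apply: mulr_ge0 => //; apply: divr_ge0 => //; exact: ltW.
  have := grid_sum_le (k := fun j => h (t + gpt (nu n) j) - h (s + gpt (nu n) j))
    q4 A0 M0 m0 (xM n).
  move=> H; apply: le_trans (H _) _.
    by move=> i _; apply: (h_diff_le_Ka hC) => //; exact: gpt_gt0.
  by rewrite /Z; apply: le_of_eq; ring.
have eK n : `|e n| <= K by rewrite ger0_norm// (le_trans (ltW c0_gt0)).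
have [mu hmu [ce cg]] := lipschitz_extraction eK gB gL.
pose E := limn (fun n => e (mu n)).
have eE : e (mu n) @[n --> \oo] --> E by [].
have c0E : c0 <= E.
  by apply: limr_ge => //; apply: nearW => n; exact: e_ge.
have E0 : E != 0 by rewrite gt_eqF// (lt_le_trans c0_gt0).
exists mu, E, (fun s => E^-1 * limn (fun n => g (mu n) s)); split => // s s0.
have [n0 hn0] := gcell_eventually s0.
have gs : g (mu n) s @[n --> \oo] --> limn (fun n => g (mu n) s) by exact: cg.
have hnum n : (n <= nu (mu n))%N by exact: leq_trans (hnu _).
pose m := (expR 1)^-1 * s.
have m0 : 0 < m by rewrite mulr_gt0// invr_gt0 expR_gt0.
have ms : m <= s.
  have e1 : 1 <= expR 1 :> R by have := expR_ge1Dx (1 : R); lra.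
  by rewrite /m ler_pdivrMl ?expR_gt0//; apply: ler_peMl => //; exact: ltW.
pose LL := m^-1 * Z * wt 4^-1 m.
have LL0 : 0 <= LL.
  rewrite /LL mulr_ge0 ?expR_ge0// mulr_ge0 ?invr_ge0 ?(ltW m0)// /Z.
  rewrite mulr_ge0//; first by rewrite mulr_ge0 ?exprn_ge0 ?expR_ge0// mulr_ge0.
  by rewrite divr_ge0//; lra.
have v2 : LL * s * gstep (nu (mu n)) @[n --> \oo] --> (0 : R).
  rewrite -(mulr0 (LL * s)); apply: cvgM; first exact: cvg_cst.
  exact: gstep_cvg0.
have es : e (mu n) * samp (nu (mu n)) (x (mu n)) s @[n --> \oo] -->
    limn (fun n => g (mu n) s).
  apply: (cvg_dist_le (n0 := n0) gs v2) => n nn0.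
  have [i iN ci] := hn0 _ (leq_trans nn0 (hnum n)).
  rewrite (samp_cell _ iN ci) -eigen// -/(g (mu n) (gpt (nu (mu n)) i)).
  have mi : m <= gpt (nu (mu n)) i.
    by rewrite /m ler_pdivrMl ?expR_gt0//; exact: gcell_expR1.
  apply: le_trans (gL _ m _ _ m0 mi ms) _.
  by rewrite -[leRHS]mulrA; apply: ler_wpM2l => //; exact: gcell_dist.
have eV : (e (mu n))^-1 @[n --> \oo] --> E^-1 by apply: cvgV.
have -> : (fun n => samp (nu (mu n)) (x (mu n)) s) =
    (fun n => (e (mu n))^-1 * (e (mu n) * samp (nu (mu n)) (x (mu n)) s)).
  by apply/funext => n; rewrite mulKf// gt_eqF// (lt_le_trans c0_gt0).
exact: cvgM eV es.
Qed.

(** The discrete equations pass to the limit since discretisation is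
    consistent; the bounds with every exponent [eps] are inherited pointwise. *)
Lemma eigenvector_limit_solution (mu : nat -> nat) (E : R) (f : R -> R) :
  (forall n, (n <= mu n)%N) -> e (mu n) @[n --> \oo] --> E ->
  (forall s : R, 0 < s -> samp (nu (mu n)) (x (mu n)) s @[n --> \oo] --> f s) ->
  [/\ measurable_fun Rplus f,
      (forall eps : R, 0 < eps < 2^-1 -> exists2 M : R, 0 < M &
        forall t : R, 0 < t -> `|f t| <= M * wt eps t) &
      forall t : R, 0 < t -> Hop h f t = E * f t].
Proof.
move=> hmu eE xf; split.
- apply: (measurable_fun_cvg (h := fun n => samp (nu (mu n)) (x (mu n)))).
    by move=> n; exact: measurable_samp.
  by move=> s /RplusE; exact: xf.
- move=> eps eps2; have [M M0 xM] := xB eps2; exists (M * expR 1 + 1).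
    by rewrite ltr_wpDl// mulr_ge0// expR_ge0.
  move=> t t0; apply: (@cvg_le_lim _ (fun n => `|samp (nu (mu n)) (x (mu n)) t|) _ _ 0).
    by apply: cvg_norm; exact: xf.
  move=> n _; have al2 : `|eps| <= 2^-1 by rewrite ger0_norm; lra.
  apply: le_trans (samp_le al2 M0 (xM (mu n)) t0) _.
  by rewrite ler_wpM2r ?expR_ge0// lerDl.
- move=> t t0.
  have q4 : `|4^-1 : R| < 2^-1 by rewrite ger0_norm//; lra.
  have [|M M0 xM] := xB (eps := 4^-1); first by lra.
  have hnum n : (n <= nu (mu n))%N by exact: leq_trans (hnu _).
  have c1 := nys_cvg hC hnum q4 M0 (fun n => xM (mu n)) xf t0.
  have c2 : samp (nu (mu n)) (nys h (nu (mu n)) (x (mu n))) t @[n --> \oo] --> E * f t.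
    have -> : (fun n => samp (nu (mu n)) (nys h (nu (mu n)) (x (mu n))) t) =
        (fun n => e (mu n) * samp (nu (mu n)) (x (mu n)) t).
      apply/funext => n; have [[i iN ci]|z] := samp_locate (nu (mu n)) t.
        by rewrite !(samp_cell _ iN ci) eigen.
      by rewrite !z mulr0.
    exact: cvgM eE (xf t t0).
  exact: (cvg_unique _ c1 c2).
Qed.

End eigenvector_limit.

(** * Eigenvectors of the discretised operator *)

Section nystrom_eigenvectors.
Context {R : realType}.
Implicit Types (N n : nat) (s t y : R).

(** The weight [(1 + `|ln t|) ^- 2], integrable for the measure [dt / t] but
    decaying more slowly than any negative power of [max t (1 / t)]. *)
Definition lgw N (i : nat) : R := (1 + `|ln (gpt N i)|) ^- 2.

Lemma lgw_gt0 N (i : nat) : 0 < lgw N i.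
Proof. by rewrite invr_gt0 exprn_gt0// ltr_wpDr. Qed.

(** A discrete integration of [(1 + `|u|) ^- 2], with primitive [u / (1 +
    `|u|)]. *)
Lemma telescoping_weight (u s : R) : 0 < s -> s <= 1 ->
  s / (1 + `|u|) ^+ 2 <= 2 * ((u + s) / (1 + `|u + s|) - u / (1 + `|u|)).
Proof.
move=> s0 s1; have [u0|u0] := ger0P u.
  rewrite ger0_norm; last by apply: addr_ge0 => //; exact: ltW.
  have p1 : 0 < 1 + u by rewrite ltr_pwDl.
  have p2 : 0 < 1 + (u + s) by rewrite ltr_pwDl// addr_ge0// ltW.
  have -> : (u + s) / (1 + (u + s)) - u / (1 + u) = s / ((1 + u) * (1 + (u + s))).
    by field; rewrite !gt_eqF.
  rewrite mulrA ler_pdivrMr ?exprn_gt0// mulrAC ler_pdivlMr ?mulr_gt0//.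
  have us : 0 <= u * s by rewrite mulr_ge0// ltW.
  have : s * ((1 + u) * (1 + (u + s))) <= s * ((1 + u) * (2 * (1 + u))).
    by rewrite !ler_pM2l//; lra.
  lra.
have n0 : 0 < 1 + - u by lra.
have [w0|w0] := ger0P (u + s); last first.
  have p2 : 0 < 1 + - (u + s) by lra.
  have -> : (u + s) / (1 + - (u + s)) - u / (1 + - u) = s / ((1 + - u) * (1 + - (u + s))).
    by field; rewrite !gt_eqF.
  rewrite mulrA ler_pdivrMr ?exprn_gt0// mulrAC ler_pdivlMr ?mulr_gt0//.
  have : s * ((1 + - u) * (1 + - (u + s))) <= s * ((1 + - u) * (1 + - u)).
    by rewrite !ler_pM2l//; lra.
  have : 0 <= s * ((1 + - u) * (1 + - u)) by rewrite !mulr_ge0// ltW.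
  lra.
have p2 : 0 < 1 + (u + s) by lra.
have h1 : (u + s) / 2 <= (u + s) / (1 + (u + s)).
  by apply: ler_wpM2l => //; rewrite lef_pV2 ?posrE//; lra.
have h2 : - u / 2 <= - u / (1 + - u).
  by apply: ler_wpM2l; [lra|rewrite lef_pV2 ?posrE//; lra].
have h3 : s / (1 + - u) ^+ 2 <= s.
  rewrite ler_pdivrMr ?exprn_gt0//; apply: ler_peMr; first exact: ltW.
  by rewrite exprn_ege1//; lra.
rewrite mulNr in h2; lra.
Qed.

Lemma lgw_sum_le N : \sum_(i < gsz N) lgw N i * (glen N i / gpt N i) <= 4 * expR 1 :> R.
Proof.
pose Phi (u : R) := u / (1 + `|u|).
have Phi1 u : `|Phi u| <= 1.
  rewrite /Phi normrM normfV [`|1 + _|]ger0_norm; last by rewrite addr_ge0.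
  by rewrite ler_pdivrMr ?mul1r ?lerDr// ltr_pwDl.
apply: (@le_trans _ _ (\sum_(i < gsz N) (expR 1 : R) *
    (2 * (Phi (ln (gpt N i.+1)) - Phi (ln (gpt N i)))))).
  apply: ler_sum => i _.
  have hg : glen N i / gpt N i <= expR 1 * gstep N :> R.
    rewrite /glen gptS; have g0 := gt_eqF (gpt_gt0 N i).
    rewrite mulrBl mulfK ?g0// divff ?g0//.
    have h1 : 1 - gstep N <= expR (- gstep N) :> R by have := expR_ge1Dx (- gstep N : R); lra.
    have := ler_wpM2r (expR_ge0 (gstep N : R)) h1.
    rewrite -expRD addNr expR0 => h2.
    have h3 : expR (gstep N) <= expR 1 :> R by rewrite ler_expR gstep_le1.
    have := ler_wpM2r (ltW (@gstep_gt0 R N)) h3; lra.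
  apply: le_trans (ler_wpM2l (ltW (lgw_gt0 N i)) hg) _.
  rewrite mulrCA; apply: ler_wpM2l; first exact: expR_ge0.
  have := telescoping_weight (ln (gpt N i)) (gstep_gt0 N) (gstep_le1 N).
  rewrite mulrC /lgw /Phi.
  suff -> : ln (gpt N i.+1) = ln (gpt N i) + gstep N :> R by [].
  by rewrite !ln_gpt -natr1; ring.
rewrite -!mulr_sumr -(big_mkord xpredT (fun i : nat => Phi (ln (gpt N i.+1)) - Phi (ln (gpt N i)))).
rewrite telescope_sumr//.
have a := Phi1 (ln (gpt N (gsz N))); have b := Phi1 (ln (gpt N 0)).
rewrite mulrC; apply: ler_wpM2r; first exact: expR_ge0.
by move: a b; rewrite !ler_norml => /andP[_ a] /andP[b _]; lra.
Qed.

Variables (h : R -> R) (C : R) (hC : hankel_like h C).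

(** Conjugating by the square roots of the cell lengths turns the quadrature
    into a symmetric matrix, positive because the kernel is. Its diagonal
    entries are at most [C / 2 * (glen N i / gpt N i)], comparable to the
    logarithmic cell lengths, so its trace with weight [lgw] is bounded
    independently of the grid. *)
Theorem nystrom_eigenvector N (chi : nat -> R) (E0 del kap c0 K Q : R) :
  let u := nys h N chi in let v := nys h N u in
  \sum_(i < gsz N) ((v i - E0 * u i) ^+ 2 - del ^+ 2 * u i ^+ 2) * glen N i <= - kap ->
  0 < kap -> 0 < del -> 0 < c0 ->
  \sum_(i < gsz N) chi i ^+ 2 * glen N i <= K ->
  c0 ^+ 2 * del ^+ 2 * K <= kap / 2 ->
  (2 * C * expR 1) / c0 < Q * (kap / (2 * (`|E0| + del) ^+ 2 * del ^+ 2)) -> 0 <= Q ->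
  exists (E : R) (x : nat -> R), [/\ `|E - E0| <= del, c0 <= E,
    forall i : nat, (i < gsz N)%N -> nys h N x i = E * x i,
    \sum_(i < gsz N) chi i * x i * glen N i = 1 &
    \sum_(i < gsz N) lgw N i * x i ^+ 2 * glen N i <= Q].
Proof.
move=> u v hS kap0 del0 c00 hK hc hQ Q0.
pose l (i : 'I_(gsz N)) : R := Num.sqrt (glen N i).
have l0 (i : 'I_(gsz N)) : 0 < l i by rewrite sqrtr_gt0 glen_gt0.
have ll (i : 'I_(gsz N)) : l i * l i = glen N i by rewrite -expr2 sqr_sqrtr// ltW// glen_gt0.
pose A : 'M[R]_(gsz N) := \matrix_(i, j) (l i * l j * h (gpt N i + gpt N j)).
have sA : A^T = A.
  by apply/matrixP => i j; rewrite !mxE addrC [l j * _]mulrC.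
have pA (x : 'I_(gsz N) -> R) : 0 <= \sum_i \sum_j x i * x j * A i j.
  have := hk_psd hC (fun i => x i * l i) (t := fun i => gpt N i) (fun i => gpt_gt0 N i).
  rewrite (eq_bigr (fun i => \sum_j x i * x j * A i j))// => i _.
  by apply: eq_bigr => j _; rewrite mxE; ring.
have Anys (F : nat -> R) (i : 'I_(gsz N)) :
    \sum_j A i j * (l j * F j) = l i * nys h N F i.
  rewrite /nys mulr_sumr; apply: eq_bigr => j _; rewrite mxE -ll; ring.
have [|//|//|//||||||E [psi [h1 h2 h3 h4 h5]]] :=
  @eigenvector_selection R (gsz N) A (fun i => l i * chi i) (lgw N) E0 del kap c0
    (2 * C * expR 1) Q sA pA _.
- rewrite /=; apply: le_trans hS; rewrite mulr_sumr -sumrB.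
  apply: le_of_eq; apply: eq_bigr => i _.
  under eq_bigr do rewrite Anys.
  rewrite !Anys -/u -/v -ll; ring.
- apply: le_trans hc; apply: ler_wpM2l.
    by apply: mulr_ge0; exact: sqr_ge0.
  apply: le_trans hK; apply: le_of_eq.
  by apply: eq_bigr => i _; rewrite -ll; ring.
- by move=> i; apply: ltW; exact: lgw_gt0.
- have C0 := hk_C hC.
  apply: (@le_trans _ _ (\sum_(i < gsz N) C / 2 * (lgw N i * (glen N i / gpt N i)))).
    apply: ler_sum => i _; rewrite mxE ll.
    have tp : 0 < gpt N i :> R by exact: gpt_gt0.
    have := hk_le hC (addr_gt0 tp tp).
    have -> : C / (gpt N i + gpt N i) = C / 2 / gpt N i.
      by rewrite -mulr2n -(mulr_natl (gpt N i)) invfM mulrA.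
    move=> hle; rewrite [leRHS](_ : _ = lgw N i * (glen N i * (C / 2 / gpt N i))); last by ring.
    apply: ler_wpM2l; first exact: ltW (lgw_gt0 N i).
    by apply: ler_wpM2l => //; exact: ltW (glen_gt0 N i).
  have hS2 := lgw_sum_le N; rewrite -mulr_sumr.
  have C2 : 0 <= C / 2 by rewrite divr_ge0// ltW.
  have := ler_wpM2l C2 hS2; move: (\sum_(i < _) _) => S; lra.
- exact: hQ.
- exact: Q0.
pose x (k : nat) : R := if insub k is Some i then psi i / l i else 0.
have xE (i : 'I_(gsz N)) : x i = psi i / l i by rewrite /x valK.
have lx (i : 'I_(gsz N)) : l i * x i = psi i.
  by rewrite xE mulrCA divff ?mulr1// gt_eqF.
exists E, x; split => //.
- move=> i iN; have := Anys x (Ordinal iN).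
  under eq_bigr do rewrite lx.
  rewrite h3 -lx mulrCA => /(mulfI _) <- //.
  by rewrite gt_eqF.
- rewrite -h4; apply: eq_bigr => i _; rewrite -lx -ll; ring.
- apply: le_trans h5; apply: le_of_eq.
  by apply: eq_bigr => i _; rewrite -lx -ll; ring.
Qed.

End nystrom_eigenvectors.

(** * Pointwise bounds for discrete eigenvectors *)

Section generalized_eigenfunctions.
Context {R : realType}.
Implicit Types (N n : nat) (s t y : R).
Variables (h : R -> R) (C : R) (hC : hankel_like h C).

Lemma wt_mono (al be t : R) : al <= be -> wt al t <= wt be t.
Proof. by move=> ab; rewrite /wt ler_expR lerD2l ler_wpM2r. Qed.

(** A logarithm is dominated by any power. *)
Lemma inv_lgw_le N (i : nat) (eps : R) : 0 < eps ->
  (lgw N i)^-1 <= (1 + eps^-1) ^+ 2 * expR (2 * eps * `|ln (gpt N i)|) :> R.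
Proof.
move=> e0; rewrite /lgw invrK.
have -> : expR (2 * eps * `|ln (gpt N i)|) = expR (eps * `|ln (gpt N i)|) ^+ 2 :> R.
  by rewrite expr2 -expRD; congr expR; ring.
rewrite -exprMn lerXn2r ?nnegrE ?addr_ge0//.
  by rewrite mulr_ge0 ?expR_ge0// addr_ge0// invr_ge0 ltW.
set u := `|_|; have u0 : 0 <= u := normr_ge0 _.
have h1 := expR_ge1Dx (eps * u).
have eu : 0 <= eps * u by rewrite mulr_ge0// ltW.
have h2 : eps * u <= expR (eps * u) by lra.
have i0 : 0 <= eps^-1 by rewrite invr_ge0 ltW.
have := ler_wpM2l i0 h2; rewrite mulrA mulVf ?gt_eqF// mul1r; lra.
Qed.

(** Bootstrapping: the eigenvalue equation represents [x i] as a sum against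
    the kernel, and Cauchy-Schwarz with weight [lgw] converts the weighted
    mean-square bound into a pointwise one. The inverse weight costs an
    arbitrarily small power. *)
Lemma eigenvector_weight_bound (eps c0 Q : R) : 0 < eps -> 2 * eps < 2^-1 ->
  0 < c0 -> 0 <= Q ->
  exists2 M : R, 0 <= M & forall N (E : R) (x : nat -> R), c0 <= E ->
    (forall i : nat, (i < gsz N)%N -> nys h N x i = E * x i) ->
    \sum_(i < gsz N) lgw N i * x i ^+ 2 * glen N i <= Q ->
    forall i : nat, (i < gsz N)%N -> `|x i| <= M * wt eps (gpt N i).
Proof.
move=> e0 e2 c00 Q0; have C0 := hk_C hC; have C0' := ltW C0.
have al2 : `|2 * eps| < 2^-1 by rewrite ger0_norm; lra.
pose D := C * (C * (1 + eps^-1) ^+ 2) * expR 1 ^+ 2 * (2 / (2^-1 - `|2 * eps|)).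
have i0 : 0 <= eps^-1 by rewrite invr_ge0 ltW.
have D0 : 0 <= D.
  rewrite /D mulr_ge0//; last by rewrite divr_ge0// subr_ge0 ltW.
  by rewrite !mulr_ge0 ?exprn_ge0 ?expR_ge0 ?addr_ge0.
exists (c0^-1 * Num.sqrt (Q * D)).
  by rewrite mulr_ge0 ?sqrtr_ge0// invr_ge0 ltW.
move=> N E x c0E eig xQ i iN.
set t := gpt N i; have t0 : 0 < t := gpt_gt0 N i.
have hp j : 0 <= h (t + gpt N j).
  by apply: (hk_ge0 hC); apply: addr_gt0 => //; exact: gpt_gt0.
have lp j : 0 <= glen N j :> R by apply: ltW; exact: glen_gt0.
have op j : 0 < lgw N j :> R by exact: lgw_gt0.
pose S := \sum_(j < gsz N) h (t + gpt N j) ^+ 2 / lgw N j * glen N j.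
have SB : S <= D * (t^-1 * expR (2 * eps * `|ln t|)).
  pose k (j : nat) := C * Ka 2^-1 t (gpt N j).
  pose F (j : nat) := C * Ka 2^-1 t (gpt N j) *
      ((1 + eps^-1) ^+ 2 * expR (2 * eps * `|ln (gpt N j)|)).
  have kp j : 0 <= k j by rewrite mulr_ge0// expR_ge0.
  have Fp j : 0 <= F j.
    by rewrite mulr_ge0//; rewrite mulr_ge0 ?expR_ge0 ?exprn_ge0 ?addr_ge0.
  have A0 : 0 <= C * expR (- ln t / 2) * (1 + eps^-1) ^+ 2.
    by rewrite !mulr_ge0 ?expR_ge0 ?exprn_ge0 ?addr_ge0.
  have G := @grid_sum_le R N F k C (2 * eps) (C * expR (- ln t / 2) * (1 + eps^-1) ^+ 2) t
     al2 C0' A0 t0 _ _.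
  apply: (@le_trans _ _ (\sum_(j < gsz N) k j * F j * glen N j)).
    apply: ler_sum => j _; apply: ler_wpM2r => //.
    rewrite expr2 -mulrA; apply: ler_pM => //.
    - by apply: divr_ge0 => //; exact: ltW.
    - exact: (h_le_Ka hC t0 (gpt_gt0 _ _)).
    - apply: ler_pM => //; first by rewrite invr_ge0 ltW.
        exact: (h_le_Ka hC t0 (gpt_gt0 _ _)).
      exact: inv_lgw_le.
  apply: le_trans (ler_norm _) _; apply: le_trans (G _ _) _.
  - move=> j _; rewrite ger0_norm// /F /wt /Ka.
    rewrite (_ : C * expR (- ln t / 2) * (1 + eps^-1) ^+ 2 *
        expR (- ln (gpt N j) / 2 + 2 * eps * `|ln (gpt N j)|) =
      C * expR (- (ln t + ln (gpt N j)) / 2) * ((1 + eps^-1) ^+ 2 *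
        expR (2 * eps * `|ln (gpt N j)|))); last first.
      have -> : - (ln t + ln (gpt N j)) / 2 = - ln t / 2 + - ln (gpt N j) / 2 by field.
      by rewrite !expRD; ring.
    apply: ler_wpM2r; first by rewrite mulr_ge0 ?expR_ge0 ?exprn_ge0 ?addr_ge0.
    by apply: ler_wpM2l => //; rewrite ler_expR gerBl mulr_ge0.
  - by move=> j _; rewrite ger0_norm.
  - rewrite /D /wt expRD.
    have -> : t^-1 = expR (- ln t / 2) * expR (- ln t / 2).
      have -> : t^-1 = expR (- ln t) by rewrite expRN lnK.
      by rewrite -expRD; congr expR; field.
    apply: le_of_eq; ring.
have S0 : 0 <= S.
  apply: sumr_ge0 => j _; apply: mulr_ge0 => //; apply: divr_ge0; last exact: ltW.
  exact: sqr_ge0.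
have key : `|E * x i| ^+ 2 <= Q * S.
  apply: sqr_le_of_young => // c c_gt0.
  rewrite -eig// /nys -/t.
  apply: (@le_trans _ _ (2 * \sum_(j < gsz N) `|h (t + gpt N j) * x j * glen N j|)).
    by apply: ler_wpM2l => //; exact: ler_norm_sum.
  apply: (@le_trans _ _ (c * (\sum_(j < gsz N) lgw N j * x j ^+ 2 * glen N j) + S / c)).
    rewrite /S !mulr_sumr mulr_suml -big_split /=; apply: ler_sum => j _.
    rewrite !normrM [`|h _|]ger0_norm// [`|glen N j|]ger0_norm//.
    have o := op j; move: (lgw N j) o (h (t + gpt N j)) (glen N j) (lp j) => w w0 k l l0.
    rewrite -(real_normK (num_real (x j))); move: `|x j| => z.
    have cw : 0 <= (c * w)^-1 by rewrite invr_ge0; apply: ltW; exact: mulr_gt0.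
    have := mulr_ge0 l0 (mulr_ge0 (sqr_ge0 (c * w * z - k)) cw).
    have -> : l * ((c * w * z - k) ^+ 2 / (c * w)) =
       c * (w * z ^+ 2 * l) + k ^+ 2 / w * l / c - 2 * (k * z * l).
      by field; rewrite !gt_eqF.
    lra.
  by rewrite lerD2r ler_pM2l.
have E0 : 0 < E by exact: lt_le_trans c0E.
have xE : `|E * x i| <= Num.sqrt (Q * D) * wt eps t.
  rewrite -(@ler_pXn2r _ 2)// ?nnegrE ?mulr_ge0 ?sqrtr_ge0 ?expR_ge0//.
  apply: le_trans key _; apply: le_trans (ler_wpM2l Q0 SB) _.
  rewrite exprMn sqr_sqrtr; last exact: mulr_ge0.
  have -> : wt eps t ^+ 2 = t^-1 * expR (2 * eps * `|ln t|).
    have -> : t^-1 = expR (- ln t) by rewrite expRN lnK.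
    by rewrite /wt expr2 -!expRD; congr expR; field.
  by rewrite mulrA.
rewrite normrM (gtr0_norm E0) in xE.
rewrite -mulrA ler_pdivlMl//; apply: le_trans xE.
by apply: ler_wpM2r.
Qed.

End generalized_eigenfunctions.

(** * Generalized eigenvalues from approximate eigenvectors *)

Section weyl_to_generalized.
Context {R : realType}.
Implicit Types (N n : nat) (s t y : R).
Variables (h : R -> R) (C : R) (hC : hankel_like h C).

Lemma samp_continuous_cvg (nu : nat -> nat) (chi : R -> R) s :
  (forall n, (n <= nu n)%N) -> 0 < s -> {for s, continuous chi} ->
  samp (nu n) (fun i => chi (gpt (nu n) i)) s @[n --> \oo] --> chi s.
Proof.
move=> hnu s0 cs; have [n0 hn0] := gcell_eventually s0.
apply/cvgrPdist_lt => e e0.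
have /cvgrPdist_lt/(_ e e0)[d /= d0 hd] := cs.
have sg : s * gstep (nu n) @[n --> \oo] --> (0 : R).
  by rewrite -(mulr0 s); apply: cvgM; [exact: cvg_cst|exact: gstep_cvg0].
have /cvgr0Pnorm_lt/(_ d d0)[n1 _ hn1] := sg.
exists (maxn n0 n1) => // n /=; rewrite geq_max => /andP[a b].
have [i iN ci] := hn0 _ (leq_trans a (hnu n)).
rewrite (samp_cell _ iN ci); apply: hd => /=.
rewrite distrC; apply: le_lt_trans (gcell_dist ci) _.
by apply: le_lt_trans (hn1 n b); exact: ler_norm.
Qed.

Lemma sqr_samp_le (a b M : R) : 0 <= b -> `|a| <= M * b -> a ^+ 2 <= M ^+ 2 * b ^+ 2.
Proof.
move=> b0 aM; rewrite -exprMn -(real_normK (num_real a)) lerXn2r ?nnegrE//.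
exact: le_trans aM.
Qed.

(** A strict failure of the lower bound [nrm2 ((H - E0) H chi) >= del ^+ 2 *
    nrm2 (H chi)] survives discretisation with a margin [kap]. The
    finite-dimensional problem then has eigenvectors with eigenvalue within
    [del] of [E0], pairing to 1 with [chi] and obeying uniform bounds; a limit
    point of them is a generalized eigenfunction, non-zero because the pairing
    passes to the limit. *)
Theorem generalized_eigenfunction_near (chi : R -> R) (M E0 del : R) :
  (forall t : R, 0 < t -> {for t, continuous chi}) ->
  (forall t : R, 0 < t -> `|chi t| <= M * wt (- 4^-1) t) -> 0 < del ->
  nrm2 (fun t => Hop h (Hop h chi) t - E0 * Hop h chi t) <
    del ^+ 2 * nrm2 (Hop h chi) ->
  exists (E : R) (f : R -> R), [/\ `|E - E0| <= del, 0 < E /\ measurable_fun Rplus f,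
    (forall eps : R, 0 < eps < 2^-1 -> exists2 B : R, 0 < B &
        forall t : R, 0 < t -> `|f t| <= B * wt eps t),
    (exists2 t : R, 0 < t & f t != 0) &
    forall t : R, 0 < t -> Hop h f t = E * f t].
Proof.
move=> cchi chiM del0 hlt.
pose al : R := - 4^-1.
have nal : `|al| = 4^-1 by rewrite normrN ger0_norm.
have al2 : `|al| < 2^-1 by rewrite nal; lra.
have M0 : 0 <= M.
  have := chiM 1 ltr01; rewrite -(pmulr_lge0 _ (wt_gt0 al 1)); exact: le_trans.
have mchi : measurable_fun Rplus chi by exact: continuous_measurable_Rplus.
pose chiN N (i : nat) := chi (gpt N i).
have chiNM N (i : nat) : (i < gsz N)%N -> `|chiN N i| <= M * wt al (gpt N i).
  by move=> _; apply: chiM; exact: gpt_gt0.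
pose KK := C * expR 1 ^+ 3 * (2 / (2^-1 - `|al|)).
have C0 := ltW (hk_C hC).
have KK0 : 0 <= KK.
  rewrite /KK mulr_ge0//; first by rewrite mulr_ge0 ?exprn_ge0 ?expR_ge0.
  by rewrite divr_ge0// subr_ge0 ltW.
pose u N := nys h N (chiN N); pose M1 := KK * M.
have uM N (i : nat) : (i < gsz N)%N -> `|u N i| <= M1 * wt al (gpt N i).
  move=> iN; have := nys_le hC al2 M0 (chiNM N) iN.
  by rewrite (_ : C * M * expR 1 ^+ 3 * (2 / (2^-1 - `|al|)) = M1)// /M1 /KK; ring.
have M10 : 0 <= M1 by rewrite mulr_ge0.
pose v N := nys h N (u N); pose M2 := KK * M1.
have vM N (i : nat) : (i < gsz N)%N -> `|v N i| <= M2 * wt al (gpt N i).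
  move=> iN; have := nys_le hC al2 M10 (uM N) iN.
  by rewrite (_ : C * M1 * expR 1 ^+ 3 * (2 / (2^-1 - `|al|)) = M2)// /M2 /KK; ring.
have M20 : 0 <= M2 by rewrite mulr_ge0.
have c1 (y : R) : 0 < y -> samp n (chiN n) y @[n --> \oo] --> chi y.
  by move=> y0; apply: (@samp_continuous_cvg id) => //; exact: cchi.
have c2 (y : R) : 0 < y -> samp n (u n) y @[n --> \oo] --> Hop h chi y.
  by move=> y0; apply: (nys_cvg hC (nu := id) (fun n => leqnn n) al2 M0 chiNM).
have c3 (y : R) : 0 < y -> samp n (v n) y @[n --> \oo] --> Hop h (Hop h chi) y.
  by move=> y0; apply: (nys_cvg hC (nu := id) (fun n => leqnn n) al2 M10 uM).
pose e1 : R := expR 1; have e10 : 0 <= e1 := expR_ge0 _.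
have uS N (y : R) : 0 < y -> `|samp N (u N) y| <= M1 * e1 * wt al y.
  by move=> y0; apply: samp_le => //; [exact: ltW|exact: uM].
have vS N (y : R) : 0 < y -> `|samp N (v N) y| <= M2 * e1 * wt al y.
  by move=> y0; apply: samp_le => //; [exact: ltW|exact: vM].
have chiS N (y : R) : 0 < y -> `|samp N (chiN N) y| <= M * e1 * wt al y.
  by move=> y0; apply: samp_le => //; [exact: ltW|exact: chiNM].
have swt : sqi (wt al) by apply: sqi_wt; rewrite oppr_lt0.
have achi := adm_wt mchi al2 chiM.
have schi : sqi chi.
  by apply: sqi_le mchi (sqiZ M swt) chiM.
have sH := (Hop_sqi hC schi).1; have sHH := (Hop_sqi hC sH).1.
pose p N (i : nat) := (v N i - E0 * u N i) ^+ 2 - del ^+ 2 * u N i ^+ 2.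
pose P (y : R) := (Hop h (Hop h chi) y - E0 * Hop h chi y) ^+ 2 - del ^+ 2 * Hop h chi y ^+ 2.
have sampp N (y : R) : samp N (p N) y =
    (samp N (v N) y - E0 * samp N (u N) y) ^+ 2 - del ^+ 2 * samp N (u N) y ^+ 2.
  have [[i iN ci]|z] := samp_locate N y; first by rewrite !(samp_cell _ iN ci).
  by rewrite !z; ring.
have jP : itg P.
  by apply: itgB; [exact: (sqiB sHH (sqiZ E0 sH)).2|apply: itgZ; exact: sH.2].
have Plim : Int (samp n (p n)) @[n --> \oo] --> Int P.
  have [||||//] := @Int_dominated_cvg _ (fun n => samp n (p n)) P
    (fun y => ((M2 * e1 + `|E0| * (M1 * e1)) ^+ 2 + del ^+ 2 * (M1 * e1) ^+ 2) * wt al y ^+ 2).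
  - by move=> n; exact: measurable_samp.
  - move=> y y0; rewrite /P (_ : (fun n => samp n (p n) y) = (fun n =>
     (samp n (v n) y - E0 * samp n (u n) y) * (samp n (v n) y - E0 * samp n (u n) y)
     - del ^+ 2 * (samp n (u n) y * samp n (u n) y))); last first.
      by apply/funext => n; rewrite sampp; ring.
    have cE : E0 * samp n (u n) y @[n --> \oo] --> E0 * Hop h chi y.
      by apply: cvgM; [exact: cvg_cst|exact: c2].
    have cd : samp n (v n) y - E0 * samp n (u n) y @[n --> \oo] -->
        Hop h (Hop h chi) y - E0 * Hop h chi y.
      by apply: cvgB cE; exact: c3.
    have cd2 : (samp n (v n) y - E0 * samp n (u n) y) *
        (samp n (v n) y - E0 * samp n (u n) y) @[n --> \oo] -->
        (Hop h (Hop h chi) y - E0 * Hop h chi y) * (Hop h (Hop h chi) y - E0 * Hop h chi y).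
      exact: cvgM.
    have cu2 : samp n (u n) y * samp n (u n) y @[n --> \oo] --> Hop h chi y * Hop h chi y.
      by apply: cvgM; exact: c2.
    have cdu : del ^+ 2 * (samp n (u n) y * samp n (u n) y) @[n --> \oo] -->
        del ^+ 2 * (Hop h chi y * Hop h chi y).
      by apply: cvgM => //; exact: cvg_cst.
    exact: (cvgB cd2 cdu).
  - by apply: itgZ; exact: swt.2.
  - move=> n y y0; rewrite sampp; have w0 : 0 <= wt al y by exact: expR_ge0.
    have b1 : (samp n (v n) y - E0 * samp n (u n) y) ^+ 2 <=
        (M2 * e1 + `|E0| * (M1 * e1)) ^+ 2 * wt al y ^+ 2.
      apply: sqr_samp_le => //; apply: le_trans (ler_normB _ _) _.
      rewrite mulrDl normrM; apply: lerD; first exact: vS.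
      by rewrite -mulrA; apply: ler_wpM2l => //; exact: uS.
    have b2 : samp n (u n) y ^+ 2 <= (M1 * e1) ^+ 2 * wt al y ^+ 2.
      by apply: sqr_samp_le => //; exact: uS.
    have d2 := sqr_ge0 del.
    have b3 := ler_wpM2l d2 b2.
    have b4 := mulr_ge0 d2 (sqr_ge0 (samp n (u n) y)).
    have b5 := sqr_ge0 (samp n (v n) y - E0 * samp n (u n) y).
    rewrite mulrDl -[del ^+ 2 * _ * wt al y ^+ 2]mulrA ler_norml; apply/andP; split; lra.
(* Half of the gap is kept as a margin for all large grids. *)
pose kap : R := - Int P / 2.
have kap0 : 0 < kap.
  rewrite divr_gt0// oppr_gt0.
  have : Int P = nrm2 (fun t => Hop h (Hop h chi) t - E0 * Hop h chi t) -
     del ^+ 2 * nrm2 (Hop h chi).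
    rewrite /nrm2 /ip -IntZ; last exact: sqi_ip.
    rewrite -IntB; [|exact: sqi_ip (sqiB sHH (sqiZ E0 sH))|apply: itgZ; exact: sqi_ip].
    by apply: eq_Int => y _; rewrite /P !expr2.
  by move=> ->; rewrite subr_lt0.
have [n1 hn1] : exists n1, forall n, (n1 <= n)%N -> Int (samp n (p n)) <= - kap.
  have /cvgrPdist_lt/(_ kap kap0)[n1 _ hn1] := Plim.
  exists n1 => n nn; have := hn1 n nn; rewrite ltr_norml => /andP[a _].
  by move: a; rewrite /kap; lra.
pose K := (M * e1) ^+ 2 * nrm2 (wt al).
have K0 : 0 <= K by rewrite mulr_ge0 ?sqr_ge0 ?ip_ge0.
have hK N : \sum_(i < gsz N) chiN N i ^+ 2 * glen N i <= K.
  rewrite -(Int_samp N (fun i => chiN N i ^+ 2)).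
  rewrite /K /nrm2 /ip -IntZ; last exact: sqi_ip.
  apply: le_Int; [exact: itg_samp|by apply: itgZ; exact: sqi_ip|] => y y0.
  have -> : samp N (fun i => chiN N i ^+ 2) y = samp N (chiN N) y ^+ 2.
    have [[i iN ci]|z] := samp_locate N y; first by rewrite !(samp_cell _ iN ci).
    by rewrite !z expr0n.
  by rewrite -expr2; apply: sqr_samp_le; [exact: expR_ge0|exact: chiS].
(* Eigenvalues below [c0] can account for at most half of the margin; this
   keeps the limiting eigenvalue positive. *)
pose c0 : R := Num.sqrt (kap / (2 * del ^+ 2 * (K + 1))).
have K1 : 0 < K + 1 by rewrite ltr_wpDl.
have q0 : 0 < kap / (2 * del ^+ 2 * (K + 1)).
  by rewrite divr_gt0// mulr_gt0// mulr_gt0// exprn_gt0.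
have c00 : 0 < c0 by rewrite sqrtr_gt0.
have hc : c0 ^+ 2 * del ^+ 2 * K <= kap / 2.
  rewrite sqr_sqrtr; last exact: ltW.
  have -> : kap / (2 * del ^+ 2 * (K + 1)) * del ^+ 2 * K = kap / 2 * (K / (K + 1)).
    by field; rewrite !gt_eqF.
  have k2 : 0 <= kap / 2 by rewrite divr_ge0// ltW.
  rewrite -[leRHS]mulr1; apply: ler_wpM2l => //.
  by rewrite ler_pdivrMr// mul1r lerDl.
pose be : R := kap / (2 * (`|E0| + del) ^+ 2 * del ^+ 2).
have be0 : 0 < be.
  by rewrite divr_gt0// mulr_gt0 ?exprn_gt0// mulr_gt0// exprn_gt0// ltr_wpDl.
pose Q : R := 2 * C * expR 1 / c0 / be + 1.
have Qp : 0 <= 2 * C * expR 1 / c0.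
  by rewrite mulr_ge0 ?invr_ge0 ?(ltW c00)// mulr_ge0 ?expR_ge0// mulr_ge0.
have Q0 : 0 <= Q by rewrite addr_ge0// divr_ge0// ltW.
have hQ : 2 * C * expR 1 / c0 < Q * be.
  have -> : Q * be = 2 * C * expR 1 / c0 + be.
    by rewrite /Q; move: (expR 1) be0 c00 => ex b0 d0; field; rewrite !gt_eqF.
  by rewrite ltrDl.
pose nu n := (n + n1)%N.
have hnu n : (n <= nu n)%N by rewrite leq_addr.
have /choice[Ex hEx] : forall n, exists Ex : R * (nat -> R),
   [/\ `|Ex.1 - E0| <= del, c0 <= Ex.1,
    forall i : nat, (i < gsz (nu n))%N -> nys h (nu n) Ex.2 i = Ex.1 * Ex.2 i,
    \sum_(i < gsz (nu n)) chiN (nu n) i * Ex.2 i * glen (nu n) i = 1 &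
    \sum_(i < gsz (nu n)) lgw (nu n) i * Ex.2 i ^+ 2 * glen (nu n) i <= Q].
  move=> n; have hs : \sum_(i < gsz (nu n)) p (nu n) i * glen (nu n) i <= - kap.
    by rewrite -Int_samp; apply: hn1; exact: leq_addl.
  have [E [x Hx]] := @nystrom_eigenvector _ h C hC (nu n) (chiN (nu n))
      E0 del kap c0 K Q hs kap0 del0 c00 (hK _) hc hQ Q0.
  by exists (E, x).
pose e n := (Ex n).1; pose x n := (Ex n).2.
have e_ge n : c0 <= e n by have [] := hEx n.
have e_near n : `|e n - E0| <= del by have [] := hEx n.
have e_le n : e n <= `|E0| + del.
  have := e_near n; rewrite ler_distl => /andP[_]; have := ler_norm E0; lra.
have eig n (i : nat) : (i < gsz (nu n))%N -> nys h (nu n) (x n) i = e n * x n i.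
  by have [_ _ + _ _] := hEx n; apply.
have xB (eps : R) : 0 < eps < 2^-1 -> exists2 B : R, 0 <= B &
  forall n (i : nat), (i < gsz (nu n))%N -> `|x n i| <= B * wt eps (gpt (nu n) i).
  move=> /andP[ep0 ep2]; pose ep := Num.min eps 5^-1.
  have ep1 : 0 < ep by rewrite lt_min ep0/=.
  have ep3 : 2 * ep < 2^-1.
    have : ep <= 5^-1 by rewrite ge_min lexx orbT.
    lra.
  have [B B0 hB] := eigenvector_weight_bound hC ep1 ep3 c00 Q0.
  exists B => // n i iN; have [_ g1 g2 _ g3] := hEx n.
  apply: le_trans (hB _ _ _ g1 g2 g3 i iN) _; apply: ler_wpM2l => //.
  by apply: wt_mono; rewrite ge_min lexx.
have [mu [E [f [hmu eE cE xf]]]] := eigenvector_subsequence hC hnu c00 e_ge e_le eig xB.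
have [mf fB fE] := eigenvector_limit_solution hC hnu eig xB hmu eE xf.
exists E, f; split => //.
- have cn : `|e (mu n) - E0| @[n --> \oo] --> `|E - E0|.
    by apply: cvg_norm; apply: cvgB => //; exact: cvg_cst.
  by apply: (@cvg_le_lim _ _ _ _ 0 cn) => n _; exact: e_near.
- by split => //; exact: lt_le_trans c00 cE.
(* If the limit vanished, the pairings with [chi], all equal to 1, would tend
   to 0 by dominated convergence. *)
- apply: contrapT => nof.
  have f0 (t : R) : 0 < t -> f t = 0.
    by move=> t0; apply/eqP/negPn/negP => ft; apply: nof; exists t.
  have [|B B0 hB] := xB 8^-1; first by apply/andP; split; lra.
  have hnum n : (n <= nu (mu n))%N by exact: leq_trans (hnu _).
  pose g n i := chiN (nu (mu n)) i * x (mu n) i.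
  have gE n (y : R) : samp (nu (mu n)) (g n) y =
      samp (nu (mu n)) (chiN (nu (mu n))) y * samp (nu (mu n)) (x (mu n)) y.
    have [[i iN ci]|z] := samp_locate (nu (mu n)) y.
      by rewrite !(samp_cell _ iN ci).
    by rewrite !z mulr0.
  have e8 : 0 < 8^-1 :> R by rewrite invr_gt0.
  have [||||_ cI] := @Int_dominated_cvg _ (fun n => samp (nu (mu n)) (g n)) (fun=> 0)
     (fun y => M * e1 * (B * e1) * expR (- ln y - 8^-1 * `|ln y - 0|)).
  + by move=> n; exact: measurable_samp.
  + move=> y y0; rewrite (_ : (fun n => _) = (fun n =>
       samp (nu (mu n)) (chiN (nu (mu n))) y * samp (nu (mu n)) (x (mu n)) y)); last first.
      by apply/funext => n; exact: gE.
    rewrite -(mulr0 (chi y)) -(f0 y y0); apply: cvgM; last exact: xf.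
    by apply: (@samp_continuous_cvg (fun n => nu (mu n))) => //; exact: cchi.
  + by apply: itgZ; have [] := itg_explog 0 e8.
  + move=> n y y0; rewrite gE normrM subr0.
    have a8 : `|8^-1 : R| <= 2^-1 by rewrite ger0_norm//; lra.
    have b1 := chiS (nu (mu n)) y y0.
    have b2 := samp_le a8 B0 (hB (mu n)) y0.
    have := ler_pM (normr_ge0 _) (normr_ge0 _) b1 b2.
    move/le_trans; apply; rewrite mulrACA; apply: ler_wpM2l.
      by rewrite !mulr_ge0.
    by rewrite /wt -expRD ler_expR /al; lra.
  have one n : Int (samp (nu (mu n)) (g n)) = 1.
    by rewrite Int_samp; have [_ _ _ + _] := hEx (mu n).
  move: cI; rewrite (_ : (fun n => _) = (fun=> 1)); last by apply/funext => n; exact: one.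
  move=> cI; have : (1 : R) = 0.
    apply: (@cvg_unique _ _ ((fun=> 1 : R) @ \oo)); [exact: norm_hausdorff|exact: cvg_cst|].
    by move: cI; rewrite [Int _](_ : _ = 0)//; exact: Int0.
  by move/eqP; rewrite oner_eq0.
Qed.

End weyl_to_generalized.

(** * The kernel of a Carleson measure *)

Section carleson_kernel.
Context {R : realType}.
Variable mu : {measure set (measurableTypeR R) -> \bar R}.
Implicit Types (t s m l : R) (n : nat).

(** Dyadic layers: [expR (- x)] is at most [4 / (1 + x) ^+ 2], and [n] is the
    scale of [1 + x]. *)
Lemma expRN_le_quarter_pow (x : R) : 0 <= x -> exists n : nat,
  x < 2 ^+ n.+1 /\ expR (- x) <= 4 / 4 ^+ n.
Proof.
move=> x0; have x1 : 0 < 1 + x by rewrite ltr_wpDr.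
have [n hn] : exists n : nat, 1 + x < 2 ^+ n.+1.
  exists (Num.bound (1 + x)); apply: lt_trans (archi_boundP (ltW x1)) _.
  by rewrite -natrX ltr_nat; exact: ltn_trans (ltnSn _) (ltn_expl _ _).
pose k := ex_minn (ex_intro (fun n : nat => 1 + x < 2 ^+ n.+1) n hn).
have [hk hmin] : 1 + x < 2 ^+ k.+1 /\ (forall j : nat, 1 + x < 2 ^+ j.+1 -> (k <= j)%N).
  by rewrite /k; case: ex_minnP.
have kx : 2 ^+ k <= 1 + x.
  case: (k) hmin => [_|j hj]; first by rewrite expr0 lerDl.
  by rewrite leNgt; apply/negP => /hj; rewrite ltnn.
exists k; split; first by apply: lt_trans hk; rewrite ltrDr.
have e1 : (1 + x) ^+ 2 <= 4 * expR x.
  have := expR_ge1Dx (x / 2); have := expR_ge0 (x / 2).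
  have -> : expR x = expR (x / 2) ^+ 2 by rewrite expr2 -expRD; congr expR; field.
  by nra.
have e2 : (4 : R) ^+ k <= 4 * expR x.
  apply: le_trans e1; have -> : 4 ^+ k = (2 ^+ k) ^+ 2 :> R.
    by rewrite -!exprM mulnC exprM; congr (_ ^+ _); ring.
  by rewrite lerXn2r ?nnegrE ?exprn_ge0// ltW.
by rewrite expRN ler_pdivlMr ?exprn_gt0// mulrC ler_pdivrMr ?expR_gt0.
Qed.

Hypothesis hmu : carleson mu.

Lemma carleson_constant : exists2 C : R, 0 < C & forall a : R, 0 < a ->
  (mu [set` `[0%R, a[] <= (C * a)%:E)%E.
Proof.
have [_ [C hC]] := hmu; exists (`|C| + 1); first by rewrite ltr_wpDl.
move=> a a0; apply: le_trans (hC a a0) _; rewrite lee_fin ler_wpM2r ?(ltW a0)//.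
by apply: le_trans (ler_norm C) _; rewrite lerDl.
Qed.

Let mRp : measurable (Rplus : set (measurableTypeR R)).
Proof. exact: measurable_itv. Qed.
Hint Resolve mRp : core.

Lemma measurable_laplace t : measurable_fun Rplus (fun l : measurableTypeR R => (expR (- (t * l)))%:E).
Proof.
apply/measurable_EFinP; apply: measurableT_comp => //.
by apply: measurableT_comp => //; exact: measurable_funM.
Qed.

(** Summing the dyadic layers of the exponential, the layer of scale [2 ^+
    n.+1 / t] has measure at most [C * 2 ^+ n.+1 / t] and weight [4 / 4 ^+ n]. *)
Lemma laplace_integral_le (C t : R) : 0 < C -> 0 < t ->
  (forall a : R, 0 < a -> (mu [set` `[0%R, a[] <= (C * a)%:E)%E) ->
  (\int[mu]_(l in Rplus) (expR (- (t * l)))%:E <= (16 * C / t)%:E)%E.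
Proof.
move=> C0 t0 hC.
pose F n (l : R) : \bar R := ((4 / 4 ^+ n) * \1_[set` `[0%R, 2 ^+ n.+1 / t[] l)%:E.
have mI n : measurable ([set` `[0%R, 2 ^+ n.+1 / t[] : set (measurableTypeR R)).
  exact: measurable_itv.
have c0 n : 0 <= 4 / 4 ^+ n :> R by rewrite divr_ge0// exprn_ge0.
have F0 n l : (0 <= F n l)%E by rewrite lee_fin mulr_ge0.
have mF n : measurable_fun Rplus (F n : measurableTypeR R -> \bar R).
  by apply/measurable_EFinP; apply: measurable_funM => //; exact: measurable_indic.
apply: (@le_trans _ _ (\int[mu]_(l in Rplus) (\sum_(n <oo) F n l))%E).
  apply: ge0_le_integral => //.
  - exact: measurable_laplace.
  - exact: (@ge0_emeasurable_sum _ _ _ _ F predT (fun n l _ _ => F0 n l) (fun n _ => mF n)).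
  - move=> l l1; have l0 := (@RplusE R l).1 l1; have [|n [n1 n2]] := @expRN_le_quarter_pow (t * l).
      by rewrite mulr_ge0// ltW.
    apply: le_trans (nneseries_lim_ge (n.+1) _); last by move=> *; exact: F0.
    rewrite big_mkord big_ord_recr/=; apply: le_trans (leeDr _ _); last exact: sume_ge0.
    rewrite /F indicE mem_set ?mulr1 ?lee_fin//=.
    by rewrite in_itv/= ltW//= ltr_pdivlMr// mulrC.
rewrite integral_nneseries//.
apply: (@le_trans _ _ (\sum_(n <oo) (16 * C / t / (2 ^ n.+1)%:R)%:E)%E); last first.
  by apply: epsilon_trick0; rewrite divr_ge0 ?mulr_ge0// ltW.
apply: lee_nneseries => n; first by move=> _ _; apply: integral_ge0 => l _; exact: F0.
move=> _; rewrite /F; under eq_integral do rewrite EFinM.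
rewrite ge0_integralZl_EFin//; last first.
  by apply/measurable_EFinP; exact: measurable_indic.
rewrite integral_indic//.
apply: (@le_trans _ _ ((4 / 4 ^+ n)%:E * (C * (2 ^+ n.+1 / t))%:E)%E).
  apply: lee_wpmul2l; first by rewrite lee_fin.
  apply: le_trans (hC _ _); last by rewrite divr_gt0// exprn_gt0.
  by apply: le_measure; rewrite ?inE//; exact: measurableI.
rewrite -EFinM lee_fin natrX; apply: le_of_eq.
have -> : 4 ^+ n = 2 ^+ n * 2 ^+ n :> R by rewrite -exprMn; congr (_ ^+ _); ring.
have := exprn_gt0 n (ltr0Sn R 1); rewrite exprS => p; field.
by rewrite !gt_eqF.
Qed.

Lemma laplace_integrable t : 0 < t -> mu.-integrable Rplus (fun l => (expR (- (t * l)))%:E).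
Proof.
move=> t0; have [C C0 hC] := carleson_constant.
apply/integrableP; split; first exact: measurable_laplace.
apply: le_lt_trans (ltry (16 * C / t)); apply: le_trans (laplace_integral_le C0 t0 hC).
apply: le_of_eq; apply: eq_integral => x _ /=.
by rewrite ger0_norm// expR_ge0.
Qed.

(** The factor [l] produced by differentiating in [t] is absorbed by half of
    the exponential decay. *)
Lemma laplace_lip m t l : 0 < m -> 0 <= l -> m <= t -> forall s, m <= s ->
  `|expR (- (t * l)) - expR (- (s * l))| <= `|t - s| * (2 / m) * expR (- (m / 2 * l)).
Proof.
move=> m0 l0 mt s ms; wlog ts : t s mt ms / t <= s.
  move=> H; have [|/ltW] := leP t s; first exact: H.
  by move=> st; rewrite distrC (distrC t s); exact: H.
have st0 : 0 <= s - t by rewrite subr_ge0.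
have sl0 : 0 <= (s - t) * l by rewrite mulr_ge0.
have e1 : expR (- (s * l)) = expR (- (t * l)) * expR (- ((s - t) * l)).
  by rewrite -expRD; congr expR; ring.
have e2 := expR_ge1Dx (- ((s - t) * l)).
have e3 : expR (- (t * l)) <= expR (- (m * l)).
  by rewrite ler_expR lerN2 ler_wpM2r.
have e4 := expR_ge1Dx (m / 2 * l).
have e5 : expR (- (m * l)) * expR (m / 2 * l) = expR (- (m / 2 * l)).
  by rewrite -expRD; congr expR; field.
have e6 : expR (- ((s - t) * l)) <= 1 by rewrite -expR0 ler_expR oppr_le0.
have p1 := expR_ge0 (- (t * l)); have p2 := expR_ge0 (- (m * l)).
rewrite e1 -{1}[expR (- (t * l))]mulr1 -mulrBr ger0_norm ?mulr_ge0 ?subr_ge0//.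
rewrite distrC (ger0_norm st0) -e5.
have q1 : expR (- (t * l)) * (1 - expR (- ((s - t) * l))) <=
    expR (- (m * l)) * ((s - t) * l).
  by apply: ler_pM; rewrite ?subr_ge0//; lra.
apply: le_trans q1 _; rewrite [leRHS]mulrCA; apply: ler_wpM2l => //.
rewrite -[leRHS]mulrA; apply: ler_wpM2l => //.
by rewrite mulrAC ler_pdivlMr//; move: e4; lra.
Qed.

(** Positivity holds because the quadratic form is the integral of [(\sum_i x
    i * expR (- (t i * l))) ^+ 2]. *)
Theorem hankel_like_kernel : exists C : R, hankel_like (hankel_kernel mu) C.
Proof.
have [C C0 hC] := carleson_constant.
have h_le t : 0 < t -> hankel_kernel mu t <= 16 * C / t.
  move=> t0; rewrite -lee_fin /hankel_kernel /Rintegral fineK; last first.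
    exact: integrable_fin_num (laplace_integrable t0).
  exact: laplace_integral_le.
exists (64 * C); split; first by rewrite mulr_gt0.
- by move=> t t0; apply: Rintegral_ge0 => l _; exact: expR_ge0.
- move=> t t0; apply: le_trans (h_le t t0) _; rewrite ler_pM2r ?invr_gt0// ler_pM2r//.
  by rewrite ler_nat.
- move=> m t s m0 mt ms.
  have jt := laplace_integrable (lt_le_trans m0 mt).
  have js := laplace_integrable (lt_le_trans m0 ms).
  have m20 : 0 < m / 2 by rewrite divr_gt0.
  have jm := laplace_integrable m20.
  have jd : mu.-integrable Rplus (EFin \o
      (fun l : measurableTypeR R => expR (- (t * l)) - expR (- (s * l)))).
    exact: (integrableB mRp jt js).
  rewrite /hankel_kernel -RintegralB//.
  apply: le_trans (le_normr_Rintegral mRp jd) _.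
  have jg : mu.-integrable Rplus (EFin \o (fun l : measurableTypeR R => `|t - s| * (2 / m) * expR (- (m / 2 * l)))).
    exact: (integrableZl mRp (`|t - s| * (2 / m)) jm).
  apply: (@le_trans _ _ (\int[mu]_(l in Rplus) (`|t - s| * (2 / m) * expR (- (m / 2 * l))))).
    apply: le_Rintegral => //.
      exact: integrable_norm jd.
    move=> l l1; have l0 := (@RplusE R l).1 l1.
      by apply: laplace_lip => //; exact: ltW.
  rewrite RintegralZl//; apply: le_trans (ler_wpM2l _ (h_le _ m20)) _.
    by rewrite mulr_ge0// divr_ge0// ltW.
  apply: le_of_eq; field.
  by rewrite gt_eqF.
- move=> n x t t0.
  have J (i j : 'I_n) : mu.-integrable Rplus (EFin \o
      (fun l : measurableTypeR R => x i * x j * expR (- ((t i + t j) * l)))).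
    exact: (integrableZl mRp (x i * x j) (laplace_integrable (addr_gt0 (t0 i) (t0 j)))).
  have RS (I : Type) (r : seq I) (F : I -> measurableTypeR R -> R) :
      (forall i, mu.-integrable Rplus (EFin \o F i)) ->
      mu.-integrable Rplus (EFin \o (fun l => \sum_(i <- r) F i l)) /\
      \int[mu]_(l in Rplus) (\sum_(i <- r) F i l) = \sum_(i <- r) \int[mu]_(l in Rplus) F i l.
    move=> jF; elim: r => [|i r [IH1 IH2]].
      split; last by rewrite big_nil; under eq_Rintegral do rewrite big_nil; rewrite /Rintegral integral0.
      by apply: eq_integrable (integrable0 _ _) => // l _ /=; rewrite big_nil.
    split; last first.
      by rewrite big_cons -IH2 -RintegralD//; apply: eq_Rintegral => l _; rewrite big_cons.
    by apply: eq_integrable (integrableD _ (jF i) IH1) => // l _ /=; rewrite big_cons.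
  rewrite (_ : \sum_i _ = \int[mu]_(l in Rplus) (\sum_i \sum_j x i * x j * expR (- ((t i + t j) * l)))).
    apply: Rintegral_ge0 => l _.
    rewrite (_ : \sum_i _ = (\sum_i x i * expR (- (t i * l))) ^+ 2) ?sqr_ge0//.
    rewrite expr2 mulr_suml; apply: eq_bigr => i _; rewrite mulr_sumr.
    apply: eq_bigr => j _; rewrite mulrDl opprD expRD; ring.
  pose G (i : 'I_n) (l : measurableTypeR R) := \sum_j x i * x j * expR (- ((t i + t j) * l)).
  have RG i := RS _ (index_enum 'I_n) _ (J i).
  have -> : \int[mu]_(l in Rplus) (\sum_i G i l) = \sum_i \int[mu]_(l in Rplus) G i l.
    by apply: (RS _ _ _ _).2 => i; exact: (RG i).1.
  apply: eq_bigr => i _; rewrite [RHS](RG i).2; apply: eq_bigr => j _.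
  by rewrite RintegralZl//; apply: laplace_integrable; exact: addr_gt0.
Qed.

End carleson_kernel.

(** * Solving the shifted equation on the complement of the null space *)

Section resolvent.
Context {R : realType}.
Implicit Types (f g k r s chi : R -> R) (t a b c M : R).
Notation leb := (@lebesgue_measure R).

Lemma ip_aez f g : measurable_fun Rplus f -> measurable_fun Rplus g -> aez g -> ip f g = 0.
Proof.
move=> mf mg g0; rewrite -[RHS]Int0; apply: ae_Int => //.
  exact: measurable_funM.
by apply: filterS g0 => t ht t0; rewrite (ht t0) mulr0.
Qed.

Lemma eq_ip f g f' g' : (forall t : R, 0 < t -> f t = f' t) ->
  (forall t : R, 0 < t -> g t = g' t) -> ip f g = ip f' g'.
Proof. by move=> e1 e2; apply: eq_Int => t t0; rewrite e1 ?e2. Qed.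

Lemma ae_ip_r f g g' : sqi f -> sqi g -> sqi g' -> aez (fun t => g t - g' t) ->
  ip f g = ip f g'.
Proof.
move=> sf sg sg' e; apply/eqP; rewrite -subr_eq0 -ipBr//.
by rewrite ip_aez//; [case: sf|case: (sqiB sg sg')].
Qed.

Variables (h : R -> R) (C : R) (hC : hankel_like h C).

(** The orthogonal complement of the null space in the real space; it contains
    the range of the operator, and the operator acts injectively on it. *)
Definition orth_ker f : Prop :=
  sqi f /\ forall k, sqi k -> aez (Hop h k) -> ip f k = 0.

(** A class of functions for which discretisation converges pointwise, dense
    enough to detect zero by [orth_test_eq0]. *)
Definition test_fun chi : Prop := (forall t : R, 0 < t -> {for t, continuous chi}) /\
  exists M : R, forall t : R, 0 < t -> `|chi t| <= M * wt (- 4^-1) t.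

Definition Hsub a f t : R := Hop h f t - a * f t.

(** The real form of [`|H - z| ^+ 2] for [z = a +i* b]: the real and imaginary
    parts of a function enter it separately. *)
Definition qform a b f g : R := ip (Hsub a f) (Hsub a g) + b ^+ 2 * ip f g.

Lemma orth_kerDZ f g a : orth_ker f -> orth_ker g -> orth_ker (fun t => f t + a * g t).
Proof.
move=> [sf of_] [sg og]; split; first exact: sqiD sf (sqiZ a sg).
move=> k sk k0; rewrite ipDl//; last exact: sqiZ.
by rewrite ipZl// of_// og// mulr0 addr0.
Qed.

Lemma orth_ker_Hop f : sqi f -> orth_ker (Hop h f).
Proof.
move=> sf; split; first exact: (Hop_sqi hC sf).1.
move=> k sk k0; rewrite (Hop_sym hC)//.
by apply: ip_aez => //; [exact: sf.1|exact: (Hop_sqi hC sk).1.1].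
Qed.

Lemma sqi_Hsub a f : sqi f -> sqi (Hsub a f).
Proof. by move=> sf; exact: sqiB (Hop_sqi hC sf).1 (sqiZ a sf). Qed.

Lemma orth_ker_Hsub a f : orth_ker f -> orth_ker (Hsub a f).
Proof.
move=> vf; have := orth_kerDZ (- a) (orth_ker_Hop vf.1) vf.
by congr orth_ker; apply/funext => t; rewrite /Hsub mulNr.
Qed.

Lemma HsubDZ a c f g t : sqi f -> sqi g -> 0 < t ->
  Hsub a (fun x => f x + c * g x) t = Hsub a f t + c * Hsub a g t.
Proof.
by move=> sf sg t0; rewrite /Hsub (HopDZ hC)//; [ring|exact: sqi_adm|exact: sqi_adm].
Qed.

Lemma Hsub_sym a f g : sqi f -> sqi g -> ip (Hsub a f) g = ip f (Hsub a g).
Proof.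
move=> sf sg; have sHf := (Hop_sqi hC sf).1; have sHg := (Hop_sqi hC sg).1.
have saf := sqiZ a sf; have sag := sqiZ a sg.
by rewrite ipBl// ipBr// (Hop_sym hC)// ipZl// ipZr.
Qed.

Lemma nrm2_addZ_le f g c : sqi f -> sqi g ->
  nrm2 (fun t => f t + c * g t) <= 2 * (nrm2 f + c ^+ 2 * nrm2 g).
Proof.
move=> sf sg; have := ip_ge0 (fun t => f t + (- c) * g t).
by rewrite /nrm2 !ip_addsq// sqrrN; lra.
Qed.

Lemma nrm2_Hsub a f : sqi f -> nrm2 (Hsub a f) <= 2 * ((4 * C) ^+ 2 + a ^+ 2) * nrm2 f.
Proof.
move=> sf; have [sH nH] := Hop_sqi hC sf.
have := nrm2_addZ_le (- a) sH sf.
rewrite (_ : (fun t => _) = Hsub a f); last by apply/funext => t; rewrite mulNr.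
by rewrite sqrrN; move: nH; lra.
Qed.

Lemma bounded_qform a b : exists M, bounded_form (qform a b) M.
Proof.
pose K := 2 * ((4 * C) ^+ 2 + a ^+ 2).
have K0 : 0 <= K by rewrite mulr_ge0// addr_ge0// sqr_ge0.
exists (2 * (K ^+ 2 + b ^+ 4)); split=> [f g k c sf sg sk|f g _ _|f g sf sg].
- have E : ip (Hsub a (fun x => f x + c * g x)) (Hsub a k) =
      ip (fun t => Hsub a f t + c * Hsub a g t) (Hsub a k).
    by apply: eq_ip => // t t0; exact: HsubDZ.
  rewrite /qform E.
  have [s1 s2 s3] : [/\ sqi (Hsub a f), sqi (Hsub a g) & sqi (Hsub a k)].
    by split; exact: sqi_Hsub.
  have scg := sqiZ c sg; have scs := sqiZ c s2.
  by rewrite (ipDl s1 scs s3) (ipZl c s2 s3) (ipDl sf scg sk) (ipZl c sg sk); ring.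
- by rewrite /qform ipC (ipC f).
- have [s1 s2] : sqi (Hsub a f) /\ sqi (Hsub a g) by split; exact: sqi_Hsub.
  have c1 := ip_cs s1 s2; have c2 := ip_cs sf sg.
  have c3 : ip (Hsub a f) (Hsub a g) ^+ 2 <= K ^+ 2 * (nrm2 f * nrm2 g).
    apply: le_trans c1 _; rewrite (_ : K ^+ 2 * _ = K * nrm2 f * (K * nrm2 g)); last by ring.
    by apply: ler_pM; rewrite ?ip_ge0//; exact: nrm2_Hsub.
  have c4 : (b ^+ 2 * ip f g) ^+ 2 <= b ^+ 4 * (nrm2 f * nrm2 g).
    rewrite exprMn -exprM; apply: ler_wpM2l => //; exact: (exprn_even_ge0 b (n := 4)).
  have c5 := sqr_ge0 (ip (Hsub a f) (Hsub a g) - b ^+ 2 * ip f g).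
  have E : (ip (Hsub a f) (Hsub a g) + b ^+ 2 * ip f g) ^+ 2 =
    2 * (ip (Hsub a f) (Hsub a g) ^+ 2 + (b ^+ 2 * ip f g) ^+ 2) -
    (ip (Hsub a f) (Hsub a g) - b ^+ 2 * ip f g) ^+ 2 by ring.
  by rewrite /qform E; lra.
Qed.

Lemma sqi_test chi : test_fun chi -> sqi chi.
Proof.
move=> [cchi [M chiM]]; have swt : sqi (@wt R (- 4^-1)) by apply: sqi_wt; rewrite oppr_lt0.
apply: sqi_le (continuous_measurable_Rplus cchi) (sqiZ M swt) chiM.
Qed.

(** A continuous function is tested against itself, damped by a positive
    weight so as to become a test function. *)
Lemma orth_test_eq0 f : (forall t : R, 0 < t -> {for t, continuous f}) -> sqi f ->
  (forall chi, test_fun chi -> ip f chi = 0) -> aez f.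
Proof.
move=> cf sf f0.
pose e t : R := expR (- ln t / 4 - `|ln t| / 8).
pose w t : R := e t / (1 + f t * f t).
have p0 t : 0 < 1 + f t * f t by rewrite ltr_wpDr// -expr2 sqr_ge0.
have e0 t : 0 < e t by exact: expR_gt0.
have w0 t : 0 < w t by rewrite divr_gt0.
have ce t : 0 < t -> {for t, continuous e}.
  move=> t0; apply: (@continuous_comp _ _ _ (fun x => - ln x / 4 - `|ln x| / 8) expR); last exact: continuous_expR.
  have cl : {for t, continuous (@ln R)} by exact: continuous_ln.
  have cl4 : - ln x / 4 @[x --> t] --> - ln t / 4.
    by apply: cvgM; [exact: cvgN|exact: cvg_cst].
  apply: cvgB => //; apply: cvgM; last exact: cvg_cst.
  exact: cvg_norm.
have cw t : 0 < t -> {for t, continuous w}.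
  move=> t0; apply: cvgM; first exact: ce.
  apply: cvgV; first by rewrite gt_eqF.
  apply: cvgD; first exact: cvg_cst.
  by apply: cvgM; exact: cf.
(* The denominator of [w] bounds [chi] by [e ^+ 2 = wt (- 4^-1)] whatever the
   growth of [f]. *)
pose chi t := f t * (w t * w t).
have tchi : test_fun chi.
  split=> [t t0|].
    apply: cvgM; first exact: cf.
    by apply: cvgM; exact: cw.
  exists 1 => t t0; rewrite mul1r /chi.
  have -> : wt (- 4^-1) t = e t * e t by rewrite /e -expRD; congr expR; field.
  rewrite normrM [X in _ * X]ger0_norm; last by apply: mulr_ge0; exact: ltW.
  rewrite /w.
  have fle : `|f t| <= (1 + f t * f t).
    have := sqr_ge0 (`|f t| - 1); rewrite -[f t * f t]ger0_norm ?normrM; last by rewrite -expr2 sqr_ge0.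
    by nra.
  have ge1 : 1 <= 1 + f t * f t by rewrite lerDl -expr2 sqr_ge0.
  rewrite [leLHS](_ : _ = (e t * e t) * (`|f t| / (1 + f t * f t) / (1 + f t * f t))); last first.
    by field; rewrite gt_eqF.
  rewrite -[leRHS]mulr1; apply: ler_wpM2l; first by rewrite mulr_ge0// ltW.
  rewrite ler_pdivrMr// mul1r; apply: le_trans ge1.
  by rewrite ler_pdivrMr// mul1r.
have mw := continuous_measurable_Rplus cw.
have sF : sqi (fun t => f t * w t).
  split; first by apply: measurable_funM => //; case: sf.
  apply: eq_itg (sqiM sf (sqi_test tchi)) => t t0; rewrite /chi; ring.
have F0 : aez (fun t => f t * w t).
  apply: ip0_aez sF _; rewrite -(f0 _ tchi); apply: eq_Int => t t0; rewrite /chi; ring.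
apply: filterS F0 => t ht t0; move: (ht t0) => /eqP.
by rewrite mulf_eq0 (gt_eqF (w0 t)) orbF => /eqP.
Qed.

(** Orthogonality to the images of test functions means that the image of [f]
    is orthogonal to all test functions, so [f] lies both in the null space
    and in its complement. *)
Lemma orth_ker_eq0 f : orth_ker f -> (forall chi, test_fun chi -> ip f (Hop h chi) = 0) ->
  aez f.
Proof.
move=> [sf of_] f0; have [sH _] := Hop_sqi hC sf.
have H0 : aez (Hop h f).
  apply: orth_test_eq0 => // [t t0|chi tchi].
    by apply: (Hop_continuous hC) => //; exact: sqi_adm.
  by rewrite (Hop_sym hC)//; [exact: f0|exact: sqi_test].
exact: ip0_aez (of_ f sf H0).
Qed.

Lemma orth_ker_cvg (u : nat -> R -> R) r : (forall n, orth_ker (u n)) -> sqi r ->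
  L2cvg u r -> orth_ker r.
Proof.
move=> vu sr ur; split=> // k sk k0.
have := form_cvgl ip_bounded_form (fun n => (vu n).1) sr sk ur.
rewrite (_ : (fun n => _) = (fun=> 0)); last by apply/funext => n; exact: (vu n).2.
by move=> c0; apply: (cvg_unique _ c0); [exact: norm_hausdorff|exact: cvg_cst].
Qed.

(** A lower bound for [H - z] on the images of test functions only: these are
    the functions that the discretisation argument controls. *)
Definition coercive_at a b c : Prop := forall chi, test_fun chi ->
  c * nrm2 (Hop h chi) <= qform a b (Hop h chi) (Hop h chi).

Lemma test_funDZ chi1 chi2 c : test_fun chi1 -> test_fun chi2 ->
  test_fun (fun t => chi1 t + c * chi2 t).
Proof.
move=> [c1 [M1 b1]] [c2 [M2 b2]]; split.
  move=> t t0; apply: cvgD; first exact: c1.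
  by apply: cvgM; [exact: cvg_cst|exact: c2].
exists (M1 + `|c| * M2) => t t0; apply: le_trans (ler_normD _ _) _.
rewrite mulrDl normrM; apply: lerD; first exact: b1.
by rewrite -mulrA; apply: ler_wpM2l => //; exact: b2.
Qed.

Lemma qform_sqi a b f k : sqi f -> sqi k ->
  qform a b f k = ip (fun t => Hsub a (Hsub a f) t + b ^+ 2 * f t) k.
Proof.
move=> sf sk; have s1 := sqi_Hsub a sf; have s2 := sqi_Hsub a s1.
by rewrite /qform -(Hsub_sym a s1 sk) ipDl// ?ipZl//; exact: sqiZ.
Qed.

(** Solve variationally over the images of test functions. The residual is
    orthogonal to these images and belongs to the complement of the null
    space, hence is zero. *)
Theorem coercive_square_solvable a b c g : 0 < c -> coercive_at a b c -> orth_ker g ->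
  exists r, [/\ orth_ker r,
    aez (fun t => Hsub a (Hsub a r) t + b ^+ 2 * r t - g t) & c ^+ 2 * nrm2 r <= nrm2 g].
Proof.
move=> c0 hc vg; have sg := vg.1.
pose S : set (R -> R) := [set f | sqi f /\
  exists2 chi, test_fun chi & forall t : R, 0 < t -> f t = Hop h chi t].
have [M QM] := bounded_qform a b.
have SV f : S f -> orth_ker f.
  move=> [sf [chi tchi fE]]; split=> // k sk k0.
  have [_ /(_ k sk k0) <-] := orth_ker_Hop (sqi_test tchi).
  exact: eq_ip.
have [||||r [sr [u uS ur] rE rle]] := @coercive_form_solution _ (qform a b) M c S g QM c0 sg.
- by move=> f [].
- split; first exact: sqi0.
  exists (fun=> 0); last by move=> t _; rewrite /Hop -[LHS]Int0; apply: eq_Int => s _; rewrite mulr0.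
  by split=> [t _|]; [exact: cvg_cst|exists 0 => t _; rewrite normr0 mul0r].
- move=> f k e [sf [chi1 t1 e1]] [sk [chi2 t2 e2]]; split; first exact: sqiD sf (sqiZ e sk).
  exists (fun t => chi1 t + e * chi2 t); first exact: test_funDZ.
  move=> t t0; rewrite (HopDZ hC)// ?e1 ?e2//; apply: sqi_adm; exact: sqi_test.
- move=> f [sf [chi tchi fE]]; have := hc chi tchi.
  have sH := (Hop_sqi hC (sqi_test tchi)).1.
  have -> : nrm2 f = nrm2 (Hop h chi) by exact: eq_ip.
  have -> : qform a b f f = qform a b (Hop h chi) (Hop h chi); last by [].
  have sE t : 0 < t -> Hsub a f t = Hsub a (Hop h chi) t.
    by move=> t0; rewrite /Hsub fE// (eq_Hop h t fE).
  by rewrite /qform; congr (_ + _ * _); exact: eq_ip.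
have vr : orth_ker r by apply: orth_ker_cvg sr ur => n; exact: SV.
exists r; split=> //.
  have v2 := orth_ker_Hsub a (orth_ker_Hsub a vr).
  have v3 := orth_kerDZ (b ^+ 2) v2 vr.
  have v4 : orth_ker (fun t => Hsub a (Hsub a r) t + b ^+ 2 * r t - g t).
    have := orth_kerDZ (-1) v3 vg; congr orth_ker; apply/funext => t; by rewrite mulN1r.
  apply: orth_ker_eq0 v4 _ => chi tchi.
  have sH := (Hop_sqi hC (sqi_test tchi)).1.
  rewrite ipBl//; last exact: v3.1.
  rewrite -qform_sqi// rE ?subrr//; split=> //; by exists chi.
have [->|n0] := eqVneq (nrm2 r) 0; first by rewrite mulr0 ip_ge0.
have np : 0 < nrm2 r by rewrite lt_def n0 ip_ge0.
have h0 : 0 <= c * nrm2 r by rewrite mulr_ge0// ltW.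
have : (c * nrm2 r) ^+ 2 <= nrm2 g * nrm2 r.
  apply: le_trans (ip_cs sg sr); rewrite lerXn2r ?nnegrE//; exact: le_trans rle.
by rewrite exprMn (expr2 (nrm2 r)) mulrA ler_pM2r.
Qed.

(** With [r] solving [((H - a) ^ 2 + b ^ 2) r = g], the function [(H - a + i
    b) r] solves [(H - z) f = g] for [z = a +i* b]; the equations are the real
    and imaginary parts of it. *)
Theorem shifted_hankel_solvable a b c : 0 < c -> coercive_at a b c ->
  exists2 K : R, 0 <= K &
  forall g1 g2, orth_ker g1 -> orth_ker g2 -> exists f1 f2, [/\ orth_ker f1, orth_ker f2,
    aez (fun t => Hsub a f1 t + b * f2 t - g1 t),
    aez (fun t => Hsub a f2 t - b * f1 t - g2 t) &
    nrm2 f1 + nrm2 f2 <= K * (nrm2 g1 + nrm2 g2)].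
Proof.
move=> c0 hc; pose K1 := 2 * ((4 * C) ^+ 2 + a ^+ 2).
have K10 : 0 <= K1 by rewrite mulr_ge0// addr_ge0// sqr_ge0.
have cc : 0 < c ^+ 2 by rewrite exprn_gt0.
have K20 : 0 <= 2 * (K1 + b ^+ 2) by rewrite mulr_ge0// addr_ge0// sqr_ge0.
exists (2 * (K1 + b ^+ 2) / c ^+ 2); first by rewrite divr_ge0// ltW.
move=> g1 g2 v1 v2.
have [r1 [w1 e1 n1]] := coercive_square_solvable c0 hc v1.
have [r2 [w2 e2 n2]] := coercive_square_solvable c0 hc v2.
have y1 := orth_ker_Hsub a w1; have y2 := orth_ker_Hsub a w2.
have [[sy1 _] [sy2 _]] := conj y1 y2; have [[s1 _] [s2 _]] := conj w1 w2.
exists (fun t => Hsub a r1 t + (- b) * r2 t), (fun t => Hsub a r2 t + b * r1 t); split.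
- exact: orth_kerDZ.
- exact: orth_kerDZ.
- apply: filterS e1 => t ht t0; rewrite -(ht t0) (HsubDZ a (- b) sy1 s2 ((RplusE t).1 t0)); ring.
- apply: filterS e2 => t ht t0; rewrite -(ht t0) (HsubDZ a b sy2 s1 ((RplusE t).1 t0)); ring.
have m1 := nrm2_addZ_le (- b) sy1 s2; have m2 := nrm2_addZ_le b sy2 s1.
have m3 := nrm2_Hsub a s1; have m4 := nrm2_Hsub a s2.
have q1 : nrm2 r1 <= nrm2 g1 / c ^+ 2 by rewrite ler_pdivlMr// mulrC.
have q2 : nrm2 r2 <= nrm2 g2 / c ^+ 2 by rewrite ler_pdivlMr// mulrC.
apply: (@le_trans _ _ (2 * (K1 + b ^+ 2) * (nrm2 r1 + nrm2 r2))).
  by move: m1 m2 m3 m4; rewrite sqrrN -/K1; lra.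
by rewrite -[leRHS]mulrA; apply: ler_wpM2l => //; rewrite mulrC mulrDl; exact: lerD.
Qed.

(** Duality: [w1] is of the form [((H - a) ^ 2 + b ^ 2) r], and moving this
    operator to the other side of the inner product annihilates [w1]. *)
Lemma shifted_hankel_injective_fst a b c w1 w2 : 0 < c -> coercive_at a b c ->
  orth_ker w1 -> orth_ker w2 -> aez (fun t => Hsub a w1 t + b * w2 t) ->
  aez (fun t => Hsub a w2 t - b * w1 t) -> aez w1.
Proof.
move=> c0 hc v1 v2 e1 e2; have [s1 _] := v1; have [s2 _] := v2.
have [r [[sr _] er _]] := coercive_square_solvable c0 hc v1.
have sar := sqi_Hsub a sr; have saar := sqi_Hsub a sar.
have [sa1 sa2] : sqi (Hsub a w1) /\ sqi (Hsub a w2) by split; exact: sqi_Hsub.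
have E := ae_ip_r s1 (sqiD saar (sqiZ (b ^+ 2) sr)) s1 er.
apply: (ip0_aez s1); rewrite -E ipC -qform_sqi// /qform.
have sb1 := sqiZ (- b) s2; have sb2 := sqiZ b s1.
have E1 : ip (Hsub a r) (Hsub a w1) = ip (Hsub a r) (fun t => - b * w2 t).
  apply: ae_ip_r => //; apply: filterS e1 => t ht t0.
  by rewrite -(ht t0) mulNr opprK.
have E2 := ae_ip_r sr sa2 sb2 e2.
by rewrite E1 (ipZr _ s2 sar) (Hsub_sym a sr s2) E2 (ipZr _ s1 sr); ring.
Qed.

Theorem shifted_hankel_injective a b c w1 w2 : 0 < c -> coercive_at a b c ->
  orth_ker w1 -> orth_ker w2 -> aez (fun t => Hsub a w1 t + b * w2 t) ->
  aez (fun t => Hsub a w2 t - b * w1 t) -> aez w1 /\ aez w2.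
Proof.
move=> c0 hc v1 v2 e1 e2; split; first exact: (shifted_hankel_injective_fst c0 hc v1 v2).
have hc' : coercive_at a (- b) c by move=> chi /hc; rewrite /qform sqrrN.
apply: (shifted_hankel_injective_fst c0 hc' v2 v1).
  by apply: filterS e2 => t ht t0; rewrite -(ht t0) mulNr.
by apply: filterS e1 => t ht t0; rewrite -(ht t0) mulNr opprK.
Qed.

End resolvent.

(** * Generalized eigenvalues and coercivity *)

Section generalized_eigenvalues.
Context {R : realType}.
Implicit Types (f u v chi : R -> R) (t a b E : R).
Variables (h : R -> R) (C : R) (hC : hankel_like h C).

(** The real counterpart of a non-zero solution in the class [B0]. *)
Definition generalized_eigenfunction E f : Prop :=
  [/\ measurable_fun Rplus f,
      (forall e : R, 0 < e < 2^-1 -> exists2 M : R, 0 < M &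
         forall t : R, 0 < t -> `|f t| <= M * wt e t),
      (exists2 t : R, 0 < t & f t != 0) &
      forall t : R, 0 < t -> Hop h f t = E * f t].

Definition generalized_eigenvalue E : Prop :=
  0 < E /\ exists f, generalized_eigenfunction E f.

Lemma coercive_at_nonreal a b : coercive_at h a b (b ^+ 2).
Proof. by move=> chi _; rewrite /qform lerDr ip_ge0. Qed.

(** The contrapositive of [generalized_eigenfunction_near]. *)
Lemma coercive_at_far (E0 del : R) : 0 < del ->
  (forall E, generalized_eigenvalue E -> del < `|E - E0|) ->
  coercive_at h E0 0 (del ^+ 2).
Proof.
move=> del0 far chi [cchi [M chiM]].
rewrite /qform expr0n mul0r addr0 leNgt; apply/negP => lt.
have [E [f [dE [E0' mf] fB fn fE]]] := generalized_eigenfunction_near hC cchi chiM del0 lt.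
by have /far : generalized_eigenvalue E; [split => //; exists f|rewrite ltNge dE].
Qed.

(** Applying the operator to a quasimode moves it into the complement of the
    null space; since [H u] is close to [E u] with [E > 0], its norm stays
    comparable to that of [u]. *)
Lemma generalized_eigenvalue_quasimode E (eta : R) : generalized_eigenvalue E -> 0 < eta ->
  exists v, [/\ orth_ker h v, 0 < nrm2 v & nrm2 (Hsub h E v) <= eta * nrm2 v].
Proof.
move=> [E0 [f [mf fB fn fE]]] eta0; have C0 := hk_C hC.
pose L := (4 * C) ^+ 2; have L0 : 0 < L by rewrite exprn_gt0// mulr_gt0.
pose th : R := Num.min (E ^+ 2 / 4) (eta * E ^+ 2 / (4 * L)).
have EE : 0 < E ^+ 2 by rewrite exprn_gt0.
(* The first bound on [th] keeps [H u] comparable to [E u], the second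
   absorbs the norm of [H] and the loss in that comparison. *)
have th0 : 0 < th by rewrite lt_min !divr_gt0// mulr_gt0.
have th1 : th <= E ^+ 2 / 4 by rewrite ge_min lexx.
have th2 : th <= eta * E ^+ 2 / (4 * L) by rewrite ge_min lexx orbT.
have [u [su u0 hu]] := schnol_quasimode hC E0 mf fB fn fE th0.
have [sH nH] := Hop_sqi hC su; have se := sqi_Hsub hC E su.
have vle : E ^+ 2 / 4 * nrm2 u <= nrm2 (Hop h u).
  have := nrm2_addZ_le (-1) sH se.
  rewrite (_ : nrm2 (fun t => _) = E ^+ 2 * nrm2 u); last first.
    transitivity (ip (fun t => E * u t) (fun t => E * u t)).
      by apply: eq_ip => t t0; rewrite /Hsub; ring.
    by rewrite (ipZl E su (sqiZ E su)) (ipZr E su su) mulrA -expr2.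
  have : nrm2 (Hsub h E u) <= E ^+ 2 / 4 * nrm2 u.
    by apply: le_trans hu _; apply: ler_wpM2r => //; exact: ip_ge0.
  by rewrite sqrrN expr1n; lra.
exists (Hop h u); split; first exact: (orth_ker_Hop hC su).
  by apply: lt_le_trans vle; rewrite mulr_gt0// divr_gt0.
have -> : nrm2 (Hsub h E (Hop h u)) = nrm2 (Hop h (Hsub h E u)).
  apply: eq_ip => t t0; rewrite /Hsub; have := HopDZ hC (- E) (sqi_adm sH) (sqi_adm su) t0.
    by rewrite mulNr => <-; apply: eq_Hop => s s0; rewrite mulNr.
  by rewrite mulNr => <-; apply: eq_Hop => s s0; rewrite mulNr.
apply: le_trans (Hop_sqi hC se).2 _; rewrite -/L.
apply: (@le_trans _ _ (L * (th * nrm2 u))); first by rewrite ler_pM2l.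
apply: (@le_trans _ _ (eta * (E ^+ 2 / 4 * nrm2 u))); last by rewrite ler_pM2l.
have -> : L * (th * nrm2 u) = L * th * nrm2 u by ring.
have -> : eta * (E ^+ 2 / 4 * nrm2 u) = L * (eta * E ^+ 2 / (4 * L)) * nrm2 u.
  by field; rewrite gt_eqF.
by apply: ler_wpM2r; [exact: ip_ge0|rewrite ler_pM2l].
Qed.

End generalized_eigenvalues.

(** * Complex-valued functions *)

Section complex_functions_facts.
Context {R : realType}.
Implicit Types (f g : R -> R[i]) (x y z : R[i]) (u v : R -> R) (a b c t : R).
Notation leb := (@lebesgue_measure R).
Local Open Scope complex_scope.

Definition fRe f t : R := complex.Re (f t).
Definition fIm f t : R := complex.Im (f t).
Definition cplx u v t : R[i] := u t +i* v t.

Lemma complex_ext x y : complex.Re x = complex.Re y -> complex.Im x = complex.Im y -> x = y.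
Proof. by case: x y => [a b] [c d] /= -> ->. Qed.

Lemma cReM x y : complex.Re (x * y) =
  complex.Re x * complex.Re y - complex.Im x * complex.Im y.
Proof. by case: x y => [a b] [c d]. Qed.

Lemma cImM x y : complex.Im (x * y) =
  complex.Re x * complex.Im y + complex.Im x * complex.Re y.
Proof. by case: x y => [a b] [c d]. Qed.

Lemma cReJ x : complex.Re (Num.conj x) = complex.Re x.
Proof. by case: x. Qed.

Lemma cImJ x : complex.Im (Num.conj x) = - complex.Im x.
Proof. by case: x. Qed.

Lemma cReB x y : complex.Re (x - y) = complex.Re x - complex.Re y.
Proof. by case: x y => [a b] [c d]. Qed.

Lemma cImB x y : complex.Im (x - y) = complex.Im x - complex.Im y.
Proof. by case: x y => [a b] [c d]. Qed.

Lemma cnormE x : Normc.normc x = Num.sqrt (complex.Re x ^+ 2 + complex.Im x ^+ 2).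
Proof. by case: x. Qed.

Lemma norm_Re_le x : `|complex.Re x| <= Normc.normc x.
Proof.
rewrite cnormE -sqrtr_sqr ler_wsqrtr// lerDl; exact: sqr_ge0.
Qed.

Lemma norm_Im_le x : `|complex.Im x| <= Normc.normc x.
Proof.
rewrite cnormE -sqrtr_sqr ler_wsqrtr// lerDr; exact: sqr_ge0.
Qed.

Lemma aeqP f g : aeq f g <->
  aez (fun t => fRe f t - fRe g t) /\ aez (fun t => fIm f t - fIm g t).
Proof.
split=> [e|[e1 e2]].
  by split; apply: filterS e => t ht t0; rewrite /fRe /fIm (ht t0) /cst subrr.
apply: filterS2 e1 e2 => t h1 h2 t0; move: (h1 t0) (h2 t0) => /eqP + /eqP.
by rewrite !subr_eq0 => /eqP e3 /eqP e4; exact: complex_ext.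
Qed.

Lemma L2normE f : cmeasurable f ->
  L2norm f = ((\int[leb]_(t in Rplus) (fRe f t ^+ 2 + fIm f t ^+ 2)%:E) `^ 2^-1)%E.
Proof.
move=> [m1 m2]; rewrite /L2norm unlock /=; congr (_ `^ _)%E.
rewrite [RHS]integral_mkcond; apply: eq_integral => t _.
rewrite !patchE; case: ifPn => _ /=; last by rewrite normr0 powR0.
have p0 : 0 <= complex.Re (f t) ^+ 2 + complex.Im (f t) ^+ 2.
  by rewrite addr_ge0 ?sqr_ge0.
rewrite cnormE ger0_norm ?sqrtr_ge0// -[2]/(2%:R) powR_mulrn ?sqrtr_ge0//.
by rewrite sqr_sqrtr.
Qed.

Definition cnrm2 f : R := nrm2 (fRe f) + nrm2 (fIm f).

Lemma L2P f : L2 f <-> sqi (fRe f) /\ sqi (fIm f).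
Proof.
split.
  move=> [[m1 m2]]; rewrite L2normE// => lty.
  have mR : measurable_fun Rplus (fun t => fRe f t ^+ 2) by exact: measurable_funX.
  have mI : measurable_fun Rplus (fun t => fIm f t ^+ 2) by exact: measurable_funX.
  have j : itg (fun t => fRe f t ^+ 2 + fIm f t ^+ 2).
    apply/integrableP; split; first by apply/measurable_EFinP; exact: measurable_funD.
    rewrite ltNge; apply/negP; rewrite leye_eq => /eqP e.
    move: lty; rewrite (_ : (\int[leb]_(t in Rplus) _)%E = +oo%E).
      by rewrite poweRyr ?invr_neq0// ltxx.
    rewrite -e; apply: eq_integral => t _ /=.
    by rewrite ger0_norm// addr_ge0 ?sqr_ge0.
  by split; split=> //; apply: (itg_le _ j) => // t t0;
    rewrite ger0_norm ?sqr_ge0// ?lerDl ?lerDr sqr_ge0.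
move=> [[m1 j1] [m2 j2]]; split; first by [].
rewrite L2normE//; apply: poweR_lty; have := itgD j1 j2.
move=> /integrableP[_]; congr (_ < _)%E; apply: eq_integral => t _ /=.
by rewrite ger0_norm// addr_ge0 ?sqr_ge0.
Qed.

Lemma L2norm_cnrm2 f : L2 f -> L2norm f = (Num.sqrt (cnrm2 f))%:E.
Proof.
move=> Lf; have [[m1 j1] [m2 j2]] := (L2P f).1 Lf.
rewrite L2normE// -EFin_Int; last exact: itgD.
rewrite IntD// poweR_EFin powR12_sqrt//.
by rewrite addr_ge0// Int_ge0// => t _; exact: sqr_ge0.
Qed.

Lemma cnrm2_aeq f g : L2 f -> L2 g -> aeq f g -> cnrm2 f = cnrm2 g.
Proof.
move=> /L2P[r1 i1] /L2P[r2 i2] /aeqP[e1 e2]; rewrite /cnrm2 /nrm2.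
congr (_ + _); first by rewrite (ae_ip_r r1 r1 r2 e1) ipC (ae_ip_r r2 r1 r2 e1).
by rewrite (ae_ip_r i1 i1 i2 e2) ipC (ae_ip_r i2 i1 i2 e2).
Qed.

Lemma L2innerE f g : L2 f -> L2 g -> L2inner f g =
  (ip (fRe f) (fRe g) + ip (fIm f) (fIm g)) +i*
  (ip (fIm f) (fRe g) - ip (fRe f) (fIm g)).
Proof.
move=> /L2P[r1 i1] /L2P[r2 i2]; rewrite /L2inner /cintegral.
congr (_ +i* _).
  rewrite /ip -IntD; [|exact: sqiM..]; apply: eq_Int => t _.
  by rewrite cReM cReJ cImJ mulrN opprK.
rewrite /ip -IntB; [|exact: sqiM..]; apply: eq_Int => t _.
by rewrite cImM cReJ cImJ mulrN addrC.
Qed.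

End complex_functions_facts.

(** * The complex Hankel operator *)

Section hankel_complexification.
Context {R : realType}.
Implicit Types (f g k : R -> R[i]) (z : R[i]) (u v : R -> R) (a b c t : R).
Local Open Scope complex_scope.
Variables (mu : {measure set (measurableTypeR R) -> \bar R}) (C : R).
Hypothesis hC : hankel_like (hankel_kernel mu) C.
Notation h := (hankel_kernel mu).
Notation H := (hankel mu).
Notation V := (L2orth (opKer H)).

Lemma fRe_hankel f : fRe (H f) = Hop h (fRe f).
Proof. by apply/funext => t; apply: eq_Int => s _; rewrite cReM /= mul0r subr0. Qed.

Lemma fIm_hankel f : fIm (H f) = Hop h (fIm f).
Proof. by apply/funext => t; apply: eq_Int => s _; rewrite cImM /= mul0r addr0. Qed.

Lemma fRe_hankel_sub z f : fRe (fun t => H f t - z * f t) =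
  (fun t => Hsub h (complex.Re z) (fRe f) t + complex.Im z * fIm f t).
Proof.
apply/funext => t; rewrite {1}/fRe cReB -/(fRe (H f) t) fRe_hankel cReM /Hsub /fRe /fIm; ring.
Qed.

Lemma fIm_hankel_sub z f : fIm (fun t => H f t - z * f t) =
  (fun t => Hsub h (complex.Re z) (fIm f) t - complex.Im z * fRe f t).
Proof.
apply/funext => t; rewrite {1}/fIm cImB -/(fIm (H f) t) fIm_hankel cImM /Hsub /fRe /fIm; ring.
Qed.

Lemma Hop0 t : Hop h (fun=> 0) t = 0.
Proof. by rewrite /Hop -[RHS]Int0; apply: eq_Int => s _; rewrite mulr0. Qed.

Lemma opKerP k : opKer H k <-> [/\ sqi (fRe k), sqi (fIm k),
  aez (Hop h (fRe k)) & aez (Hop h (fIm k))].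
Proof.
rewrite /opKer/=; split.
  move=> [/L2P[s1 s2] /aeqP[e1 e2]]; split=> //.
    by apply: filterS e1 => t ht t0; rewrite -(ht t0) -fRe_hankel /fRe /= subr0.
  by apply: filterS e2 => t ht t0; rewrite -(ht t0) -fIm_hankel /fIm /= subr0.
move=> [s1 s2 e1 e2]; split; first exact/L2P.
by apply/aeqP; split; [apply: filterS e1|apply: filterS e2] => t ht t0;
  rewrite -(ht t0) -?fRe_hankel -?fIm_hankel /fRe /fIm /= subr0.
Qed.

Lemma L2orthP f : V f <-> orth_ker h (fRe f) /\ orth_ker h (fIm f).
Proof.
split.
  move=> [Lf of_]; have [s1 s2] := (L2P f).1 Lf.
  have main (k : R -> R) : sqi k -> aez (Hop h k) -> ip (fRe f) k = 0 /\ ip (fIm f) k = 0.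
    move=> sk k0.
    (* A real element of the null space is a complex one, and pairing with it
       separates real and imaginary parts. *)
    have kk : opKer H (cplx k (fun=> 0)).
      apply/opKerP; split=> //; first exact: sqi0.
      by apply: filterE => t _; exact: Hop0.
    have := of_ _ kk; rewrite L2innerE//; last by case: kk.
    have z0 (q : R -> R) : ip q (fIm (cplx k (fun=> 0))) = 0.
      by rewrite /ip -[RHS]Int0; apply: eq_Int => t _; rewrite mulr0.
    by rewrite !z0 addr0 subr0 => -[].
  by split; split=> // k sk k0; have [] := main k sk k0.
move=> [[s1 o1] [s2 o2]]; have Lf : L2 f by exact/L2P.
split=> // k kk; have [Lk _] := kk; rewrite L2innerE//.
have [q1 q2 e1 e2] := (opKerP k).1 kk.
by rewrite !o1 ?o2// addr0 subr0.
Qed.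

(** The real system solved by [shifted_hankel_solvable] is the complex
    equation. *)
Lemma coercive_resolvent z c : 0 < c -> coercive_at h (complex.Re z) (complex.Im z) c ->
  resolvent_set V H z.
Proof.
move=> c0 hc; have [K K0 hK] := shifted_hankel_solvable hC c0 hc.
exists (Num.sqrt K) => g Vg; have [v1 v2] := (L2orthP g).1 Vg.
have [k1 [k2 [p1 p2 e1 e2 n12]]] := hK _ _ v1 v2.
have Vf : V (cplx k1 k2) by apply/L2orthP.
exists (cplx k1 k2); split=> //.
- by apply/aeqP; rewrite fRe_hankel_sub fIm_hankel_sub.
- rewrite !L2norm_cnrm2; [|by case: Vg|by case: Vf].
  by rewrite -EFinM lee_fin -sqrtrM// ler_wsqrtr.
- move=> f' Vf' /aeqP[]; rewrite fRe_hankel_sub fIm_hankel_sub => e1' e2'.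
  have [x1 x2] := (L2orthP f').1 Vf'.
  have d1 := orth_kerDZ (-1) x1 p1; have d2 := orth_kerDZ (-1) x2 p2.
  have [[[sx1 _] [sx2 _]] [[sp1 _] [sp2 _]]] := conj (conj x1 x2) (conj p1 p2).
  have [] := shifted_hankel_injective hC c0 hc d1 d2.
  + apply: filterS2 e1 e1' => t h1 h2 t0.
    rewrite (HsubDZ hC _ _ sx1 sp1 ((RplusE t).1 t0)).
    have := h1 t0; have := h2 t0; rewrite /cst; lra.
  + apply: filterS2 e2 e2' => t h1 h2 t0.
    rewrite (HsubDZ hC _ _ sx2 sp2 ((RplusE t).1 t0)).
    have := h1 t0; have := h2 t0; rewrite /cst; lra.
  move=> w1 w2; apply/aeqP; split; [apply: filterS w1|apply: filterS w2] => t ht t0;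
    by rewrite -(ht t0) mulN1r.
Qed.

(** A quasimode [v] at a nearby generalized eigenvalue has [nrm2 ((H - E0) v)]
    much smaller than [nrm2 v], while by uniqueness [v] is the solution that
    the resolvent bound estimates. *)
Lemma near_eigenvalue_spectrum (E0 : R) :
  (forall e : R, 0 < e -> exists2 E, generalized_eigenvalue h E & `|E - E0| < e) ->
  ~ resolvent_set V H E0%:C.
Proof.
move=> near [K hK].
(* Squaring the resolvent bound, the error [2 * (d + d) * K ^+ 2] must stay
   below 1. *)
pose d : R := (4 * (K ^+ 2 + 1))^-1.
have K1 : 0 < K ^+ 2 + 1 by rewrite ltr_wpDl// sqr_ge0.
have d0 : 0 < d by rewrite invr_gt0 mulr_gt0.
have d1 : d <= 1 / 4.
  by rewrite /d invfM div1r ler_pdivrMl// mulrV ?unitfE// ?invf_le1//; rewrite lerDr sqr_ge0.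
have [E gE Ed] := near d d0.
have [v [ov v0 hv]] := generalized_eigenvalue_quasimode hC gE d0.
have [sv _] := ov.
have og : orth_ker h (Hsub h E0 v) by exact: (orth_ker_Hsub hC).
have o0 : orth_ker h (fun=> 0).
  by split=> [|k _ _]; [exact: sqi0|rewrite /ip -[RHS]Int0; apply: eq_Int => s _; rewrite mul0r].
have Vg : V (cplx (Hsub h E0 v) (fun=> 0)) by apply/L2orthP.
have Vv : V (cplx v (fun=> 0)) by apply/L2orthP.
have [f [Vf _ nf uf]] := hK _ Vg.
have fv : aeq (cplx v (fun=> 0)) f.
  apply: uf => //; apply/aeqP; rewrite fRe_hankel_sub fIm_hankel_sub /=.
  split; apply: filterE => t _; rewrite /fRe /fIm /cst /=.
    by rewrite mul0r addr0 subrr.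
  by rewrite /Hsub Hop0 mulr0 mul0r !subr0.
have n0 : nrm2 (fun _ : R => 0) = 0 :> R.
  by rewrite /nrm2 /ip -[RHS]Int0; apply: eq_Int => t _; rewrite mul0r.
have cE u : cnrm2 (cplx u (fun=> 0)) = nrm2 u.
  by rewrite /cnrm2 (_ : nrm2 (fIm _) = 0) ?addr0//.
have [Lf _] := Vf; have [Lv _] := Vv; have [Lg _] := Vg.
move: nf; rewrite !L2norm_cnrm2// -EFinM lee_fin -(cnrm2_aeq Lv Lf fv) !cE => nf.
have q1 : nrm2 v <= K ^+ 2 * nrm2 (Hsub h E0 v).
  rewrite -[X in X <= _]sqr_sqrtr ?ip_ge0// -[X in _ <= _ * X]sqr_sqrtr ?ip_ge0//.
  rewrite -exprMn lerXn2r ?nnegrE ?sqrtr_ge0//; exact: le_trans nf.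
have q2 : nrm2 (Hsub h E0 v) <= 2 * (nrm2 (Hsub h E v) + (E - E0) ^+ 2 * nrm2 v).
  apply: le_trans (nrm2_addZ_le (E - E0) (sqi_Hsub hC E sv) sv).
  apply: le_of_eq; apply: eq_ip => t _; rewrite /Hsub; ring.
have q3 : (E - E0) ^+ 2 <= d.
  rewrite -[X in X ^+ 2 <= _]/(E - E0) -real_normK ?num_real//.
  have := normr_ge0 (E - E0); move: Ed d1 d0; nra.
have q4 : nrm2 v <= K ^+ 2 * (4 * d) * nrm2 v.
  apply: le_trans q1 _; rewrite -mulrA; apply: ler_wpM2l; first exact: sqr_ge0.
  apply: le_trans q2 _; have := ler_wpM2r (ltW v0) q3; move: hv; lra.
have q5 : K ^+ 2 * (4 * d) < 1.
  have -> : K ^+ 2 * (4 * d) = K ^+ 2 / (K ^+ 2 + 1) by rewrite /d; field; rewrite gt_eqF.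
  by rewrite ltr_pdivrMr// mul1r ltrDl.
by move: q4; rewrite leNgt gtr_pMl ?q5.
Qed.

End hankel_complexification.

(** * The classes of solutions *)

Section growth_classes.
Context {R : realType}.
Implicit Types (f : R -> R[i]) (u : R -> R) (t e : R).
Local Open Scope complex_scope.

Lemma wt_powR_lt1 e t : 0 < t < 1 -> wt e t = t `^ (- 2^-1 - e).
Proof.
move=> /andP[t0 t1]; rewrite /wt /powR gt_eqF// (ltr0_norm (ln_lt0 _)) ?t0//.
by congr expR; field.
Qed.

Lemma wt_powR_gt1 e t : 1 < t -> wt e t = t `^ (- 2^-1 + e).
Proof.
move=> t1; have t0 : 0 < t by exact: lt_trans t1.
rewrite /wt /powR gt_eqF// (gtr0_norm (ln_gt0 t1)).
by congr expR; field.
Qed.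

(** The conditions for [t < 1] and [t > 1] combine into one; the value at 1,
    on which the class imposes nothing, is absorbed by the constant. *)
Lemma BepsP e f : Beps e f <-> cmeasurable f /\ exists2 M : R, 0 < M &
  forall t, 0 < t -> Normc.normc (f t) <= M * wt e t.
Proof.
split=> -[mf [M M0]].
  move=> [b0 b1]; split=> //.
  exists (M + Normc.normc (f 1) / wt e 1).
    rewrite ltr_pwDl// divr_ge0 ?(ltW (wt_gt0 _ _))// cnormE; exact: sqrtr_ge0.
  have n1 : 0 <= Normc.normc (f 1) / wt e 1.
    by rewrite divr_ge0 ?(ltW (wt_gt0 _ _))// cnormE; exact: sqrtr_ge0.
  move=> t t0; have w0 := ltW (wt_gt0 e t).
  rewrite mulrDl; have [t1|t1|->] := ltgtP t 1.
  - have t01 : 0 < t < 1 by rewrite t0.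
    apply: le_trans (b0 t t01) _; rewrite -wt_powR_lt1// lerDl; exact: mulr_ge0.
  - by apply: le_trans (b1 t t1) _; rewrite -wt_powR_gt1// lerDl; exact: mulr_ge0.
  - by rewrite divfK ?gt_eqF ?wt_gt0// lerDr mulr_ge0// ltW// wt_gt0.
move=> b; split=> //; exists M => //; split=> t.
  by move=> t01; rewrite -wt_powR_lt1//; apply: b; case/andP: t01.
by move=> t1; rewrite -wt_powR_gt1//; apply: b; exact: lt_trans t1.
Qed.

(** The kernel being real, the real and imaginary parts of a solution are
    solutions, and one of them is not zero. *)
Lemma generalized_eigenvalueP (mu : {measure set (measurableTypeR R) -> \bar R}) E :
  generalized_eigenvalue (hankel_kernel mu) E <-> 0 < E /\
    exists f : R -> R[i], [/\ B0 f, (exists2 t : R, 0 < t & f t != 0) &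
      hankel_equation mu E f].
Proof.
split=> -[E0].
  move=> [u [mu_ uB [t t0 ut] uE]]; split=> //; exists (cplx u (fun=> 0)); split.
  - move=> e e0; apply/BepsP; split; first by split=> //; exact: measurable_cst.
    have [M M0 uM] := uB e e0; exists M => // s s0.
    by rewrite cnormE /= expr0n/= addr0 sqrtr_sqr; exact: uM.
  - by exists t => //; apply: contra_neq ut => /(congr1 (@complex.Re R)).
  - move=> s s0; apply: complex_ext.
      by rewrite -/(fRe _ _) fRe_hankel cReM /= mul0r subr0 uE.
    by rewrite -/(fIm _ _) fIm_hankel cImM /= mul0r addr0 mulr0 Hop0.
move=> [f [fB [t t0 ft] fE]]; split=> //.
have mf : cmeasurable f by have [|//] := fB 4^-1; apply/andP; split; lra.
have bnd e : 0 < e < 2^-1 -> exists2 M : R, 0 < M &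
    forall t, 0 < t -> Normc.normc (f t) <= M * wt e t.
  by move=> /fB/BepsP[].
have [r0|r0] := eqVneq (fRe f t) 0.
  have i0 : fIm f t != 0.
    by apply: contra_neq ft => i0; apply: complex_ext.
  exists (fIm f); split; [by case: mf| |by exists t|].
    move=> e /bnd[M M0 hM]; exists M => // s s0.
    by apply: le_trans (hM s s0); exact: norm_Im_le.
  by move=> s s0; rewrite -fIm_hankel /fIm fE// cImM /= mul0r addr0.
exists (fRe f); split; [by case: mf| |by exists t|].
  move=> e /bnd[M M0 hM]; exists M => // s s0.
  by apply: le_trans (hM s s0); exact: norm_Re_le.
by move=> s s0; rewrite -fRe_hankel /fRe fE// cReM /= mul0r subr0.
Qed.

End growth_classes.

(** * The spectrum *)

Local Open Scope complex_scope.

Theorem corollary1p8 (R : realType)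
    (mu : {measure set (measurableTypeR R) -> \bar R})
    (hmu : carleson mu)
    (hH : exists f : R -> R[i], L2 f /\ ~ aeq (hankel mu f) (cst 0)) :
  spectrum (L2orth (opKer (hankel mu))) (hankel mu) =
  [set E%:C | E in closure [set E : R | 0 < E /\
    exists f : R -> R[i], [/\ B0 f, (exists2 t : R, 0 < t & f t != 0) &
      hankel_equation mu E f]]].
Proof.
have [C hC] := hankel_like_kernel hmu.
rewrite (_ : [set E : R | _] = generalized_eigenvalue (hankel_kernel mu)); last first.
  by apply/seteqP; split=> E; rewrite /= generalized_eigenvalueP.
apply/seteqP; split=> [z zs|_ [E0 E0c <-]].
  have zreal : complex.Im z = 0.
    apply/eqP; apply: contra_notT zs => b0.
    apply: (coercive_resolvent hC) (coercive_at_nonreal _ _ _).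
    by rewrite lt_def sqrf_eq0 b0 sqr_ge0.
  exists (complex.Re z); last by apply: complex_ext.
  apply: contrapT => ncl; apply: zs.
  have [B zB BS] : exists2 B, nbhs (complex.Re z) B &
      forall E, generalized_eigenvalue (hankel_kernel mu) E -> ~ B E.
    apply: contrapT => nB; apply: ncl => B zB; apply: contrapT => nE.
    by apply: nB; exists B => // E gE BE; apply: nE; exists E.
  have [e /= e0 eB] := (nbhs_ballP _ _).1 zB.
  have e20 : 0 < e / 2 by rewrite divr_gt0.
  apply: (coercive_resolvent hC (c := (e / 2) ^+ 2)); first by rewrite exprn_gt0.
  rewrite zreal; apply: (coercive_at_far hC e20) => E gE.
  rewrite ltNge; apply/negP => le; apply: (BS E gE); apply: eB.
  by rewrite /ball /= distrC; apply: le_lt_trans le _; rewrite ltr_pdivrMr// mulr_natr mulr2n ltrDl.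
apply: (near_eigenvalue_spectrum hC) => e e0.
have [E [gE bE]] := E0c _ (nbhsx_ballx E0 e e0).
by exists E => //; rewrite distrC.
Qed.
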